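(* Let $M$ be a closed manifold and $X=-\mathrm{grad}_g(f)$ a Morse--Bott--Smale vector field on $M$. Then the space $\hat W^-$ (the completed unstable manifold of $X$, by broken trajectories) is compact.
   Context: Let $f:M\to\mathbb R$ be smooth with critical set $\Sigma$. The Hessian is $H(Y,Z)=Y\cdot df(Z)$ on $TM|_\Sigma$. $f$ is Morse--Bott if $\Sigma$ is a closed submanifold and $H$ is non-degenerate on $N=TM|_\Sigma/T\Sigma$. A metric $g$ is compatible with $f$ if there are an $H$-orthogonal splitting $N=N^+\oplus N^-$ with $\pm H|_{N^\pm}>0$, a metric on $\Sigma$, linear connections on $N^\pm$ with $H|_{N^\pm}$ parallel, and a tubular neighborhood $\varphi:N\to M$ of $\Sigma$ such that near the zero section $\varphi^*df=d(\frac12H(Y,Y))$ and $\varphi^*g$ is the metric on the total space of $N$ determined by the metric on $\Sigma$ (horizontal part), $H|_{N^+}\oplus(-H|_{N^-})$ (vertical part), horizontal $\perp$ vertical. Let $X=-\mathrm{grad}_gf$ with flow $\phi_t$. For a connected component $S\subseteq\Sigma$ let $W^\pm_S=\{x:\lim_{t\to\pm\infty}\phi_t(x)\in S\}$ (smooth submanifolds), $p_\pm:W^\pm_S\to S$ the limit maps (smooth fiber bundles), $W^-_x$ the fiber of $p_-$ over $x$, $W^-=\bigsqcup_SW^-_S$, $i_-:W^-\to M$ the immersion given by inclusions. $(f,g)$ is a Morse--Bott--Smale pair, and $X$ a Morse--Bott--Smale vector field, if $g$ is compatible with $f$ and $W^-_x$ is transversal to $W^+_S$ for all $x\in\Sigma$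 and all $S$. For components $S\neq S'$ let $\mathcal T(S,S')=(W^-_S\cap W^+_{S'})/\mathbb R$ (quotient by the flow), $\mathcal T=\bigsqcup_{S\ne S'}\mathcal T(S,S')$, with starting-point map $\pi_-$ and end-point map $\pi_+$ to $\Sigma$. For $k\ge0$, $(\hat W^-)_k=\mathcal T\times_\Sigma\cdots\times_\Sigma\mathcal T\times_\Sigma W^-$ ($k$ factors $\mathcal T$; consecutive elements satisfy $\pi_+(t_i)=\pi_-(t_{i+1})$, and $\pi_+(t_k)=p_-(w)$), $\hat W^-=\bigsqcup_{k\ge0}(\hat W^-)_k$. $\hat i:\hat W^-\to M$ is $i_-$ of the last factor; $\hat p_-:\hat W^-\to\Sigma$ is $\pi_-$ of the first factor if $k\ge1$ and $p_-$ if $k=0$. Topology: for a component $S$ let $\hat W^-_S=\hat p_-^{-1}(S)$, $b=f(S)$, $a=\min_Mf$; an element $x\in\hat W^-_S$ is regarded as a path $\sigma\in C^0([a,b],M)$ from $S$ to $\hat i(x)$ along the broken trajectory with $f(\sigma(t))=a+b-t$ for $a\le t\le a+b-f(\hat i(x))$ and $\sigma$ constant equal to $\hat i(x)$ for $a+b-f(\hat i(x))\le t\le b$. $\hat W^-_S$ carries the topology induced from $C^0([a,b],M)$, and $\hat W^-$ is the disjoint union of the $\hat W^-_S$. *)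

(* Defs.v *)
From mathcomp Require Import all_boot all_order all_algebra.
From mathcomp Require Import all_classical all_reals all_analysis.
Import Order.TTheory GRing.Theory Num.Theory.
Import numFieldNormedType.Exports.
Set Implicit Arguments.
Unset Strict Implicit.
Unset Printing Implicit Defensive.
Local Open Scope classical_set_scope.
Local Open Scope ring_scope.

Fixpoint Ck (R : realType) (V W : normedModType R) (k : nat)
    (U : set V) (F : V -> W) : Prop :=
  match k with
  | 0 => forall x, U x -> {for x, continuous F}
  | k'.+1 => (forall x, U x -> differentiable F x) /\
             (forall v : V, Ck k' U (fun x => 'D_v F x))
  end.

Definition smooth_on (R : realType) (V W : normedModType R)
    (U : set V) (F : V -> W) : Prop :=
  open U /\ forall k, Ck k U F.

(* An atlas lives on a subset of its carrier type [T], namely the union of the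
   domains of its charts, and the dimension may depend on the chart.  Hence a
   submanifold of [M] of non-constant dimension, or the total space of a vector
   bundle, is an atlas on an ambient type, and the notions below (smooth map,
   tangent vector, metric, ...) apply to all of them. *)

Record chart (R : realType) (T : Type) (m : nat) := Chart {
  cdom : set T;
  cfun : T -> 'rV[R]_m;
  cinv : 'rV[R]_m -> T }.

Definition ccod (R : realType) (T : Type) m (c : chart R T m) : set 'rV[R]_m :=
  cfun c @` cdom c.

Definition atlas (R : realType) (T : Type) := forall m, set (chart R T m).

Definition chart_ok (R : realType) (T : Type) m (c : chart R T m) : Prop :=
  (forall p, cdom c p -> cinv c (cfun c p) = p) /\ open (ccod c).

Definition compatible (R : realType) (T : Type) m k
    (c : chart R T m) (d : chart R T k) : Prop :=
  smooth_on (cfun c @` (cdom c `&` cdom d)) (cfun d \o cinv c).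

Definition max_atlas (R : realType) (T : Type) (A : atlas R T) : atlas R T :=
  fun m c => chart_ok c /\
    forall k (d : chart R T k), A k d -> compatible c d /\ compatible d c.

Definition covers (R : realType) (T : Type) (A : atlas R T) (p : T) : Prop :=
  exists m (c : chart R T m), A m c /\ cdom c p.

(* Second countability follows from compactness. *)
Definition closed_manifold (R : realType) (M : topologicalType) (n : nat)
    (A : atlas R M) : Prop :=
  [/\ compact [set: M], hausdorff_space M, forall p, covers A p &
      forall m (c : chart R M m), A m c ->
        [/\ m = n, open (cdom c), max_atlas A c &
            forall U, U `<=` cdom c -> (open U <-> open (cfun c @` U))]].

Definition mnear (R : realType) (T : Type) (A : atlas R T) (p : T)
    (P : T -> Prop) : Prop :=
  exists m (c : chart R T m), [/\ A m c, cdom c p &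
    exists O : set 'rV[R]_m, [/\ open O, O (cfun c p), O `<=` ccod c &
      forall y, O y -> P (cinv c y)]].

Definition smooth_near (R : realType) (T : Type) (A : atlas R T)
    (h : T -> R) (p : T) : Prop :=
  exists m (c : chart R T m), [/\ A m c, cdom c p &
    exists O : set 'rV[R]_m, [/\ O (cfun c p), O `<=` ccod c &
      smooth_on O (h \o cinv c : _ -> R^o)]].

Definition smooth_map (R : realType) (T T' : Type) (A : atlas R T)
    (B : atlas R T') (F : T -> T') (p : T) : Prop :=
  exists m (c : chart R T m) k (d : chart R T' k),
    [/\ A m c, B k d, cdom c p, cdom d (F p) &
    exists O : set 'rV[R]_m, [/\ O (cfun c p), O `<=` ccod c,
      forall y, O y -> cdom d (F (cinv c y)) &
      smooth_on O (cfun d \o F \o cinv c)]].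

(* A tangent vector at [p] is the velocity of a smooth curve through [p],
   i.e. the derivation of the germs of smooth functions at [p] which it
   induces.  It is extended by 0 to the functions that are not smooth near
   [p], so that equality and the vector space structure are those of
   [(T -> R) -> R]. *)

Notation tvec R T := ((T -> R) -> R).

Definition smooth_curve (R : realType) (T : Type) (A : atlas R T)
    (gam : R -> T) : Prop :=
  exists m (c : chart R T m), A m c /\
    exists O : set R^o, [/\ O 0, forall t, O t -> cdom c (gam t) &
      smooth_on O (cfun c \o gam)].

Definition velocity (R : realType) (T : Type) (A : atlas R T)
    (gam : R -> T) : tvec R T :=
  fun h => if `[< smooth_near A h (gam 0) >]
           then derive1 (h \o gam : R^o -> R^o) 0 else 0.

(* T_p W, for W a submanifold of the manifold, as a subspace of T_p M *)
Definition tangent_in (R : realType) (T : Type) (A : atlas R T) (W : set T)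
    (p : T) : set (tvec R T) :=
  [set v | exists gam : R -> T, [/\ smooth_curve A gam, gam 0 = p,
     \forall t \near (0 : R), W (gam t) & v = velocity A gam]].

Definition tangent (R : realType) (T : Type) (A : atlas R T) (p : T) :=
  tangent_in A [set: T] p.

Definition dmap (R : realType) (T T' : Type) (A : atlas R T)
    (B : atlas R T') (F : T -> T') (p : T) (v : tvec R T) : tvec R T' :=
  fun h => if `[< smooth_near B h (F p) >] then v (h \o F) else 0.

Definition smooth_field (R : realType) (T : Type) (A : atlas R T)
    (X : T -> tvec R T) (p : T) : Prop :=
  mnear A p (fun y => tangent A y (X y)) /\
  forall h, smooth_near A h p -> smooth_near A (fun y => X y h) p.

Definition riemannian_metric (R : realType) (T : Type) (A : atlas R T)
    (g : T -> tvec R T -> tvec R T -> R) : Prop :=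
  forall p, covers A p ->
  [/\ forall u v w a, tangent A p u -> tangent A p v -> tangent A p w ->
        g p (a *: u + v) w = a * g p u w + g p v w,
      forall u v, tangent A p u -> tangent A p v -> g p u v = g p v u,
      forall v, tangent A p v -> v <> 0 -> 0 < g p v v &
      forall X Y, smooth_field A X p -> smooth_field A Y p ->
        smooth_near A (fun y => g y (X y) (Y y)) p].

Definition slice (R : realType) (T : Type) (W : set T) k l
    (c : chart R T (k + l)) : chart R T k :=
  Chart (cdom c `&` W) (fun p => lsubmx (cfun c p))
        (fun y => cinv c (row_mx y 0)).

Definition sub_atlas (R : realType) (T : Type) (A : atlas R T) (W : set T) :
    atlas R T :=
  fun k d => exists l (c : chart R T (k + l)), [/\ max_atlas A c,
    forall p, cdom c p -> (W p <-> rsubmx (cfun c p) = 0) & d = slice W c].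

Definition submanifold (R : realType) (T : Type) (A : atlas R T)
    (W : set T) : Prop :=
  forall p, W p -> covers (sub_atlas A W) p.

Definition crit (R : realType) (T : Type) (A : atlas R T) (f : T -> R) :
    set T :=
  [set p | covers A p /\ forall v, tangent A p v -> v f = 0].

(* Y . df(Z): at a critical point it does not depend on the local vector
   field [Zf] by which Z is extended. *)
Definition hess (R : realType) (T : Type) (A : atlas R T) (f : T -> R)
    (p : T) (Y Z : tvec R T) : R :=
  xget 0 [set r | exists Zf, [/\ smooth_field A Zf p, Zf p = Z &
                                 r = Y (fun y => Zf y f)]].

Definition morse_bott (R : realType) (M : topologicalType) (A : atlas R M)
    (f : M -> R) : Prop :=
  [/\ closed (crit A f), submanifold A (crit A f) &
      forall p Y, crit A f p -> tangent A p Y ->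
        (forall Z, tangent A p Z -> hess A f p Y Z = 0) ->
        tangent_in A (crit A f) p Y].

(* The normal bundle N = TM|_S / TS of a submanifold S:
   [q p : T_p M -> V] is any model of the quotient map T_p M -> T_p M / T_p S;
   the fibre N_p is its image.  The total space is a subset of [T * V]. *)

Definition quotient_model (R : realType) (T : Type) (A : atlas R T)
    (S : set T) (V : lmodType R) (q : T -> tvec R T -> V) : Prop :=
  forall p, S p ->
  (forall Y Z a, tangent A p Y -> tangent A p Z ->
     q p (a *: Y + Z) = a *: q p Y + q p Z) /\
  (forall Y, tangent A p Y -> (q p Y = 0 <-> tangent_in A S p Y)).

Definition nfib (R : realType) (T : Type) (A : atlas R T) (V : lmodType R)
    (q : T -> tvec R T -> V) (p : T) : set V :=
  q p @` tangent A p.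

Definition ntot (R : realType) (T : Type) (A : atlas R T) (S : set T)
    (V : lmodType R) (q : T -> tvec R T -> V) : set (T * V) :=
  [set e | S e.1 /\ nfib A q e.1 e.2].

(* The charts of N given by a chart [c] of S and a frame of N over its domain,
   the frame being induced by smooth vector fields [E i]. *)
Inductive natlas (R : realType) (T : Type) (A : atlas R T) (S : set T)
    (V : lmodType R) (q : T -> tvec R T -> V) :
    forall m, chart R (T * V) m -> Prop :=
| Natlas k l (c : chart R T k) (E : 'I_l -> T -> tvec R T)
    (C : chart R (T * V) (k + l)) of
    sub_atlas A S c &
    (forall i p, cdom c p -> smooth_field A (E i) p) &
    cdom C = [set e | cdom c e.1 /\ nfib A q e.1 e.2] &
    chart_ok C &
    ccod C = [set z | ccod c (lsubmx z)] &
    (forall z, ccod C z ->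
       let p := cinv c (lsubmx z) in
       cinv C z = (p, \sum_(i < l) rsubmx z 0 i *: q p (E i p))) :
    natlas A S q C.

Definition smooth_section (R : realType) (T : Type) (A : atlas R T)
    (S : set T) (V : lmodType R) (q : T -> tvec R T -> V)
    (s : T -> V) (p : T) : Prop :=
  smooth_map (sub_atlas A S) (natlas A S q) (fun y => (y, s y)) p.

Definition subbundle (R : realType) (T : Type) (A : atlas R T) (S : set T)
    (V : lmodType R) (q : T -> tvec R T -> V) (P : T -> set V) : Prop :=
  forall p, S p -> exists l (s : 'I_l -> T -> V),
    (forall i, smooth_section A S q (s i) p) /\
    mnear (sub_atlas A S) p (fun y =>
      P y = [set \sum_(i < l) a i *: s i y | a in [set: 'I_l -> R]] /\
      forall a : 'I_l -> R, \sum_(i < l) a i *: s i y = 0 ->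
        forall i, a i = 0).

Definition section_of (R : realType) (T : Type) (A : atlas R T) (S : set T)
    (V : lmodType R) (q : T -> tvec R T -> V) (P : T -> set V)
    (s : T -> V) (p : T) : Prop :=
  smooth_section A S q s p /\ mnear (sub_atlas A S) p (fun y => P y (s y)).

(* [D p v s] is the covariant derivative at [p], along v in T_p S, of the local
   section [s] of the subbundle [P] of N. *)
Definition linear_connection (R : realType) (T : Type) (A : atlas R T)
    (S : set T) (V : lmodType R) (q : T -> tvec R T -> V) (P : T -> set V)
    (D : T -> tvec R T -> (T -> V) -> V) : Prop :=
  let TS := tangent (sub_atlas A S) in
  forall p, S p ->
  [/\ forall v s, TS p v -> section_of A S q P s p -> P p (D p v s),
      forall v w a s, TS p v -> TS p w -> section_of A S q P s p ->
        D p (a *: v + w) s = a *: D p v s + D p w s,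
      forall v s s', TS p v -> section_of A S q P s p ->
        section_of A S q P s' p ->
        D p v (fun y => s y + s' y) = D p v s + D p v s',
      forall v h s, TS p v -> smooth_near (sub_atlas A S) h p ->
        section_of A S q P s p ->
        D p v (fun y => h y *: s y) = v h *: s p + h p *: D p v s &
      forall X s, smooth_field (sub_atlas A S) X p ->
        section_of A S q P s p ->
        section_of A S q P (fun y => D y (X y) s) p].

Definition parallel (R : realType) (T : Type) (A : atlas R T)
    (S : set T) (V : lmodType R) (q : T -> tvec R T -> V) (P : T -> set V)
    (D : T -> tvec R T -> (T -> V) -> V) (B : T -> V -> V -> R) : Prop :=
  forall p v s s', S p -> tangent (sub_atlas A S) p v ->
    section_of A S q P s p -> section_of A S q P s' p ->
    v (fun y => B y (s y) (s' y)) =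
      B p (D p v s) (s' p) + B p (s p) (D p v s').

(* The form induced by the Hessian on N; a critical point has T_p S in the
   kernel of its Hessian, so the representatives Y and Z do not matter. *)
Definition nhess (R : realType) (T : Type) (A : atlas R T) (f : T -> R)
    (V : lmodType R) (q : T -> tvec R T -> V) (p : T) (xi eta : V) : R :=
  xget 0 [set r | exists Y Z, [/\ tangent A p Y, tangent A p Z,
                    q p Y = xi, q p Z = eta & r = hess A f p Y Z]].

Definition splitting (R : realType) (T : Type) (A : atlas R T) (f : T -> R)
    (V : lmodType R) (q : T -> tvec R T -> V) (Np Nm : T -> set V) : Prop :=
  let H := nhess A f q in
  [/\ subbundle A (crit A f) q Np, subbundle A (crit A f) q Nm &
  forall p, crit A f p ->
  [/\ nfib A q p = [set xi + eta | xi in Np p & eta in Nm p],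
      Np p `&` Nm p = [set 0],
      forall xi eta, Np p xi -> Nm p eta -> H p xi eta = 0,
      forall xi, Np p xi -> xi <> 0 -> 0 < H p xi xi &
      forall eta, Nm p eta -> eta <> 0 -> H p eta eta < 0]].

(* A diffeomorphism from N onto an open subset of M that restricts to the
   inclusion on the zero section. *)
Definition tubular_neighborhood (R : realType) (M : topologicalType)
    (A : atlas R M) (S : set M) (V : lmodType R) (q : M -> tvec R M -> V)
    (phi : M * V -> M) : Prop :=
  [/\ forall p, S p -> phi (p, 0) = p,
      open (phi @` ntot A S q),
      forall e, ntot A S q e -> smooth_map (natlas A S q) A phi e &
      exists psi : M -> M * V,
        (forall e, ntot A S q e -> psi (phi e) = e) /\
        (forall x, (phi @` ntot A S q) x ->
           smooth_map A (natlas A S q) psi x)].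

Definition near_zero_section (R : realType) (T : Type) (A : atlas R T)
    (S : set T) (V : lmodType R) (q : T -> tvec R T -> V)
    (P : T * V -> Prop) : Prop :=
  forall p, S p -> mnear (natlas A S q) (p, 0) P.

(* The vertical tangent vector of N at [e] given by [u] in the fibre of [e] *)
Definition vertical (R : realType) (T : Type) (A : atlas R T)
    (S : set T) (V : lmodType R) (q : T -> tvec R T -> V) (e : T * V) (u : V) :
    tvec R (T * V) :=
  velocity (natlas A S q) (fun t : R => (e.1, e.2 + t *: u)).

(* [w] in T_e N is the horizontal lift of v in T_p S, with p = [e.1], for the
   connection Dp + Dm on N = Np + Nm: it is the image of v under the
   differential of a local section through [e] with zero covariant derivative
   along v. *)
Definition horizontal_lift (R : realType) (T : Type) (A : atlas R T)
    (S : set T) (V : lmodType R) (q : T -> tvec R T -> V) (Np Nm : T -> set V)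
    (Dp Dm : T -> tvec R T -> (T -> V) -> V)
    (e : T * V) (v : tvec R T) (w : tvec R (T * V)) : Prop :=
  tangent (sub_atlas A S) e.1 v /\
  exists sp sm : T -> V,
    [/\ section_of A S q Np sp e.1 /\ section_of A S q Nm sm e.1,
        sp e.1 + sm e.1 = e.2, Dp e.1 v sp = 0, Dm e.1 v sm = 0 &
        w = dmap (sub_atlas A S) (natlas A S q)
              (fun y => (y, sp y + sm y)) e.1 v].

Definition compatible_metric (R : realType) (M : topologicalType)
    (A : atlas R M) (f : M -> R) (g : M -> tvec R M -> tvec R M -> R) : Prop :=
  let S := crit A f in
  exists (V : lmodType R) (q : M -> tvec R M -> V) (Np Nm : M -> set V)
    (gS : M -> tvec R M -> tvec R M -> R)
    (Dp Dm : M -> tvec R M -> (M -> V) -> V) (phi : M * V -> M),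
  let H := nhess A f q in
  let pull_g e w w' := g (phi e) (dmap (natlas A S q) A phi e w)
                                 (dmap (natlas A S q) A phi e w') in
  let vert := vertical A S q in
  let hor := horizontal_lift A S q Np Nm Dp Dm in
  [/\ quotient_model A S q /\ splitting A f q Np Nm,
      riemannian_metric (sub_atlas A S) gS,
      [/\ linear_connection A S q Np Dp, linear_connection A S q Nm Dm,
          parallel A S q Np Dp H & parallel A S q Nm Dm H],
      tubular_neighborhood A S q phi &
      near_zero_section A S q (fun e =>
        [/\ forall w, tangent (natlas A S q) e w ->
              w (f \o phi) = w (fun e' => H e'.1 e'.2 e'.2 / 2),
            forall v v' w w', hor e v w -> hor e v' w' ->
              pull_g e w w' = gS e.1 v v',
            forall xi xi' eta eta', Np e.1 xi -> Np e.1 xi' ->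
              Nm e.1 eta -> Nm e.1 eta' ->
              pull_g e (vert e (xi + eta)) (vert e (xi' + eta')) =
                H e.1 xi xi' - H e.1 eta eta' &
            forall v w u, hor e v w -> nfib A q e.1 u ->
              pull_g e w (vert e u) = 0])].

Definition neg_gradient (R : realType) (T : Type) (A : atlas R T)
    (g : T -> tvec R T -> tvec R T -> R) (f : T -> R)
    (X : T -> tvec R T) : Prop :=
  forall p, covers A p -> tangent A p (X p) /\
    forall v, tangent A p v -> g p (X p) v = - v f.

Definition is_flow (R : realType) (T : Type) (A : atlas R T)
    (X : T -> tvec R T) (phi : R -> T -> T) : Prop :=
  [/\ forall x, phi 0 x = x,
      forall s t x, phi (s + t) x = phi s (phi t x),
      forall t x h, smooth_near A h (phi t x) ->
        is_derive (t : R^o) (1 : R^o) (fun s => h (phi s x) : R^o)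
                  (X (phi t x) h) &
      forall t x, exists m (c : chart R T m) k (d : chart R T k),
        [/\ A m c, A k d, cdom c x, cdom d (phi t x) &
        exists O : set (R^o * 'rV[R]_m)%type,
          [/\ O (t, cfun c x),
              forall z, O z -> ccod c z.2 /\ cdom d (phi z.1 (cinv c z.2)) &
              smooth_on O (fun z => cfun d (phi z.1 (cinv c z.2)))]]].

Definition component (R : realType) (M : topologicalType) (A : atlas R M)
    (f : M -> R) : set (set M) :=
  [set S | exists2 x, crit A f x & S = connected_component (crit A f) x].

(* [starts phi x y]: y = p_-(x); [ends phi x y]: y = p_+(x) *)
Definition starts (R : realType) (M : topologicalType) (phi : R -> M -> M)
    (x y : M) : Prop := phi t x @[t --> -oo] --> y.
Definition ends (R : realType) (M : topologicalType) (phi : R -> M -> M)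
    (x y : M) : Prop := phi t x @[t --> +oo] --> y.

Definition Wminus (R : realType) (M : topologicalType) (phi : R -> M -> M)
    (S : set M) : set M := [set x | exists2 y, S y & starts phi x y].
Definition Wplus (R : realType) (M : topologicalType) (phi : R -> M -> M)
    (S : set M) : set M := [set x | exists2 y, S y & ends phi x y].

Definition transversal_at (R : realType) (T : Type) (A : atlas R T)
    (W W' : set T) (z : T) : Prop :=
  tangent A z =
    [set v + v' | v in tangent_in A W z & v' in tangent_in A W' z].

Definition morse_bott_smale (R : realType) (M : topologicalType)
    (A : atlas R M) (f : M -> R) (g : M -> tvec R M -> tvec R M -> R)
    (phi : R -> M -> M) : Prop :=
  [/\ morse_bott A f, compatible_metric A f g &
      forall x S z, crit A f x -> component A f S ->
        Wminus phi [set x] z -> Wplus phi S z ->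
        transversal_at A (Wminus phi [set x]) (Wplus phi S) z].

(* Points of T(S, S') are represented by orbits of the flow. *)
Definition orbit_of (R : realType) (M : Type) (phi : R -> M -> M) (x : M) :
    set M := [set phi t x | t in [set: R]].

Definition Tmod (R : realType) (M : topologicalType) (phi : R -> M -> M)
    (S S' : set M) : set (set M) :=
  [set orbit_of phi x | x in Wminus phi S `&` Wplus phi S'].

Definition Tall (R : realType) (M : topologicalType) (A : atlas R M)
    (f : M -> R) (phi : R -> M -> M) : set (set M) :=
  [set tau | exists S S', [/\ component A f S, component A f S', S <> S' &
                              Tmod phi S S' tau]].

(* [pi_minus phi tau y]: pi_-(tau) = y; [pi_plus phi tau y]: pi_+(tau) = y *)
Definition pi_minus (R : realType) (M : topologicalType) (phi : R -> M -> M)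
    (tau : set M) (y : M) : Prop := exists2 x, tau x & starts phi x y.
Definition pi_plus (R : realType) (M : topologicalType) (phi : R -> M -> M)
    (tau : set M) (y : M) : Prop := exists2 x, tau x & ends phi x y.

(* [(t_1, ..., t_k), w] is an element of T x_S ... x_S T x_S W^- whose starting
   point (the value of hat p_-) is [y]. *)
Fixpoint broken_from (R : realType) (M : topologicalType) (A : atlas R M)
    (f : M -> R) (phi : R -> M -> M) (y : M) (ts : seq (set M)) (w : M) :
    Prop :=
  match ts with
  | [::] => crit A f y /\ starts phi w y
  | tau :: ts' => [/\ Tall A f phi tau, pi_minus phi tau y &
      exists2 y', pi_plus phi tau y' & broken_from A f phi y' ts' w]
  end.

Definition What_at (R : realType) (M : topologicalType) (A : atlas R M)
    (f : M -> R) (phi : R -> M -> M) (S : set M) : set (seq (set M) * M) :=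
  [set x | exists2 y, S y & broken_from A f phi y x.1 x.2].

(* The points of M on the broken trajectory, from its starting point to
   hat i([x]) = [x.2], the intermediate critical points included *)
Definition support_of (R : realType) (M : topologicalType)
    (phi : R -> M -> M) (x : seq (set M) * M) : set M :=
  [set p | (exists2 tau, tau \in x.1 &
              [\/ tau p, pi_minus phi tau p | pi_plus phi tau p]) \/
           starts phi x.2 p \/ (exists2 s : R, s <= 0 & p = phi s x.2)].

(* min_M f, attained as soon as M is non-empty *)
Definition minf (R : realType) (M : Type) (f : M -> R) : R := inf (range f).

(* f(S), for f constant on S *)
Definition fval (R : realType) (M : Type) (f : M -> R) (S : set M) : R :=
  xget 0 (f @` S).

(* f is injective on [support_of phi x], so that there is exactly one point to
   choose where [xget] is used. *)
Definition broken_path (R : realType) (M : topologicalType) (f : M -> R)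
    (phi : R -> M -> M) (S : set M) (x : seq (set M) * M) :
    {compact-open, (`[minf f, fval f S]%classic : set R) -> M} :=
  fun t => let u := minf f + fval f S - set_val t in
    if f x.2 <= u
    then xget x.2 [set p | support_of phi x p /\ f p = u]
    else x.2.

(* hat W^-: the disjoint union of the hat W^-_S, each with the topology induced
   by [broken_path] from the compact-open topology *)
Definition What (R : realType) (M : topologicalType) (A : atlas R M)
    (f : M -> R) (phi : R -> M -> M) : topologicalType :=
  {S : component A f &
     initial_topology (fun x : What_at A f phi (set_val S) =>
                         @broken_path R M f phi (set_val S) (set_val x))}.

(* Main.v *)
(* Near every point p, in a chart in which the critical set is a linear subspace
   if p is critical, the Morse-Bott condition gives a Lojasiewicz inequality
   |f - f(p)| <= k |X|^2.  Hence along a trajectory the length in the chart is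
   bounded by the variation of C sgn(f - f(p)) sqrt|f - f(p)|, so that broken
   trajectories parametrized by the values of f are equicontinuous, also when
   they pass close to a critical manifold.  An ultrafilter on hat W^-_S then
   converges pointwise, with a continuous limit which is invariant under the
   backward flow; cut at its finitely many critical values, this limit is a
   broken trajectory, and the convergence is uniform. *)
Require Import Defs.
From HB Require Import structures.
From mathcomp Require Import all_boot all_order all_algebra.
From mathcomp Require Import all_classical all_reals all_analysis.
From mathcomp Require Import ring lra.
Import Order.TTheory GRing.Theory Num.Theory.
Import numFieldNormedType.Exports.
Set Implicit Arguments.
Unset Strict Implicit.
Unset Printing Implicit Defensive.
Local Open Scope classical_set_scope.
Local Open Scope ring_scope.

(** A trajectory spends unbounded time near the critical set, so time is useless as a parameter in a
    limit, while the values of [f] survive. With respect to [f] the speed is of order [1 / |X|],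
    which blows up there; the inequality [|f - f(p)| <= k |X|^2] makes it integrable, as [|X| dt =
    |df| / |X| <= sqrt k |df| / sqrt |f - f(p)|]. The resulting bound is the variation of one
    function of [f], monotone along trajectories, so the bounds for consecutive pieces add up
    without loss and pass to limit points: neither the number of breaks nor the length of time
    matters. It remains to recognize the limit as a broken trajectory. A path rests after its end
    point, so only the backward flow maps its support into itself; this weaker invariance is what
    passes to the limit. The forward behaviour between two critical levels comes from continuity: an
    orbit cannot reach the lower critical point in finite time, since critical points are fixed by
    the flow. Ultrafilters take the place of subsequences, and equicontinuity is stated with
    neighbourhoods, as no distance is fixed on [M]. *)

(** * Calculus of C^k and smooth maps between normed spaces *)

Section Ck.
Context {R : realType}.
Implicit Types V W Z : normedModType R.

Lemma near_open_eq (T : topologicalType) (T' : Type) (U : set T) (F G : T -> T') x :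
  open U -> U x -> (forall y, U y -> F y = G y) -> \forall y \near x, F y = G y.
Proof. by move=> oU Ux FG; near=> y; apply: FG; near: y; exact: open_nbhs_nbhs. 
Unshelve. all: by end_near. Qed.

(** The difference [G - F] vanishes near [x], so it has the null map as differential and can be
    added to [F]. *)
Lemma near_eq_differentiable V W (F G : V -> W) x :
  (\forall y \near x, F y = G y) -> differentiable F x -> differentiable G x.
Proof.
move=> FG dF.
have -> : G = F + (G - F) by apply/funext => y; rewrite /= addrC subrK.
apply: differentiableD => //; set D := G - F.
have D0 : \forall y \near x, D y = 0.
  by near do rewrite /D !fctE (near FG) ?subrr//.
have sh : y + x @[y --> (0 : V)] --> x.
  by rewrite -[X in _ --> X]add0r; apply: cvgD; [exact: cvg_id|exact: cvg_cst].
have nullE : D \o shift x = cst (D x) + (\0 : V -> W) +o_ 0 id.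
  apply/eqaddoP => e e0; near=> y.
  rewrite !fctE /= (nbhs_singleton D0) addr0 subr0.
  rewrite (_ : D (y + x) = 0) ?normr0 ?mulr_ge0 ?(ltW e0)//.
  by near: y; exact: (sh _ D0).
have dE : 'd D x = \0 :> (V -> W) by apply: diff_unique => // ?; exact: cst_continuous.
apply/diff_locallyP; rewrite dE; split => // ?; exact: cst_continuous.
Unshelve. all: by end_near. Qed.

(** Scaling packed as a bilinear map turns the product rule into an instance of the differential of
    a bilinear map. *)
Lemma scaler_is_bilinear W : bilinear_for
    (GRing.Scale.Law.clone _ _ *:%R _) (GRing.Scale.Law.clone _ _ *:%R _)
    (@GRing.scale R W).
Proof.
split=> [u'|u] a x y /=.
- by rewrite scalerDl scalerA.
- by rewrite scalerDr !scalerA mulrC.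
Qed.

Lemma differentiable_scale V W (a : V -> R) (F : V -> W) x :
  differentiable a x -> differentiable F x ->
  differentiable (fun y => a y *: F y) x.
Proof.
move=> da dF.
pose bM := bilinear_isBilinear.Build R R W W _ _ (@GRing.scale R W)
  (@scaler_is_bilinear W).
pose B : {bilinear R -> W -> W} := HB.pack (@GRing.scale R W) bM.
have dB p : differentiable (fun q : R * W => B q.1 q.2) p.
  by apply: differentiable_bilin; exact: scale_continuous.
exact: (differentiable_comp (differentiable_pair da dF) (dB _)).
Qed.

Lemma derive_scale V W (a : V -> R) (F : V -> W) x v :
  differentiable a x -> differentiable F x ->
  'D_v (fun y => a y *: F y) x = 'D_v a x *: F x + a x *: 'D_v F x.
Proof.
move=> da dF.
pose bM := bilinear_isBilinear.Build R R W W _ _ (@GRing.scale R W)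
  (@scaler_is_bilinear W).
pose B : {bilinear R -> W -> W} := HB.pack (@GRing.scale R W) bM.
have cB : continuous (fun q : R * W => B q.1 q.2) by exact: scale_continuous.
have dB p : differentiable (fun q : R * W => B q.1 q.2) p.
  by apply: differentiable_bilin.
rewrite deriveE; last exact: differentiable_scale.
transitivity ('d (fun q : R * W => B q.1 q.2) (a x, F x)
    ('d (fun y => (a y, F y)) x v)).
  exact: (congr1 (@^~ v) (diff_comp (differentiable_pair da dF) (dB _))).
by rewrite (diff_bilin (a x, F x) cB) diff_pair//= addrC !deriveE.
Qed.

Lemma derive_comp V W Z (F : V -> W) (G : W -> Z) x v :
  differentiable F x -> differentiable G (F x) ->
  'D_v (G \o F) x = 'D_('D_v F x) G (F x).
Proof.
move=> dF dG; rewrite !deriveE//; last exact: differentiable_comp.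
by rewrite diff_comp.
Qed.

Lemma derive_rV m W (G : 'rV[R]_m -> W) x v : differentiable G x ->
  'D_v G x = \sum_(j < m) v 0 j *: 'D_(delta_mx 0 j) G x.
Proof.
move=> dG; rewrite deriveE// [in LHS](row_sum_delta v) linear_sum.
by apply: eq_bigr => j _; rewrite linearZ deriveE.
Qed.

Lemma derive_coord V m (F : V -> 'rV[R]_m) x v j : differentiable F x ->
  'D_v (fun y => F y 0 j : R) x = 'D_v F x 0 j.
Proof.
move=> dF; rewrite derive_mx ?mxE//; exact: diff_derivable.
Qed.

Lemma differentiable_coordl V m (F : V -> 'rV[R]_m) x j : differentiable F x ->
  differentiable (fun y => F y 0 j : R) x.
Proof.
move=> dF; apply: (@differentiable_comp _ _ _ _ F (fun N : 'rV[R]_m => N 0 j : R)) => //.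
exact: differentiable_coord.
Qed.

Lemma CkW V W k (U : set V) (F : V -> W) : Ck k.+1 U F -> Ck k U F.
Proof.
elim: k F => [|k IH] F /=.
  by move=> [dF _] x Ux; apply: differentiable_continuous; exact: dF.
by move=> [dF DF]; split => // v; apply: IH; exact: DF.
Qed.

Lemma Ck_ext V W k (U : set V) (F G : V -> W) : open U ->
  (forall x, U x -> F x = G x) -> Ck k U F -> Ck k U G.
Proof.
move=> oU; elim: k F G => [|k IH] F G FG /=.
  move=> cF x Ux; have nFG := near_open_eq oU Ux FG.
  change (G y @[y --> x] --> G x); rewrite -(FG _ Ux).
  apply: cvg_trans (cF _ Ux).
  exact: near_eq_cvg nFG.
move=> [dF DF]; split.
  move=> x Ux; have nFG := near_open_eq oU Ux FG.
  exact: near_eq_differentiable nFG (dF _ Ux).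
move=> v; apply: (IH _ _ _ (DF v)) => x Ux.
by apply: near_eq_derive; exact: near_open_eq oU Ux FG.
Qed.

Lemma Ck_sub V W k (U U' : set V) (F : V -> W) : U' `<=` U -> Ck k U F -> Ck k U' F.
Proof.
move=> UU; elim: k F => [|k IH] F /=; first by move=> cF x /UU; exact: cF.
by move=> [dF DF]; split=> [x /UU|v]; [exact: dF|exact: IH].
Qed.

Lemma Ck_cst V W k (U : set V) (w : W) : Ck k U (fun=> w).
Proof.
elim: k w => [|k IH] w /=; first by move=> x _; exact: cst_continuous.
split=> [x _|v]; first exact: differentiable_cst.
by under eq_fun => x do rewrite derive_cst.
Qed.

Lemma Ck_add V W k (U : set V) (F G : V -> W) : open U ->
  Ck k U F -> Ck k U G -> Ck k U (fun x => F x + G x).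
Proof.
move=> oU; elim: k F G => [|k IH] F G /=.
  by move=> cF cG x Ux; apply: cvgD; [exact: cF|exact: cG].
move=> [dF DF] [dG DG]; split=> [x Ux|v].
  by apply: differentiableD; [exact: dF|exact: dG].
apply: (Ck_ext oU _ (IH _ _ (DF v) (DG v))) => x Ux.
by rewrite deriveD//; apply: diff_derivable; [exact: dF|exact: dG].
Qed.

Lemma Ck_sum V W k (U : set V) (I : Type) (s : seq I) (F : I -> V -> W) : open U ->
  (forall i, Ck k U (F i)) -> Ck k U (fun x => \sum_(i <- s) F i x).
Proof.
move=> oU cF; elim: s => [|i s IH].
  by under eq_fun => x do rewrite big_nil; exact: Ck_cst.
by under eq_fun => x do rewrite big_cons; exact: Ck_add.
Qed.

Lemma Ck_scale V W k (U : set V) (a : V -> R^o) (F : V -> W) : open U ->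
  Ck k U a -> Ck k U F -> Ck k U (fun x => a x *: F x).
Proof.
move=> oU; elim: k a F => [|k IH] a F.
  by move=> ca cF x Ux; apply: cvgZ; [exact: ca|exact: cF].
move=> ca cF; have ca' := CkW ca; have cF' := CkW cF.
move: ca cF => /= [da Da] [dF DF]; split=> [x Ux|v].
  by apply: differentiable_scale; [exact: da|exact: dF].
apply: (Ck_ext oU _ (Ck_add oU (IH _ _ (Da v) cF') (IH _ _ ca' (DF v)))) => x Ux.
by rewrite derive_scale//; [exact: da|exact: dF].
Qed.

Lemma Ck_coord V m k (U : set V) (F : V -> 'rV[R]_m) j : open U ->
  Ck k U F -> Ck k U (fun x => F x 0 j : R^o).
Proof.
move=> oU; elim: k F => [|k IH] F /=.
  move=> cF x Ux; apply: (@continuous_comp _ _ _ F (fun N : 'rV[R]_m => N 0 j : R)).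
    exact: cF.
  exact: coord_continuous.
move=> [dF DF]; split=> [x Ux|v]; first exact/differentiable_coordl/dF.
apply: (Ck_ext oU _ (IH _ (DF v))) => x Ux.
by rewrite -derive_coord//; exact: dF.
Qed.

Lemma Ck_comp V m Z k (U : set V) (O : set 'rV[R]_m) (F : V -> 'rV[R]_m)
    (G : 'rV[R]_m -> Z) : open U -> (forall x, U x -> O (F x)) ->
  Ck k O G -> Ck k U F -> Ck k U (G \o F).
Proof.
move=> oU UO; elim: k G => [|k IH] G.
  move=> cG cF x Ux; apply: continuous_comp; first exact: cF.
  exact/cG/UO.
move=> [dG DG] cF; have cF' := CkW cF; case: cF => dF DF; split=> [x Ux|v].
  by apply: differentiable_comp; [exact: dF|exact: (dG _ (UO _ Ux))].
(* The direction ['D_v F x] varies with [x], whereas [Ck] speaks of fixed directions; expanding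
   along the standard basis reduces to these. *)
have : Ck k U (fun x => \sum_(j < m) ('D_v F x 0 j : R^o) *:
           ('D_(delta_mx 0 j) G \o F) x).
  apply: Ck_sum => // j; apply: Ck_scale => //; last exact: (IH _ (DG _) cF').
  exact: Ck_coord (DF v).
apply: Ck_ext => // x Ux.
rewrite (derive_comp _ (dF _ Ux) (dG _ (UO _ Ux))).
by rewrite [in RHS]derive_rV//; exact: (dG _ (UO _ Ux)).
Qed.

Lemma Ck_affine V W k (U : set V) (F : V -> W) :
  (forall x, differentiable F x) -> (forall v x y, 'D_v F x = 'D_v F y) ->
  Ck k U F.
Proof.
move=> dF cF; case: k => [|k] /=.
  by move=> x _; exact: differentiable_continuous.
split=> // v; rewrite (_ : (fun x => 'D_v F x) = (fun=> 'D_v F 0)).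
  exact: Ck_cst.
by apply/funext => x; exact: cF.
Qed.

Lemma smooth_on_sub V W (U U' : set V) (F : V -> W) : open U' -> U' `<=` U ->
  smooth_on U F -> smooth_on U' F.
Proof. by move=> oU' UU [oU cF]; split => // k; exact: Ck_sub (cF k). Qed.

Lemma smooth_on_ext V W (U : set V) (F G : V -> W) :
  (forall x, U x -> F x = G x) -> smooth_on U F -> smooth_on U G.
Proof. by move=> FG [oU cF]; split => // k; exact: Ck_ext (cF k). Qed.

Lemma smooth_on_comp V m Z (U : set V) (O : set 'rV[R]_m) (F : V -> 'rV[R]_m)
    (G : 'rV[R]_m -> Z) : (forall x, U x -> O (F x)) ->
  smooth_on O G -> smooth_on U F -> smooth_on U (G \o F).
Proof.
move=> UO [oO cG] [oU cF]; split => // k; exact: Ck_comp (cG k) (cF k).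
Qed.

Lemma smooth_on_derive V W (U : set V) (F : V -> W) v :
  smooth_on U F -> smooth_on U (fun x => 'D_v F x).
Proof. by move=> [oU cF]; split=> // k; have [_ DF] := cF k.+1; exact: DF. Qed.

Lemma smooth_on_differentiable V W (U : set V) (F : V -> W) x :
  smooth_on U F -> U x -> differentiable F x.
Proof. by move=> [oU cF] Ux; have [dF _] := cF 1%N; exact: dF. Qed.

Lemma smooth_on_continuous V W (U : set V) (F : V -> W) x :
  smooth_on U F -> U x -> {for x, continuous F}.
Proof. by move=> sF Ux; apply: differentiable_continuous; exact: smooth_on_differentiable Ux. Qed.

Lemma smooth_on_preimage V W (U : set V) (F : V -> W) (O : set W) :
  smooth_on U F -> open O -> open (U `&` F @^-1` O).
Proof.
move=> sF oO; rewrite openE => x [Ux FO]; apply: filterI.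
  by apply: open_nbhs_nbhs; split=> //; case: sF.
by apply: (smooth_on_continuous sF Ux); exact: open_nbhs_nbhs.
Qed.

End Ck.

(** * Charts of the maximal atlas and the topology of the manifold *)

(** The condition of [smooth_near] with the chart fixed in advance; [smooth_nearP] shows that the
    choice of chart is immaterial. *)
Definition smooth_at_chart (R : realType) (T : Type) m (c : chart R T m)
    (h : T -> R) (p : T) : Prop :=
  exists O : set 'rV[R]_m, [/\ O (cfun c p), O `<=` ccod c &
    smooth_on O (h \o cinv c : _ -> R^o)].

(** The tangent vector with coordinates [xi], realized as the velocity of a straight line in the
    chart. *)
Definition chart_tvec (R : realType) (T : Type) (A : atlas R T) m
    (c : chart R T m) (xi : 'rV[R]_m) (p : T) : tvec R T :=
  velocity A (fun t => cinv c (cfun c p + t *: xi)).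

Lemma nbhs_exopen (T : topologicalType) (x : T) (P : set T) : nbhs x P ->
  exists O, [/\ open O, O x & O `<=` P].
Proof. by rewrite nbhsE => -[ O [oO Ox] OP]; exists O. Qed.

Section chart_ok.
Context {R : realType} {T : Type}.

Lemma cfunK m (c : chart R T m) p : chart_ok c -> cdom c p ->
  cinv c (cfun c p) = p.
Proof. by case=> cK _; exact: cK. Qed.

Lemma open_ccod m (c : chart R T m) : chart_ok c -> open (ccod c).
Proof. by case. Qed.

Lemma ccod_cfun m (c : chart R T m) p : cdom c p -> ccod c (cfun c p).
Proof. by move=> cp; exists p. Qed.

Lemma cinv_cdom m (c : chart R T m) z : chart_ok c -> ccod c z ->
  cdom c (cinv c z).
Proof. by move=> okc [p cp <-]; rewrite cfunK. Qed.

Lemma cinvK m (c : chart R T m) z : chart_ok c -> ccod c z ->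
  cfun c (cinv c z) = z.
Proof. by move=> okc [p cp <-]; rewrite cfunK. Qed.

Lemma overlapP m k (c : chart R T m) (d : chart R T k) z : chart_ok c ->
  (cfun c @` (cdom c `&` cdom d)) z <-> ccod c z /\ cdom d (cinv c z).
Proof.
move=> okc; split=> [[p [cp dp] <-]|[cz dz]].
  by rewrite cfunK//; split => //; exact: ccod_cfun.
by exists (cinv c z); [split=> //; exact: cinv_cdom|exact: cinvK].
Qed.

Lemma smooth_at_chart_transfer m k (c : chart R T m) (d : chart R T k) h p :
  chart_ok c -> chart_ok d -> compatible c d -> cdom c p -> cdom d p ->
  smooth_at_chart d h p -> smooth_at_chart c h p.
Proof.
move=> okc okd cd cp dp [ O [Op Od sO]].
pose U := cfun c @` (cdom c `&` cdom d).
pose O' := U `&` (cfun d \o cinv c) @^-1` O.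
have oO' : open O' by apply: smooth_on_preimage => //; case: sO.
exists O'; split.
- by split; [exists p|rewrite /= cfunK].
- by move=> z [/(overlapP _ _ okc)[]].
- have : smooth_on O' ((h \o cinv d : _ -> R^o) \o (cfun d \o cinv c)).
    apply: smooth_on_comp sO _; first by move=> z [].
    by apply: (smooth_on_sub oO' _ cd) => z [].
  apply: smooth_on_ext => z [/(overlapP _ _ okc)[cz dz] _] /=.
  by rewrite cfunK.
Qed.

End chart_ok.

Section manifold.
Context {R : realType} {M : topologicalType} {n : nat} {A : atlas R M}.
Arguments A : clear implicits.
Hypothesis hM : closed_manifold n A.

Lemma atlas_max m (c : chart R M m) : A m c -> max_atlas A c.
Proof. by case: hM => _ _ _ /[apply] -[]. Qed.

Lemma atlas_chart p : exists c : chart R M n, A n c /\ cdom c p.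
Proof.
case: hM => _ _ /(_ p)[m [c [Ac cp]]] /(_ _ _ Ac)[mn _ _ _].
by subst m; exists c.
Qed.

Lemma max_ok m (c : chart R M m) : max_atlas A c -> chart_ok c.
Proof. by case. Qed.

Lemma atlas_homeo m (c : chart R M m) U : A m c -> U `<=` cdom c ->
  (open U <-> open (cfun c @` U)).
Proof. by case: hM => _ _ _ /[apply] -[_ _ _]; exact. Qed.

Lemma atlas_open_cdom m (c : chart R M m) : A m c -> open (cdom c).
Proof. by case: hM => _ _ _ /[apply] -[_]. Qed.

Lemma atlas_cfun_continuous m (c : chart R M m) p : A m c -> cdom c p ->
  {for p, continuous (cfun c)}.
Proof.
move=> Ac cp; have okc := max_ok (atlas_max Ac).
move=> O; rewrite nbhsE /= => -[B [oB Bp] BO].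
pose U := cdom c `&` cfun c @^-1` B.
apply: (@filterS _ _ _ U); first by move=> q [_ /BO].
apply: open_nbhs_nbhs; split; last by [].
apply/(atlas_homeo Ac); first by move=> q [].
rewrite (_ : _ @` _ = ccod c `&` B); first by apply: openI => //; exact: open_ccod.
apply/seteqP; split=> [_ [q [cq Bq] <-]|z [cz Bz]].
  by split=> //; exact: ccod_cfun.
exists (cinv c z); last exact: cinvK.
by split; [exact: cinv_cdom|rewrite /= cinvK].
Qed.

Lemma atlas_cinv_continuous m (c : chart R M m) z : A m c -> ccod c z ->
  {for z, continuous (cinv c)}.
Proof.
move=> Ac cz; have okc := max_ok (atlas_max Ac).
move=> O; rewrite nbhsE /= => -[B [oB Bp] BO].
pose U := cdom c `&` B.
have oU : open (cfun c @` U).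
  apply/(atlas_homeo Ac); first by move=> q [].
  by apply: openI => //; exact: atlas_open_cdom.
apply: (@filterS _ _ _ (cfun c @` U)).
  by move=> _ [q [cq /BO Oq] <-] /=; rewrite cfunK.
apply: open_nbhs_nbhs; split => //; exists (cinv c z); last exact: cinvK.
by split => //; exact: cinv_cdom.
Qed.

(** [max_atlas] does not mention the topology of [M]. Openness is read in an atlas chart [d]: the
    image of the overlap is open there, because [smooth_on] includes the openness of its domain. *)
Lemma max_open_cdom m (c : chart R M m) : max_atlas A c -> open (cdom c).
Proof.
move=> mc; have okc := max_ok mc; rewrite openE => p cp.
have [d [Ad dp]] := atlas_chart p; have okd := max_ok (atlas_max Ad).
have [_ [oU _]] := mc.2 _ _ Ad.
have dc := atlas_cfun_continuous Ad dp.
have nU : nbhs (cfun d p) (cfun d @` (cdom d `&` cdom c)).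
  by apply: open_nbhs_nbhs; split => //; exists p.
have nd : nbhs p (cdom d) by apply: open_nbhs_nbhs; split => //; exact: atlas_open_cdom.
apply: filterS (filterI nd (dc _ nU)) => q [dq].
by move=> /(overlapP _ _ okd)[_]; rewrite cfunK.
Qed.

Lemma near_cdom m (c : chart R M m) p : max_atlas A c -> cdom c p ->
  \forall q \near p, cdom c q.
Proof. by move=> mc cp; apply: open_nbhs_nbhs; split => //; exact: max_open_cdom. Qed.

Lemma near_ccod m (c : chart R M m) z : max_atlas A c -> ccod c z ->
  \forall y \near z, ccod c y.
Proof. by move=> mc cz; apply: open_nbhs_nbhs; split => //; exact/open_ccod/max_ok. Qed.

(** Charts of the maximal atlas matter because the slice charts of the critical set are only known
    to lie in it. Near [p] such a chart factors through an atlas chart and a smooth transition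
    map. *)
Lemma max_cfun_continuous m (c : chart R M m) p : max_atlas A c -> cdom c p ->
  {for p, continuous (cfun c)}.
Proof.
move=> mc cp; have okc := max_ok mc.
have [d [Ad dp]] := atlas_chart p; have okd := max_ok (atlas_max Ad).
have [_ dc] := mc.2 _ _ Ad.
have cdp : (cfun d @` (cdom d `&` cdom c)) (cfun d p) by exists p.
have cT := smooth_on_continuous dc cdp.
have cd := atlas_cfun_continuous Ad dp.
have H : cfun c (cinv d (cfun d q)) @[q --> p] --> cfun c (cinv d (cfun d p)).
  exact: (continuous_comp cd cT).
rewrite cfunK// in H; apply: cvg_trans H; apply: near_eq_cvg.
have := near_cdom (atlas_max Ad) dp.
by apply: filterS => q dq /=; rewrite cfunK.
Qed.

Lemma max_cinv_continuous m (c : chart R M m) z : max_atlas A c -> ccod c z ->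
  {for z, continuous (cinv c)}.
Proof.
move=> mc cz; have okc := max_ok mc.
have [d [Ad dp]] := atlas_chart (cinv c z); have okd := max_ok (atlas_max Ad).
have [cd _] := mc.2 _ _ Ad.
have Uz : (cfun c @` (cdom c `&` cdom d)) z by apply/(overlapP _ _ okc).
have cT := smooth_on_continuous cd Uz.
have H : cinv d (cfun d (cinv c y)) @[y --> z] --> cinv d (cfun d (cinv c z)).
  apply: (continuous_comp cT).
  by apply: atlas_cinv_continuous => //=; exact: ccod_cfun.
rewrite (cfunK okd)// in H.
have nU : nbhs z (cfun c @` (cdom c `&` cdom d)).
  by apply: open_nbhs_nbhs; split => //; case: cd.
have E : \forall y \near z, cinv d (cfun d (cinv c y)) = cinv c y.
  by apply: filterS nU => y /(overlapP _ _ okc)[cy dy] /=; rewrite cfunK.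
exact: cvg_trans (near_eq_cvg E) H.
Qed.

Lemma max_cinv_near m (c : chart R M m) p (P : set M) : max_atlas A c ->
  cdom c p -> nbhs p P -> \forall z \near cfun c p, P (cinv c z).
Proof.
move=> mc cp nP; apply: (max_cinv_continuous mc (ccod_cfun cp)).
by rewrite (cfunK (max_ok mc)).
Qed.

Lemma max_cfun_near m (c : chart R M m) p P : max_atlas A c ->
  cdom c p -> nbhs (cfun c p) P -> \forall q \near p, P (cfun c q).
Proof. by move=> mc cp nP; exact: (max_cfun_continuous mc cp nP). Qed.

Lemma mnear_nbhs p (P : M -> Prop) : (\forall q \near p, P q) -> mnear A p P.
Proof.
move=> nP; have [c [Ac cp]] := atlas_chart p; have mc := atlas_max Ac.
have okc := max_ok mc.
exists n, c; split => //.
have /nbhs_exopen[ O [oO Op OP]] : nbhs (cfun c p) (fun z => ccod c z /\ P (cinv c z)).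
  apply: filterI; first by apply: near_ccod => //; exact: ccod_cfun.
  exact: max_cinv_near nP.
exists O; split => //.
  by move=> z /OP[].
by move=> z /OP[].
Qed.

Lemma smooth_nearP m (c : chart R M m) h p : max_atlas A c -> cdom c p ->
  smooth_near A h p <-> smooth_at_chart c h p.
Proof.
move=> mc cp; have okc := max_ok mc; split.
  move=> [k [d [Ad dp sd]]]; have [cd _] := mc.2 _ _ Ad.
  exact: (smooth_at_chart_transfer okc (max_ok (atlas_max Ad)) cd cp dp sd).
have [d [Ad dp]] := atlas_chart p; have [_ dc] := mc.2 _ _ Ad.
move/(smooth_at_chart_transfer (max_ok (atlas_max Ad)) okc dc dp cp) => sd.
by exists n, d; split.
Qed.

Lemma smooth_near_continuous h p : smooth_near A h p ->
  {for p, continuous (h : M -> R)}.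
Proof.
have [c [Ac cp]] := atlas_chart p; have mc := atlas_max Ac.
move=> /(smooth_nearP _ mc cp)[ O [Op Oc sO]].
have cc := max_cfun_continuous mc cp.
have H : h (cinv c (cfun c q)) @[q --> p] --> h (cinv c (cfun c p)).
  exact: (continuous_comp cc (smooth_on_continuous sO Op)).
rewrite (cfunK (max_ok mc))// in H; apply: cvg_trans H; apply: near_eq_cvg.
by apply: filterS (near_cdom mc cp) => q cq /=; rewrite (cfunK (max_ok mc)).
Qed.

End manifold.

(** * Tangent vectors in coordinates *)

Section tangent.
Context {R : realType} {M : topologicalType} {n : nat} {A : atlas R M}.
Arguments A : clear implicits.
Hypothesis hM : closed_manifold n A.

Lemma smooth_at_chart_diff m (c : chart R M m) h p :
  smooth_at_chart c h p -> differentiable (h \o cinv c : _ -> R^o) (cfun c p).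
Proof. by move=> [ O [Op _ sO]]; exact: smooth_on_differentiable sO Op. Qed.

Lemma is_derive_line_dir m (z xi : 'rV[R]_m) (t v : R^o) :
  is_derive t v (fun t : R^o => z + t *: xi) (v *: xi).
Proof.
rewrite -[X in is_derive _ _ _ X]add0r.
apply: is_deriveD.
have := @is_diff_scalel R 'rV[R]_m t xi => -[d e].
apply: DeriveDef; first exact: diff_derivable.
by rewrite deriveE// e.
Qed.

Lemma is_derive_line m (z xi : 'rV[R]_m) (t : R^o) :
  is_derive t (1 : R^o) (fun t : R^o => z + t *: xi) xi.
Proof. by rewrite -[X in is_derive _ _ _ X]scale1r; exact: is_derive_line_dir. Qed.

Lemma differentiable_line m (z xi : 'rV[R]_m) (t : R^o) :
  differentiable (fun t : R^o => z + t *: xi) t.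
Proof.
apply/derivable1_diffP; have [] // := is_derive_line z xi t.
Qed.

Lemma derive1_chart m (c : chart R M m) (gam : R -> M) h : max_atlas A c ->
  (\forall t \near (0 : R^o), cdom c (gam t)) ->
  differentiable (cfun c \o gam : R^o -> _) 0 -> smooth_near A h (gam 0) ->
  derive1 (h \o gam : R^o -> R^o) 0 =
  'D_('D_(1 : R^o) (cfun c \o gam : R^o -> 'rV[R]_m) 0) (h \o cinv c : _ -> R^o) (cfun c (gam 0)).
Proof.
move=> mc gc dg; have c0 := nbhs_singleton gc.
move=> /(smooth_nearP hM _ mc c0)/smooth_at_chart_diff dh.
rewrite derive1E -(derive_comp _ dg dh).
apply: near_eq_derive; apply: filterS gc => t ct /=.
by rewrite (cfunK (max_ok mc)).
Qed.

Lemma smooth_curve_chart m (c : chart R M m) (gam : R -> M) : max_atlas A c ->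
  smooth_curve A gam -> cdom c (gam 0) ->
  (\forall t \near (0 : R^o), cdom c (gam t)) /\
  differentiable (cfun c \o gam : R^o -> _) 0.
Proof.
move=> mc [k [d [Ad [U0 [U00 Ud0 sU]]]]] c0; have md := atlas_max hM Ad.
have okd := max_ok md.
have oO : nbhs (0 : R^o) U0 by apply: open_nbhs_nbhs; split => //; case: sU.
have dd := smooth_on_differentiable sU U00.
have [_ sdc] := mc.2 _ _ Ad.
have Ud : (cfun d @` (cdom d `&` cdom c)) (cfun d (gam 0)).
  by exists (gam 0) => //; split => //; exact: Ud0.
split.
  have := differentiable_continuous dd (max_cinv_near hM md (Ud0 _ U00) (near_cdom hM mc c0)).
  by move=> H; apply: filterS (filterI oO H) => t [/Ud0 dt] /=; rewrite cfunK.
have ddc := smooth_on_differentiable sdc Ud.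
apply: near_eq_differentiable (differentiable_comp dd ddc).
by apply: filterS oO => t /Ud0 dt /=; rewrite cfunK.
Qed.

Lemma line_chart m (c : chart R M m) xi p : max_atlas A c -> cdom c p ->
  let gam := fun t : R => cinv c (cfun c p + t *: xi) in
  [/\ gam 0 = p, smooth_curve A gam &
    forall t, ccod c (cfun c p + t *: xi) -> cfun c (gam t) = cfun c p + t *: xi].
Proof.
move=> mc cp gam; have okc := max_ok mc.
have g0 : gam 0 = p by rewrite /gam scale0r addr0 cfunK.
split => //; last by move=> t ct; rewrite /gam cinvK.
(* [smooth_curve] asks for a chart of the atlas itself, so the line is read in [d] through the
   transition map. *)
have [d [Ad dp]] := atlas_chart hM p; have [scd _] := mc.2 _ _ Ad.
exists n, d; split => //.
pose L := fun t : R^o => cfun c p + t *: xi.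
have sL : smooth_on setT L.
  split; first exact: openT.
  move=> k; apply: Ck_affine; first exact: differentiable_line.
  move=> v x y.
  by rewrite !(@derive_val _ _ _ _ _ _ _ (is_derive_line_dir _ _ _ _)).
pose U := cfun c @` (cdom c `&` cdom d).
have oU : open (L @^-1` U).
  rewrite -[X in open X]setTI; apply: smooth_on_preimage => //; by case: scd.
exists (L @^-1` U); split.
- by exists p => //; rewrite /L scale0r addr0.
- by move=> t /(overlapP _ _ okc)[].
- apply: (@smooth_on_comp _ _ _ _ _ U L (cfun d \o cinv c)) => //.
  exact: smooth_on_sub sL.
Qed.

Lemma chart_tvec_tangent m (c : chart R M m) xi p : max_atlas A c -> cdom c p ->
  tangent A p (chart_tvec A c xi p).
Proof.
move=> mc cp; have [g0 sg _] := line_chart xi mc cp.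
by eexists; split; [exact: sg|exact: g0|by apply: filterE => ?|].
Qed.

Lemma velocity_chart m (c : chart R M m) (gam : R -> M) : max_atlas A c ->
  smooth_curve A gam -> cdom c (gam 0) ->
  velocity A gam = chart_tvec A c ('D_(1 : R^o) (cfun c \o gam : R^o -> 'rV[R]_m) 0) (gam 0).
Proof.
move=> mc sg c0; set xi := derive _ _ _; have okc := max_ok mc.
have [l0 sl lK] := line_chart xi mc c0.
apply/funext => h; rewrite /chart_tvec /velocity l0.
case: asboolP => // sh.
have [gc gd] := smooth_curve_chart mc sg c0.
set lam := fun t : R => cinv c (_ + t *: _) in sl lK *.
have {}l0 : lam 0 = _ := l0.
have cl0 : cdom c (lam 0) by rewrite l0.
have [lc ld] := smooth_curve_chart mc sl cl0.
have E1 := derive1_chart mc gc gd sh.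
have shl : smooth_near A h (lam 0) by rewrite l0.
have E2 := derive1_chart mc lc ld shl; rewrite [in cfun c (lam 0)]l0 in E2.
refine (etrans E1 (etrans _ (esym E2))); congr derive; rewrite -/xi.
have nl : \forall t \near (0 : R^o), cfun c (gam 0) + t *: xi = (cfun c \o lam) t.
  have : \forall t \near (0 : R^o), ccod c (cfun c (gam 0) + t *: xi).
    apply: (differentiable_continuous (differentiable_line (cfun c (gam 0)) xi 0)).
    by rewrite /= scale0r addr0; exact: (near_ccod mc (ccod_cfun c0)).
  by apply: filterS => t /lK.
rewrite -(near_eq_derive _ nl).
by rewrite (@derive_val _ _ _ _ _ _ _ (is_derive_line _ _ _)).
Qed.

(** Velocities of arbitrary curves cannot be added directly; this reduces linear algebra on
    [tangent] to rows of coordinates. *)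
Lemma tangentP m (c : chart R M m) p v : max_atlas A c -> cdom c p ->
  tangent A p v <-> exists xi, v = chart_tvec A c xi p.
Proof.
move=> mc cp; split; last by move=> [xi ->]; exact: chart_tvec_tangent.
by move=> [gam [sg g0 _ ->]]; rewrite -g0 in cp *; eexists; exact: velocity_chart.
Qed.

Lemma chart_tvecE m (c : chart R M m) xi p h : max_atlas A c -> cdom c p ->
  smooth_near A h p ->
  chart_tvec A c xi p h = 'D_xi (h \o cinv c : _ -> R^o) (cfun c p).
Proof.
move=> mc cp sh; have [l0 sl lK] := line_chart xi mc cp.
rewrite /chart_tvec /velocity l0; case: asboolP => // _.
set lam := fun t : R => cinv c (_ + t *: _) in sl lK *.
have {}l0 : lam 0 = _ := l0.
have cl0 : cdom c (lam 0) by rewrite l0.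
have [lc ld] := smooth_curve_chart mc sl cl0.
have shl : smooth_near A h (lam 0) by rewrite l0.
have E2 := derive1_chart mc lc ld shl; rewrite [in cfun c (lam 0)]l0 in E2.
refine (etrans E2 _); congr derive.
have nl : \forall t \near (0 : R^o), cfun c p + t *: xi = (cfun c \o lam) t.
  have : \forall t \near (0 : R^o), ccod c (cfun c p + t *: xi).
    apply: (differentiable_continuous (differentiable_line (cfun c p) xi 0)).
    by rewrite /= scale0r addr0; exact: (near_ccod mc (ccod_cfun cp)).
  by apply: filterS => t /lK.
rewrite -(near_eq_derive _ nl).
by rewrite (@derive_val _ _ _ _ _ _ _ (is_derive_line _ _ _)).
Qed.

(** Tangent vectors are equal when they agree on all functions, so linearity must also be checked on
    the functions to which they are extended by 0. *)
Lemma chart_tvec_out m (c : chart R M m) xi p h : max_atlas A c -> cdom c p ->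
  ~ smooth_near A h p -> chart_tvec A c xi p h = 0.
Proof.
move=> mc cp sh; have [l0 sl lK] := line_chart xi mc cp.
by rewrite /chart_tvec /velocity l0; case: asboolP.
Qed.

Lemma smooth_near_coord m (c : chart R M m) p j : max_atlas A c -> cdom c p ->
  smooth_near A (fun q => cfun c q 0 j) p.
Proof.
move=> mc cp; have okc := max_ok mc; apply/(smooth_nearP hM _ mc cp).
exists (ccod c); split => //; first exact: ccod_cfun.
apply: (@smooth_on_ext _ _ _ _ (fun z : 'rV[R]_m => z 0 j : R^o)).
  by move=> z cz /=; rewrite cinvK.
split; first exact: open_ccod.
move=> k; apply: (@Ck_coord _ _ _ _ _ id); first exact: open_ccod.
by apply: Ck_affine => // v x y; rewrite !derive_id.
Qed.

Lemma chart_tvec_coord m (c : chart R M m) xi p j : max_atlas A c -> cdom c p ->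
  chart_tvec A c xi p (fun q => cfun c q 0 j) = xi 0 j.
Proof.
move=> mc cp; rewrite chart_tvecE//; last exact: smooth_near_coord.
have nE : \forall z \near cfun c p, (z : 'rV[R]_m) 0 j = cfun c (cinv c z) 0 j.
  by have := near_ccod mc (ccod_cfun cp); apply: filterS => z cz; rewrite (cinvK (max_ok mc)).
rewrite -[LHS](near_eq_derive xi nE).
by rewrite (@derive_coord _ _ _ id)// derive_id.
Qed.

Lemma chart_tvecP m (c : chart R M m) p v : max_atlas A c -> cdom c p ->
  tangent A p v ->
  v = chart_tvec A c (\row_j v (fun q => cfun c q 0 j)) p.
Proof.
move=> mc cp /(tangentP _ mc cp)[xi ->]; congr chart_tvec.
by apply/rowP => j; rewrite mxE chart_tvec_coord.
Qed.

Lemma chart_tvec_lin m (c : chart R M m) a xi eta p : max_atlas A c -> cdom c p ->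
  chart_tvec A c (a *: xi + eta) p = a *: chart_tvec A c xi p + chart_tvec A c eta p.
Proof.
move=> mc cp; apply/funext => h.
have -> : (a *: chart_tvec A c xi p + chart_tvec A c eta p) h =
  a * chart_tvec A c xi p h + chart_tvec A c eta p h by [].
have [sh|sh] := pselect (smooth_near A h p); last first.
  by rewrite !chart_tvec_out// mulr0 addr0.
have /smooth_at_chart_diff dh := (smooth_nearP hM h mc cp).1 sh.
by rewrite !chart_tvecE// !deriveE// linearP.
Qed.

Lemma tangent_lin p a u v : tangent A p u -> tangent A p v ->
  tangent A p (a *: u + v).
Proof.
have [c [Ac cp]] := atlas_chart hM p; have mc := atlas_max hM Ac.
move=> /(tangentP _ mc cp)[xi ->] /(tangentP _ mc cp)[eta ->].
by rewrite -chart_tvec_lin//; exact: chart_tvec_tangent.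
Qed.

Lemma tangent0 p : tangent A p 0.
Proof.
have [c [Ac cp]] := atlas_chart hM p; have mc := atlas_max hM Ac.
have E := chart_tvec_lin 1 0 0 mc cp; rewrite scaler0 addr0 scale1r in E.
have -> : (0 : tvec R M) = chart_tvec A c 0 p.
  by apply: (addrI (chart_tvec A c 0 p)); rewrite addr0 -E.
exact: chart_tvec_tangent.
Qed.

(** Supplies the fields on which the smoothness of the metric is tested, which makes its
    coefficients in a chart smooth. *)
Lemma smooth_field_chart m (c : chart R M m) xi p : max_atlas A c -> cdom c p ->
  smooth_field A (chart_tvec A c xi) p.
Proof.
move=> mc cp; have okc := max_ok mc; split.
  apply: (mnear_nbhs hM); apply: filterS (near_cdom hM mc cp) => q cq.
  exact: chart_tvec_tangent.
move=> h /(smooth_nearP hM _ mc cp)[ O [Op Oc sO]]; apply/(smooth_nearP hM _ mc cp).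
exists O; split => //.
apply: (@smooth_on_ext _ _ _ _ (fun z => 'D_xi (h \o cinv c : _ -> R^o) z)).
  move=> z Oz /=; have cz := cinv_cdom okc (Oc _ Oz).
  have sh : smooth_near A h (cinv c z).
    by apply/(smooth_nearP hM _ mc cz); exists O; rewrite (cinvK okc (Oc _ Oz)).
  by rewrite chart_tvecE// (cinvK okc (Oc _ Oz)).
exact: smooth_on_derive.
Qed.

End tangent.

(** * The Lojasiewicz inequality in Euclidean space *)

Section lojasiewicz.
Context {R : realType}.

Lemma MVT_line (V : normedModType R) (F : V -> R^o) (x w : V) :
  (forall t : R, 0 <= t <= 1 -> differentiable F (x + t *: w)) ->
  exists2 t : R, 0 <= t <= 1 & F (x + w) - F x = 'D_w F (x + t *: w).
Proof.
move=> dF; pose L := fun t : R^o => x + t *: w.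
have dL t : is_derive t (1 : R^o) L w.
  rewrite -[X in is_derive _ _ _ X]add0r; apply: is_deriveD.
  have := @is_diff_scalel R V t w => -[d e].
  by apply: DeriveDef; [exact: diff_derivable|rewrite deriveE// e scale1r].
have dfL t : differentiable L t by apply/derivable1_diffP; have [] := dL t.
have dFL (t : R) : 0 <= t <= 1 -> differentiable (F \o L : R^o -> R^o) (t : R^o).
  by move=> t01; apply: differentiable_comp => //; exact: dF.
have [t||t t01 E] := @MVT_segment R (F \o L) (fun t => 'D_w F (L t)) 0 1 ler01.
- rewrite in_itv /= => /andP[t0 t1]; have t01 : 0 <= t <= 1 by rewrite !ltW.
  apply: DeriveDef; first exact/diff_derivable/dFL.
  by rewrite (derive_comp _ (dfL t) (dF _ t01)) (@derive_val _ _ _ _ _ _ _ (dL t)).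
- apply: continuous_in_subspaceT => t; rewrite inE /= in_itv /= => t01.
  exact/differentiable_continuous/dFL.
exists t; first by rewrite in_itv in t01.
by move: E; rewrite /= /L scale1r scale0r addr0 subr0 mulr1.
Qed.

Lemma norm_coord m (x : 'rV[R]_m) j : `|x 0 j| <= `|x|.
Proof.
by rewrite [leRHS]/Num.Def.normr /= mx_normrE; exact: (le_bigmax _ _ (0, j)).
Qed.

Lemma norm_rV_le m (x : 'rV[R]_m) B : 0 <= B -> (forall j, `|x 0 j| <= B) -> `|x| <= B.
Proof.
move=> B0 xB; rewrite [leLHS]/Num.Def.normr /= mx_normrE.
by apply: bigmax_le => // -[i j] _; rewrite ord1.
Qed.

Lemma mulmx_norm_le m k (B : 'M[R]_(m, k)) :
  exists2 K : R, 0 <= K & forall (u : 'rV[R]_m) b, 0 <= b ->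
    (forall i, `|u 0 i| <= b) -> forall j, `|(u *m B) 0 j| <= K * b.
Proof.
exists (\sum_i \sum_j `|B i j|) => [|u b b0 ub j].
  by apply: sumr_ge0 => i _; apply: sumr_ge0.
rewrite mxE (le_trans (ler_norm_sum _ _ _))// mulr_suml; apply: ler_sum => i _.
rewrite normrM mulrC ler_pM//.
by rewrite (bigD1 j)//= lerDl sumr_ge0.
Qed.

Lemma derive_rsub k l (W : normedModType R) (G : 'rV[R]_(k + l) -> W) x (y : 'rV[R]_l) :
  differentiable G x ->
  'D_(row_mx 0 y) G x =
  \sum_(i < l) y 0 i *: 'D_(delta_mx 0 (rshift k i)) G x.
Proof.
move=> dG; rewrite derive_rV// big_split_ord /= big1 ?add0r.
  by apply: eq_bigr => i _; rewrite row_mxEr.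
by move=> i _; rewrite row_mxEl mxE scale0r.
Qed.

Lemma row_mx_decomp k l (z : 'rV[R]_(k + l)) :
  z = row_mx (lsubmx z) 0 + row_mx 0 (rsubmx z).
Proof. by rewrite add_row_mx addr0 add0r hsubmxK. Qed.

Lemma norm_row_mx_le k l (x : 'rV[R]_k) (y : 'rV[R]_l) b :
  0 <= b -> `|x| <= b -> `|y| <= b -> `|row_mx x y| <= b.
Proof.
move=> b0 xb yb; apply: norm_rV_le => // j; rewrite mxE.
by case: splitP => i _; apply: le_trans (norm_coord _ _) _.
Qed.

Lemma norm_lsub k l (z : 'rV[R]_(k + l)) : `|lsubmx z| <= `|z|.
Proof. by apply: norm_rV_le => // j; rewrite mxE norm_coord. Qed.

Lemma norm_rsub k l (z : 'rV[R]_(k + l)) : `|rsubmx z| <= `|z|.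
Proof. by apply: norm_rV_le => // j; rewrite mxE norm_coord. Qed.

(* The rows of the Hessian in the directions normal to [rsubmx z = 0] are
   independent, so the gradient controls the distance to that subspace, on
   which [F] and its gradient vanish to the first order. *)
Lemma lojasiewicz_morse_bott k l (F : 'rV[R]_(k + l) -> R^o) (O : set 'rV[R]_(k + l))
    (z0 : 'rV[R]_(k + l)) :
  smooth_on O F -> O z0 -> rsubmx z0 = 0 ->
  (forall z v, O z -> rsubmx z = 0 -> 'D_v F z = 0) ->
  (forall v, (forall j, 'D_v (fun z => 'D_(delta_mx 0 j) F z) z0 = 0) ->
     rsubmx v = 0) ->
  exists2 C : R, 0 < C & \forall z \near z0, forall b, 0 <= b ->
    (forall j, `|'D_(delta_mx 0 j) F z| <= b) -> `|F z - F z0| <= C * b ^+ 2.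
Proof.
move=> sF Oz0 z0S critF nondeg.
pose D j z := 'D_(delta_mx 0 j) F z.
have sD j : smooth_on O (D j) by exact: smooth_on_derive.
pose H (i : 'I_l) j z := 'D_(delta_mx 0 (rshift k i)) (D j) z.
have sH i j : smooth_on O (H i j) by exact: smooth_on_derive.
pose H0 : 'M[R]_(l, k + l) := \matrix_(i, j) H i j z0.
have : row_free H0.
  apply: inj_row_free => y yH; rewrite -(row_mxKr (0 : 'rV[R]_k) y).
  apply: nondeg => j; rewrite -/(D j).
  rewrite derive_rsub; last exact: smooth_on_differentiable (sD j) Oz0.
  move/rowP/(_ j): yH; rewrite !mxE => {2}<-.
  by apply: eq_bigr => i _; rewrite mxE.
move=> /row_freeP[B HB].
have [K K0 KB] := mulmx_norm_le B.
have [K' K'0 KH] := mulmx_norm_le H0.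
(* Chosen so that [K * (l%:R * e) <= 1 / 2]: the error of the linearized gradient can then be
   absorbed. Each [+ 1] keeps the inverse positive. *)
pose e := (2 * (K + 1) * (l%:R + 1))^-1.
have e0 : 0 < e by rewrite invr_gt0 !mulr_gt0// ?ltr_wpDl.
have : \forall z \near z0, O z /\ forall i j, `|H i j z0 - H i j z| <= e.
  apply: filterI; first by apply: open_nbhs_nbhs; split => //; case: sF.
  apply: (@filter_forall _ _ (fun i z => forall j, `|H i j z0 - H i j z| <= e) _
    (nbhs_filter z0)) => i.
  apply: (@filter_forall _ _ (fun j z => `|H i j z0 - H i j z| <= e) _
    (nbhs_filter z0)) => j.
  by have /cvgrPdist_le/(_ _ e0) := smooth_on_continuous (sH i j) Oz0.
move=> /nbhs_ballP[r /= r0 rP].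
pose C1 := K' + l%:R * e.
have C10 : 0 <= C1 by rewrite addr_ge0// mulr_ge0// ltW.
(* The distance to the subspace will be at most [2 * K * b], and the variation of [F] at most
   [l%:R * C1] times its square; [+ 1] makes the constant positive. *)
exists (l%:R * C1 * (2 * K) ^+ 2 + 1).
  by rewrite ltr_wpDl// mulr_ge0 ?sqr_ge0// mulr_ge0.
(* In the maximum norm, and because [rsubmx z0 = 0], the segment from [z] to its projection on the
   subspace stays in the ball. *)
have inball z t : ball z0 r z -> 0 <= t <= 1 ->
    ball z0 r (row_mx (lsubmx z) 0 + t *: row_mx 0 (rsubmx z)).
  rewrite -!ball_normE /= => zr /andP[t0 t1].
  have -> : z0 - (row_mx (lsubmx z) 0 + t *: row_mx 0 (rsubmx z)) =
    row_mx (lsubmx (z0 - z)) (t *: rsubmx (z0 - z)).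
    rewrite -[LHS]hsubmxK !linearB !linearD !linearZ /= !row_mxKl !row_mxKr z0S.
    by rewrite !oppr0 !scaler0 ?addr0 ?add0r.
  apply: le_lt_trans zr; apply: norm_row_mx_le => //; first exact: norm_lsub.
  rewrite normrZ ger0_norm// (le_trans _ (norm_rsub (z0 - z)))//.
  by rewrite ler_piMl.
(* The gradient vanishes at the projection of [z]; the mean value theorem from there gives its
   linear part [H0], up to the oscillation [e] of the Hessian. *)
have Dest z j : ball z0 r z ->
    `|D j z - (rsubmx z *m H0) 0 j| <= l%:R * e * `|rsubmx z|.
  move=> zr.
  have [t t01|t t01 E] := @MVT_line _ (D j) (row_mx (lsubmx z) 0) (row_mx 0 (rsubmx z)).
    apply: (smooth_on_differentiable (sD j)).
    by have [] := rP _ (inball _ _ zr t01).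
  have zb1 : ball z0 r (row_mx (lsubmx z) 0).
    by have := inball z 0 zr; rewrite scale0r addr0 lexx ler01; exact.
  move: E; rewrite -row_mx_decomp (_ : D j (row_mx _ 0) = 0); last first.
    by apply: critF; [have [] := rP _ zb1|rewrite row_mxKr].
  rewrite subr0 => ->.
  have [Ot He] := rP _ (inball _ _ zr t01).
  rewrite derive_rsub; last exact: (smooth_on_differentiable (sD j)).
  rewrite mxE -sumrB (le_trans (ler_norm_sum _ _ _))//.
  apply: (@le_trans _ _ (\sum_(i < l) (`|rsubmx z| * e))).
    apply: ler_sum => i _; rewrite -mulrBr normrM ler_pM//; first exact: norm_coord.
    by rewrite [H0 _ _]mxE distrC; exact: He.
  by rewrite sumr_const card_ord -[leLHS]mulr_natl mulrA mulrAC.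
have DC1 z j : ball z0 r z -> `|D j z| <= C1 * `|rsubmx z|.
  move=> zr; rewrite -[D j z](subrK ((rsubmx z *m H0) 0 j)).
  rewrite (le_trans (ler_normD _ _))// /C1 mulrDl addrC lerD//; last exact: Dest.
  by apply: KH => // i; exact: norm_coord.
apply/nbhs_ballP; exists r => //= z zr b b0 Db.
set y := rsubmx z.
(* The right inverse [B] recovers [y] from [y *m H0], which is the gradient up to an error of at
   most half of [|y|] after multiplication by [B]. *)
have yb : `|y| <= 2 * K * b.
  have : `|y| <= K * (b + l%:R * e * `|y|).
    have bb0 : 0 <= b + l%:R * e * `|y| by rewrite addr_ge0// mulr_ge0// mulr_ge0// ltW.
    apply: norm_rV_le => [|j]; first by rewrite mulr_ge0.
    have -> : y 0 j = (y *m H0 *m B) 0 j by rewrite -mulmxA HB mulmx1.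
    apply: KB => // i.
    rewrite -[(y *m H0) 0 i](subKr (D i z)).
    by rewrite (le_trans (ler_normB _ _))// lerD//; [exact: Db|exact: Dest].
  have le1 : K * (l%:R * e) <= 2^-1.
    rewrite /e; rewrite mulrA ler_pdivrMr; last by rewrite !mulr_gt0// ?ltr_wpDl.
    have -> : 2^-1 * (2 * (K + 1) * (l%:R + 1)) = (K + 1) * (l%:R + 1) by field.
    by rewrite ler_pM// lerDl.
  have : K * (l%:R * e) * `|y| <= 2^-1 * `|y| by exact: ler_wpM2r.
  lra.
have zb1 : ball z0 r (row_mx (lsubmx z) 0).
  by have := inball z 0 zr; rewrite scale0r addr0 lexx ler01; exact.
(* [F] is constant on the part of the subspace in the ball, so it may be compared with its value at
   the projection of [z]. *)
have -> : F z0 = F (row_mx (lsubmx z) 0).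
  have Oseg t : 0 <= t <= 1 -> ball z0 r (z0 + t *: (row_mx (lsubmx z) 0 - z0)).
    move=> /andP[t0 t1]; move: zb1; rewrite -!ball_normE /= opprD addrA subrr sub0r normrN.
    rewrite normrZ ger0_norm// distrC => /(le_lt_trans _); apply.
    by rewrite ler_piMl.
  have [t t01|t t01] := @MVT_line _ F z0 (row_mx (lsubmx z) 0 - z0).
    by apply: (smooth_on_differentiable sF); have [] := rP _ (Oseg _ t01).
  rewrite addrCA subrr addr0 critF.
  - by move/eqP; rewrite subr_eq0 => /eqP.
  - by have [] := rP _ (Oseg _ t01).
  - by rewrite linearD linearZ linearB /= z0S row_mxKr subr0 scaler0 addr0.
have [t t01|t t01] := @MVT_line _ F (row_mx (lsubmx z) 0) (row_mx 0 y).
  by apply: (smooth_on_differentiable sF); have [] := rP _ (inball _ _ zr t01).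
rewrite -row_mx_decomp => ->.
have zt := inball _ _ zr t01; have [Ot _] := rP _ zt.
rewrite derive_rsub; last exact: (smooth_on_differentiable sF).
rewrite (le_trans (ler_norm_sum _ _ _))//.
apply: (@le_trans _ _ (\sum_(i < l) (`|y| * (C1 * `|y|)))).
  apply: ler_sum => i _; rewrite normrZ ler_pM// ?norm_coord//.
  rewrite (le_trans (DC1 _ _ zt))// ler_wpM2l//.
  rewrite linearD linearZ /= !row_mxKr add0r normrZ.
  by case/andP: t01 => t0 t1; rewrite ger0_norm// ler_piMl.
rewrite sumr_const card_ord -[leLHS]mulr_natl.
have -> : l%:R * (`|y| * (C1 * `|y|)) = l%:R * C1 * `|y| ^+ 2 by ring.
apply: (@le_trans _ _ (l%:R * C1 * (2 * K * b) ^+ 2)).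
  by rewrite ler_wpM2l ?mulr_ge0// lerXn2r// nnegrE// !mulr_ge0.
rewrite -subr_ge0 [X in 0 <= X](_ : _ = b ^+ 2); first exact: sqr_ge0.
by ring.
Qed.

End lojasiewicz.

(** * Quadratic forms on row vectors *)

Section quadratic.
Context {R : realType} {m : nat}.
Implicit Types (G : 'I_m -> 'I_m -> R) (xi : 'rV[R]_m).

Definition quad G xi : R := \sum_i \sum_j xi 0 i * xi 0 j * G i j.

Lemma linear_rV_sum (L : 'rV[R]_m -> R) :
  (forall a x y, L (a *: x + y) = a * L x + L y) ->
  forall x, L x = \sum_j x 0 j * L (delta_mx 0 j).
Proof.
move=> linL x.
have L0 : L 0 = 0.
  by have := linL 1 0 0; rewrite scaler0 addr0 mul1r; lra.
have LZ a y : L (a *: y) = a * L y by have := linL a y 0; rewrite !addr0 L0 addr0.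
have LD y z : L (y + z) = L y + L z by have := linL 1 y z; rewrite scale1r mul1r.
rewrite {1}(row_sum_delta x) (big_morph L LD L0).
by apply: eq_bigr => j _; rewrite LZ.
Qed.

Lemma quad_form (b : 'rV[R]_m -> 'rV[R]_m -> R) :
  (forall a x y z, b (a *: x + y) z = a * b x z + b y z) ->
  (forall x y, b x y = b y x) ->
  forall xi, b xi xi = quad (fun i j => b (delta_mx 0 i) (delta_mx 0 j)) xi.
Proof.
move=> blin bsym xi.
rewrite (linear_rV_sum (L := b ^~ xi))//; apply: eq_bigr => i _.
rewrite bsym (linear_rV_sum (L := b ^~ _))// mulr_sumr; apply: eq_bigr => j _.
by rewrite mulrA bsym.
Qed.

Lemma quad_le G K xi : (forall i j, `|G i j| <= K) ->
  `|quad G xi| <= m%:R ^+ 2 * K * `|xi| ^+ 2.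
Proof.
move=> GK; rewrite (le_trans (ler_norm_sum _ _ _))//.
apply: (@le_trans _ _ (\sum_(i < m) \sum_(j < m) (K * `|xi| ^+ 2))).
  apply: ler_sum => i _; rewrite (le_trans (ler_norm_sum _ _ _))//.
  apply: ler_sum => j _; rewrite !normrM mulrC ler_pM ?mulr_ge0//.
  by rewrite expr2 ler_pM// norm_coord.
rewrite !sumr_const !card_ord le_eqVlt; apply/orP; left; apply/eqP.
by rewrite -mulrnA -[LHS]mulr_natl natrM; ring.
Qed.

Lemma quadZ G a xi : quad G (a *: xi) = a ^+ 2 * quad G xi.
Proof.
rewrite /quad mulr_sumr; apply: eq_bigr => i _; rewrite mulr_sumr.
by apply: eq_bigr => j _; rewrite !mxE; ring.
Qed.

Lemma quad_continuous {G} : continuous (quad G : 'rV[R]_m -> R).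
Proof.
apply: continuous_big => [|i _]; first exact: add_continuous.
apply: continuous_big => [|j _ xi]; first exact: add_continuous.
have cj k : {for xi, continuous (fun x : 'rV[R]_m => x 0 k : R)} := @coord_continuous R 1 m 0 k xi.
exact: (continuousM (continuousM (cj i) (cj j)) (@cst_continuous _ _ (G i j) xi)).
Qed.

(** By homogeneity, [mu] can be the minimum on the unit sphere, which is compact. *)
Lemma quad_coercive G : (forall xi, xi != 0 -> 0 < quad G xi) ->
  exists2 mu : R, 0 < mu & forall xi, mu * `|xi| ^+ 2 <= quad G xi.
Proof.
move=> Gpos; pose S := [set xi : 'rV[R]_m | `|xi| = 1].
have cS : compact S.
  apply: bounded_closed_compact.
    by exists 1; split => // x x1 y /= ->; exact: ltW.
  rewrite (_ : S = (fun xi : 'rV[R]_m => `|xi|) @^-1` [set 1]); last by [].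
  by apply: closed_comp => [x _|]; [exact: norm_continuous|exact: closed_eq].
have nS xi : xi != 0 -> S (`|xi|^-1 *: xi).
  by move=> x0; rewrite /S /= normrZ normfV normr_id mulVf// normr_eq0.
have quad0 : quad G 0 = 0.
  by rewrite /quad big1// => i _; rewrite big1// => j _; rewrite !mxE !mul0r.
(* An empty sphere leaves 0 as the only vector, and any [mu] will do. *)
have [[x Sx]|S0] := pselect (S !=set0); last first.
  exists 1 => // xi; have [->|x0] := eqVneq xi 0.
    by rewrite normr0 expr0n /= mulr0 quad0.
  by exfalso; apply: S0; exists (`|xi|^-1 *: xi); exact: nS.
have [c] := @EVT_min_rV R m (quad G) S (ex_intro _ x Sx) cS
  (continuous_subspaceT (quad_continuous (G := G))).
rewrite inE => Sc cmin; exists (quad G c).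
  by apply: Gpos; rewrite -normr_eq0 Sc oner_eq0.
move=> xi; have [->|x0] := eqVneq xi 0.
  by rewrite normr0 expr0n /= mulr0 quad0.
have /mem_set/cmin := nS _ x0.
rewrite quadZ exprVn mulrC ler_pdivlMr// exprn_gt0// normr_gt0//.
Qed.

Lemma quadB G G' xi : quad G xi - quad G' xi = quad (fun i j => G i j - G' i j) xi.
Proof.
rewrite /quad -sumrB; apply: eq_bigr => i _; rewrite -sumrB.
by apply: eq_bigr => j _; rewrite mulrBr.
Qed.

End quadratic.

(** * Comparison of the metric with the norm of a chart *)

Section metric.
Context {R : realType} {M : topologicalType} {n : nat} {A : atlas R M}.
Arguments A : clear implicits.
Hypothesis hM : closed_manifold n A.
Context {f : M -> R} {g : M -> tvec R M -> tvec R M -> R} {X : M -> tvec R M}.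
Hypothesis hf : forall p, smooth_near A f p.
Hypothesis hg : riemannian_metric A g.
Hypothesis hX : neg_gradient A g f X.

Let cov p : covers A p.
Proof. by have [c [Ac cp]] := atlas_chart hM p; exists n, c. Qed.

Lemma gl p a u v w : tangent A p u -> tangent A p v -> tangent A p w ->
  g p (a *: u + v) w = a * g p u w + g p v w.
Proof. by move=> *; have [H _ _ _] := hg (cov p); exact: H. Qed.

Lemma gsym p u v : tangent A p u -> tangent A p v -> g p u v = g p v u.
Proof. by move=> *; have [_ H _ _] := hg (cov p); exact: H. Qed.

Lemma gpos p v : tangent A p v -> v <> 0 -> 0 < g p v v.
Proof. by move=> *; have [_ _ H _] := hg (cov p); exact: H. Qed.

Lemma gsmooth p Y Z : smooth_field A Y p -> smooth_field A Z p ->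
  smooth_near A (fun y => g y (Y y) (Z y)) p.
Proof. by move=> *; have [_ _ _ H] := hg (cov p); exact: H. Qed.

Lemma g0l p w : tangent A p w -> g p 0 w = 0.
Proof.
move=> tw; have := gl 1 (tangent0 hM p) (tangent0 hM p) tw.
by rewrite scaler0 addr0 mul1r; lra.
Qed.

Lemma gge0 p v : tangent A p v -> 0 <= g p v v.
Proof.
move=> tv; have [->|v0] := pselect (v = 0); first by rewrite g0l//; exact: (tangent0 hM).
by rewrite ltW// gpos.
Qed.

Lemma Xtan p : tangent A p (X p).
Proof. by have [] := hX (cov p). Qed.

Lemma Xgrad p v : tangent A p v -> g p (X p) v = - v f.
Proof. by have [_] := hX (cov p); exact. Qed.

Lemma cauchy_schwarz p u v : tangent A p u -> tangent A p v ->
  g p u v ^+ 2 <= g p u u * g p v v.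
Proof.
move=> tu tv; have [v0|v0] := pselect (v = 0).
  by rewrite gsym// v0 !g0l ?expr0n ?mulr0//; exact: (tangent0 hM).
have vpos := gpos tv v0.
have tZ a w : tangent A p w -> tangent A p (a *: w).
  by move=> tw; rewrite -[a *: w]addr0; apply: (tangent_lin hM) => //; exact: (tangent0 hM).
have gZ a w w' : tangent A p w -> tangent A p w' -> g p (a *: w) w' = a * g p w w'.
  move=> tw tw'; rewrite -[a *: w]addr0 gl//; last exact: (tangent0 hM).
  by rewrite g0l// addr0.
have gD a b w : tangent A p w -> g p (a *: u + b *: v) w = a * g p u w + b * g p v w.
  by move=> tw; rewrite gl ?gZ//; exact: tZ.
pose a := g p v v; pose b := - g p u v.
have tw : tangent A p (a *: u + b *: v) by apply: (tangent_lin hM) => //; exact: tZ.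
have := gge0 tw; rewrite gD// (gsym tu tw) (gsym tv tw) !gD// (gsym tv tu).
rewrite (_ : _ + _ = a * (g p u u * g p v v - g p u v ^+ 2)); last by rewrite /a /b; ring.
by rewrite pmulr_rge0// subr_ge0.
Qed.

Lemma chart_quad m (c : chart R M m) p xi : max_atlas A c -> cdom c p ->
  g p (chart_tvec A c xi p) (chart_tvec A c xi p) =
  quad (fun i j => g p (chart_tvec A c (delta_mx 0 i) p) (chart_tvec A c (delta_mx 0 j) p)) xi.
Proof.
move=> mc cp.
rewrite (quad_form (b := fun x y => g p (chart_tvec A c x p) (chart_tvec A c y p)))//.
  move=> a x y z; rewrite (chart_tvec_lin hM)//; apply: gl; exact: (chart_tvec_tangent hM).
by move=> x y; apply: gsym; exact: (chart_tvec_tangent hM).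
Qed.

(** Coercivity at the single point [p] extends to a neighbourhood, since the coefficients of the
    metric are smooth, hence continuous. *)
Lemma metric_bounds m (c : chart R M m) p : max_atlas A c -> cdom c p ->
  exists2 k : R, 0 < k & \forall q \near p, cdom c q /\ forall xi,
    `|xi| ^+ 2 <= k * g q (chart_tvec A c xi q) (chart_tvec A c xi q) /\
    g q (chart_tvec A c xi q) (chart_tvec A c xi q) <= k * `|xi| ^+ 2.
Proof.
move=> mc cp.
pose G q i j := g q (chart_tvec A c (delta_mx 0 i) q) (chart_tvec A c (delta_mx 0 j) q).
have [xi xi0|mu mu0 muG] := @quad_coercive _ _ (G p).
  rewrite -chart_quad//; apply: gpos; first exact: (chart_tvec_tangent hM).
  move=> x0; move/eqP: xi0; apply; apply/rowP => j.
  by rewrite -(chart_tvec_coord hM _ _ mc cp) x0 mxE.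
(* Coefficients that move by at most [e] change the form by at most [mu / 2], so half of the
   coercivity at [p] is left. *)
pose e := mu / (2 * (m%:R ^+ 2 + 1)).
have m2 : 0 < 2 * (m%:R ^+ 2 + 1) :> R by rewrite mulr_gt0// ltr_wpDl.
have e0 : 0 < e by rewrite divr_gt0.
have me : m%:R ^+ 2 * e <= mu / 2.
  rewrite /e mulrA ler_pdivrMr//.
  have -> : mu / 2 * (2 * (m%:R ^+ 2 + 1)) = (m%:R ^+ 2 + 1) * mu :> R by field.
  by rewrite ler_pM2r// lerDl.
pose K := \sum_i \sum_j `|G p i j|.
have GK i j : `|G p i j| <= K.
  rewrite /K (bigD1 i)//= (bigD1 j)//= -addrA lerDl addr_ge0// sumr_ge0// => ? _.
  by rewrite sumr_ge0.
have K0 : 0 <= K by rewrite sumr_ge0// => ? _; rewrite sumr_ge0.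
(* [2 / mu] serves the lower bound of the form, the other two terms the upper one. *)
pose k := 2 / mu + m%:R ^+ 2 * K + mu.
have k0 : 0 < k by rewrite ltr_wpDl// addr_ge0// ?divr_ge0 ?mulr_ge0// ltW.
exists k => //.
have nG : \forall q \near p, forall i j, `|G q i j - G p i j| <= e.
  apply: (@filter_forall _ _ (fun i q => forall j, `|G q i j - G p i j| <= e) _
    (nbhs_filter p)) => i.
  apply: (@filter_forall _ _ (fun j q => `|G q i j - G p i j| <= e) _
    (nbhs_filter p)) => j.
  have := smooth_near_continuous hM (gsmooth (smooth_field_chart hM (delta_mx 0 i) mc cp)
    (smooth_field_chart hM (delta_mx 0 j) mc cp)).
  by move=> /cvgrPdist_le/(_ _ e0); apply: filterS => q; rewrite distrC.
apply: filterS (filterI nG (near_cdom hM mc cp)) => q [Gq cq]; split=> // xi.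
rewrite chart_quad// -/(G q).
have := quad_le xi (Gq); rewrite -quadB => H.
have {}H : `|quad (G q) xi - quad (G p) xi| <= mu / 2 * `|xi| ^+ 2.
  by apply: le_trans H _; rewrite ler_wpM2r ?sqr_ge0.
have H1 := muG xi; have H2 := quad_le xi GK.
move: H H2; rewrite !ler_norml => /andP[Ha Hb] /andP[_ Hc].
have x2 : 0 <= `|xi| ^+ 2 by exact: sqr_ge0.
split.
  apply: (@le_trans _ _ (2 / mu * quad (G q) xi)).
    by rewrite mulrAC ler_pdivlMr//; lra.
  apply: ler_wpM2r.
    by apply: (@le_trans _ _ (mu / 2 * `|xi| ^+ 2)); [rewrite mulr_ge0// divr_ge0// ltW|lra].
  by rewrite /k -addrA lerDl addr_ge0 ?mulr_ge0// ltW.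
rewrite /k.
have h1 : 0 <= 2 / mu * `|xi| ^+ 2 by rewrite mulr_ge0// divr_ge0// ltW.
have h2 : 0 <= mu * `|xi| ^+ 2 by rewrite mulr_ge0// ltW.
lra.
Qed.

(** The coordinates of [X] are bounded by its length directly; a partial derivative of [f] is minus
    the product of [X] with a coordinate vector, hence the Cauchy-Schwarz inequality. *)
Lemma gradient_bounds m (c : chart R M m) p : max_atlas A c -> cdom c p ->
  exists2 k : R, 0 < k & \forall q \near p, [/\ cdom c q,
    forall j, X q (fun y => cfun c y 0 j) ^+ 2 <= k * g q (X q) (X q) &
    forall j, 'D_(delta_mx 0 j) (f \o cinv c : _ -> R^o) (cfun c q) ^+ 2 <=
      k * g q (X q) (X q)].
Proof.
move=> mc cp; have [k k0 kP] := metric_bounds mc cp; exists k => //.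
apply: filterS kP => q [cq kq]; split => // j.
  have [] := kq (\row_j X q (fun y => cfun c y 0 j)).
  rewrite -(chart_tvecP hM mc cq (Xtan q)) => H _; apply: le_trans H.
  rewrite -real_normK ?num_real// lerXn2r ?nnegrE//.
  by have := norm_coord (\row_j X q (fun y => cfun c y 0 j)) j; rewrite mxE.
have te := chart_tvec_tangent hM (delta_mx 0 j) mc cq.
rewrite -(chart_tvecE hM _ mc cq (hf q)) -sqrrN -(Xgrad te).
apply: le_trans (cauchy_schwarz (Xtan q) te) _; rewrite mulrC ler_wpM2r ?gge0//.
  exact: Xtan.
have [_ H] := kq (delta_mx 0 j); apply: le_trans H _.
rewrite ler_piMr ?(ltW k0)// -(expr1n _ 2) lerXn2r ?nnegrE//.
by apply: norm_rV_le => // i; rewrite mxE; case: eqP => _; case: eqP => _; rewrite ?normr0 ?normr1.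
Qed.

End metric.

(** * The Lojasiewicz inequality on the manifold *)

Section loj.
Context {R : realType} {M : topologicalType} {n : nat} {A : atlas R M}.
Arguments A : clear implicits.
Hypothesis hM : closed_manifold n A.
Context {f : M -> R} {g : M -> tvec R M -> tvec R M -> R} {X : M -> tvec R M}.
Hypothesis hf : forall p, smooth_near A f p.
Hypothesis hg : riemannian_metric A g.
Hypothesis hX : neg_gradient A g f X.

Lemma mnear_near p (P : M -> Prop) : mnear A p P -> \forall q \near p, P q.
Proof.
move=> [m [c [Ac cp [ O [oO Op Oc OP]]]]]; have mc := atlas_max hM Ac.
have nO : nbhs (cfun c p) O by exact: open_nbhs_nbhs.
apply: filterS (filterI (max_cfun_near hM mc cp nO) (near_cdom hM mc cp)) => q [Oq cq].
by rewrite -(cfunK (max_ok mc) cq); exact: OP.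
Qed.

Lemma max_cinv_near_ccod m (c : chart R M m) p (P : set M) : max_atlas A c ->
  cdom c p -> nbhs p P -> \forall z \near cfun c p, ccod c z /\ P (cinv c z).
Proof.
move=> mc cp nP; apply: filterI; first exact: (near_ccod mc (ccod_cfun cp)).
exact: (max_cinv_near hM mc cp nP).
Qed.

Lemma critP p : crit A f p <-> X p f = 0.
Proof.
have [c [Ac cp]] := atlas_chart hM p; split.
  by move=> [_]; apply; exact: (Xtan hM hX).
move=> Xf0; split; first by exists n, c.
move=> v tv; have tX := Xtan hM hX p.
have X0 : X p = 0.
  apply/not_notP => X0; have := gpos hM hg tX X0.
  by rewrite (Xgrad hM hX tX) Xf0 oppr0 ltxx.
have := Xgrad hM hX tv; rewrite X0 (g0l hM hg)// => /esym/eqP.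
by rewrite oppr_eq0 => /eqP.
Qed.

Lemma speedE p : g p (X p) (X p) = - X p f.
Proof. by apply: (Xgrad hM hX); exact: (Xtan hM hX). Qed.

Lemma speed_ge0 p : 0 <= g p (X p) (X p).
Proof. by apply: (gge0 hM hg); exact: (Xtan hM hX). Qed.

Lemma crit_derive m (c : chart R M m) q v : max_atlas A c -> cdom c q ->
  crit A f q -> 'D_v (f \o cinv c : _ -> R^o) (cfun c q) = 0.
Proof.
move=> mc cq [_ Cq]; rewrite -(chart_tvecE hM v mc cq (hf q)).
by apply: Cq; exact: (chart_tvec_tangent hM).
Qed.

(** [Zf y f] is a sum of coefficients of [Zf] times partial derivatives of [f]. The latter vanish at
    [p], so in the product rule only their own derivatives survive, whichever extension [Zf] is
    taken. *)
Lemma smooth_field_derive m (c : chart R M m) p v Zf : max_atlas A c -> cdom c p ->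
  crit A f p -> smooth_field A Zf p ->
  (forall j, 'D_v (fun z => 'D_(delta_mx 0 j) (f \o cinv c : _ -> R^o) z) (cfun c p) = 0) ->
  chart_tvec A c v p (fun y => Zf y f) = 0.
Proof.
move=> mc cp Cp [tZ sZ] Hv; have okc := max_ok mc.
pose D j z := 'D_(delta_mx 0 j) (f \o cinv c : _ -> R^o) z.
pose ze j (z : 'rV[R]_m) : R^o := Zf (cinv c z) (fun y => cfun c y 0 j).
rewrite (chart_tvecE hM v mc cp (sZ _ (hf p))).
have [ O [Op Oc sO]] := (smooth_nearP hM _ mc cp).1 (hf p).
have E : \forall z \near cfun c p,
    (\sum_(j < m) (ze j * D j)) z = (((fun y => Zf y f) \o cinv c) z : R^o).
  have nt := max_cinv_near_ccod mc cp (filterI (mnear_near tZ) (near_cdom hM mc cp)).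
  near=> z.
  have [czz [tz cz]] : ccod c z /\ tangent A (cinv c z) (Zf (cinv c z)) /\ cdom c (cinv c z).
    by near: z; exact: nt.
  rewrite /=.
  rewrite (chart_tvecP hM mc cz tz) (chart_tvecE hM _ mc cz (hf _)).
  rewrite derive_rV; last exact/smooth_at_chart_diff/(smooth_nearP hM _ mc cz).
  rewrite fct_sumE; apply: eq_bigr => j _; rewrite mxE /D /ze /=.
  by rewrite (cinvK okc czz).
rewrite -[LHS](near_eq_derive v E).
have dz j : differentiable (ze j) (cfun c p).
  have := sZ _ (smooth_near_coord hM j mc cp).
  by move=> /(smooth_nearP hM _ mc cp)/smooth_at_chart_diff.
have dD j : differentiable (D j) (cfun c p).
  exact: (smooth_on_differentiable (smooth_on_derive _ sO) Op).
rewrite derive_sum => [|j]; last by apply: derivableM; exact: diff_derivable.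
apply: big1 => j _; rewrite deriveM; [|exact: diff_derivable..].
by rewrite [D j _]crit_derive// scale0r addr0 Hv scaler0.
Unshelve. all: by end_near. Qed.

(** The normal coordinates of a curve in [W] are constantly 0, hence so are those of its
    velocity. *)
Lemma tangent_slice k l (c : chart R M (k + l)) (W : set M) p v : max_atlas A c ->
  cdom c p -> (forall q, cdom c q -> W q -> rsubmx (cfun c q) = 0) ->
  tangent_in A W p (chart_tvec A c v p) -> rsubmx v = 0.
Proof.
move=> mc cp cW [gam [sg g0 gW E]]; apply/rowP => i; rewrite !mxE.
rewrite -(chart_tvec_coord hM v (rshift k i) mc cp) E /velocity g0.
case: asboolP => [_|[]]; last exact: (smooth_near_coord hM).
have cg : cdom c (gam 0) by rewrite g0.
have [gc _] := smooth_curve_chart hM mc sg cg.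
rewrite derive1E.
have E0 : \forall t \near (0 : R^o), (0 : R^o) =
    ((fun q => cfun c q 0 (rshift k i)) \o gam) t.
  apply: filterS (filterI gc gW) => t [ct /(cW _ ct)/rowP/(_ i)] /=.
  by rewrite !mxE => ->.
by rewrite -[LHS](near_eq_derive (1 : R^o) E0) derive_cst.
Qed.

Lemma lojasiewicz_crit p : morse_bott A f -> crit A f p ->
  exists m (c : chart R M m), [/\ max_atlas A c, cdom c p &
    exists2 C : R, 0 < C & \forall q \near p, forall b, 0 <= b ->
    (forall j, `|'D_(delta_mx 0 j) (f \o cinv c : _ -> R^o) (cfun c q)| <= b) ->
    `|f q - f p| <= C * b ^+ 2].
Proof.
move=> [clS subS ndS] Cp.
have [k [_ [[l [c [mc cS ->]]] [cp _]]]] := subS _ Cp.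
exists (k + l)%N, c; split => //; have okc := max_ok mc.
have [ O [Op Oc sO]] := (smooth_nearP hM _ mc cp).1 (hf p).
have critF z v : O z -> rsubmx z = 0 -> 'D_v (f \o cinv c : _ -> R^o) z = 0.
  move=> Oz z0; have cz := cinv_cdom okc (Oc _ Oz).
  have zK := cinvK okc (Oc _ Oz); rewrite -{1}zK; apply: crit_derive => //.
  by apply/(cS _ cz); rewrite zK.
have nondeg v : (forall j, 'D_v (fun z => 'D_(delta_mx 0 j) (f \o cinv c : _ -> R^o) z) (cfun c p) = 0) ->
    rsubmx v = 0.
  move=> Hv; apply: (tangent_slice (W := crit A f) mc cp); first by move=> q cq /(cS _ cq).
  apply: ndS => //; first exact: (chart_tvec_tangent hM).
  (* Every extension that [xget] may pick gives the value 0, and so does its default. *)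
  move=> Z tZ; rewrite /hess; case: xgetP => // r _ [Zf [sZ _ ->]].
  exact: smooth_field_derive sZ Hv.
have [C C0 HC] := lojasiewicz_morse_bott sO Op ((cS _ cp).1 Cp) critF nondeg.
exists C => //.
apply: filterS (filterI (near_cdom hM mc cp) (max_cfun_near hM mc cp HC)) => q [cq Hq] b b0 Hb.
by have := Hq b b0 Hb; rewrite /= !cfunK.
Qed.

(** At a regular point some partial derivative stays away from 0 while [|f q - f p| <= 1], so the
    inequality only costs a constant. Having it at every point lets the estimates along trajectories
    treat critical and regular points alike. *)
Lemma lojasiewicz p : morse_bott A f ->
  exists m (c : chart R M m), [/\ max_atlas A c, cdom c p &
    exists2 C : R, 0 < C & \forall q \near p, [/\ cdom c q,
    forall j, X q (fun y => cfun c y 0 j) ^+ 2 <= C * g q (X q) (X q) &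
    `|f q - f p| <= C * g q (X q) (X q)]].
Proof.
move=> hMB; have [Cp|nCp] := pselect (crit A f p).
  have [m [c [mc cp [C C0 HC]]]] := lojasiewicz_crit hMB Cp.
  have [k k0 Hk] := gradient_bounds hM hf hg hX mc cp.
  exists m, c; split => //; exists (k + C * k); first by rewrite addr_gt0// mulr_gt0.
  apply: filterS (filterI HC Hk) => q [Hq [cq Xk Dk]]; split=> //.
    move=> j; apply: le_trans (Xk j) _; rewrite ler_wpM2r ?speed_ge0//.
    by rewrite lerDl mulr_ge0// ltW.
  (* By [Dk], this square root bounds all partial derivatives of [f] at [q]. *)
  apply: le_trans (Hq (Num.sqrt (k * g q (X q) (X q))) (sqrtr_ge0 _) _) _.
    by move=> j; rewrite -sqrtr_sqr ler_wsqrtr.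
  rewrite sqr_sqrtr; last by rewrite mulr_ge0 ?speed_ge0// ltW.
  by rewrite mulrA ler_wpM2r ?speed_ge0// lerDr ltW.
have [c [Ac cp]] := atlas_chart hM p; have mc := atlas_max hM Ac.
exists n, c; split => //.
have [k k0 Hk] := gradient_bounds hM hf hg hX mc cp.
pose D j := 'D_(delta_mx 0 j) (f \o cinv c : _ -> R^o).
have [ O [Op Oc sO]] := (smooth_nearP hM _ mc cp).1 (hf p).
have [j Dj0] : exists j, D j (cfun c p) != 0.
  apply/not_existsP => H; apply: nCp; split; first by exists n, c.
  move=> v /(tangentP hM _ mc cp)[xi ->]; rewrite (chart_tvecE hM _ mc cp (hf p)).
  rewrite derive_rV; last exact: smooth_on_differentiable sO Op.
  rewrite big1// => j _; have /negP := H j; rewrite negbK => /eqP.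
  by rewrite /D => ->; rewrite scaler0.
pose e := `|D j (cfun c p)| / 2.
have e0 : 0 < e by rewrite divr_gt0// normr_gt0.
have nD : \forall q \near p, e <= `|D j (cfun c q)|.
  have cD : {for cfun c p, continuous (D j)}.
    exact: (smooth_on_continuous (smooth_on_derive _ sO) Op).
  have /cvgrPdist_le/(_ _ e0) H := cD.
  apply: filterS (max_cfun_near hM mc cp H) => q Hq.
  have := ler_normD (D j (cfun c q)) (D j (cfun c p) - D j (cfun c q)).
  by rewrite addrCA subrr addr0; move: Hq; rewrite /e; lra.
have nf : \forall q \near p, `|f q - f p| <= 1.
  have /cvgrPdist_le/(_ _ ltr01) := smooth_near_continuous hM (hf p).
  by apply: filterS => q; rewrite distrC.
exists (k + k / e ^+ 2); first by rewrite addr_gt0// divr_gt0// exprn_gt0.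
apply: filterS (filterI nf (filterI nD Hk)) => q [fq [eD [cq Xk Dk]]]; split=> //.
  move=> i; apply: le_trans (Xk i) _; rewrite ler_wpM2r ?speed_ge0//.
  by rewrite lerDl divr_ge0// ?ltW// exprn_gt0.
apply: le_trans fq _; rewrite mulrDl addrC.
have H0 : 0 <= k * g q (X q) (X q) by rewrite mulr_ge0 ?speed_ge0// ltW.
rewrite (@le_trans _ _ (k / e ^+ 2 * g q (X q) (X q)))// ?lerDl//.
rewrite mulrAC ler_pdivlMr ?exprn_gt0// mul1r.
apply: le_trans (Dk j); rewrite -[leRHS]real_normK ?num_real//.
by rewrite lerXn2r ?nnegrE// ltW.
Qed.

End loj.

(** * The gradient flow and the limits of its trajectories *)

Section flow.
Context {R : realType} {M : topologicalType} {n : nat} {A : atlas R M}.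
Arguments A : clear implicits.
Hypothesis hM : closed_manifold n A.
Context {f : M -> R} {g : M -> tvec R M -> tvec R M -> R} {X : M -> tvec R M}.
Hypothesis hf : forall p, smooth_near A f p.
Hypothesis hg : riemannian_metric A g.
Hypothesis hX : neg_gradient A g f X.
Context {phi : R -> M -> M}.
Hypothesis hphi : is_flow A X phi.

Lemma manifold_hausdorff : hausdorff_space M. Proof. by case: hM. Qed.

Lemma limit_unique (F : set_system M) {FF : ProperFilter F} (y y' : M) :
  F --> y -> F --> y' -> y = y'.
Proof. by move=> Fy Fy'; exact: (cvg_unique manifold_hausdorff Fy Fy'). Qed.

Lemma manifold_compact : compact [set: M]. Proof. by case: hM. Qed.

Lemma flow0 x : phi 0 x = x. Proof. by case: hphi. Qed.

Lemma flowD s t x : phi (s + t) x = phi s (phi t x). Proof. by case: hphi. Qed.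

Lemma flowK t x : phi (- t) (phi t x) = x.
Proof. by rewrite -flowD addNr flow0. Qed.

Lemma flowNK t x : phi t (phi (- t) x) = x.
Proof. by rewrite -flowD subrr flow0. Qed.

Lemma flow_is_derive t x h : smooth_near A h (phi t x) ->
  is_derive (t : R^o) (1 : R^o) (fun s => h (phi s x) : R^o) (X (phi t x) h).
Proof. by case: hphi => _ _ H _; exact: H. Qed.

Lemma flow_joint_continuous t x :
  {for (t, x), continuous (fun z : R * M => phi z.1 z.2)}.
Proof.
have [_ _ _ /(_ t x)[m [c [k [d [Ac Ad cx dtx [ O [Op OP sO]]]]]]]] := hphi.
have mc := atlas_max hM Ac; have md := atlas_max hM Ad.
have cc := max_cfun_continuous hM mc cx.
have cL : {for (t, x), continuous (fun z : R * M => (z.1 : R^o, cfun c z.2))}.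
  have c1 : z.1 @[z --> (t, x)] --> t by exact: cvg_fst.
  have c2 : cfun c z.2 @[z --> (t, x)] --> cfun c x.
    exact: (continuous_comp (cvg_snd : _ @ nbhs (t, x) --> _) cc).
  exact: (cvg_pair c1 c2).
have cK := smooth_on_continuous sO Op.
have H1 := continuous_comp cL cK.
have ctx : ccod d (cfun d (phi t (cinv c (cfun c x)))).
  by rewrite (cfunK (max_ok mc))//; exact: ccod_cfun.
have H2 := continuous_comp H1 (max_cinv_continuous hM md ctx).
have oO : open O by case: sO.
have nO : \forall z \near (t, x), cdom c z.2 /\ O (z.1 : R^o, cfun c z.2).
  have nx : \forall z \near (t, x), cdom c z.2.
    by apply: (cvg_snd : _ @ nbhs (t, x) --> _); exact: (near_cdom hM mc cx).
  have nO : \forall z \near (t, x), O (z.1 : R^o, cfun c z.2).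
    exact: (cL _ (open_nbhs_nbhs (conj oO Op))).
  exact: filterI nx nO.
have E : \forall z \near (t, x),
    (cinv d \o ((fun z => cfun d (phi z.1 (cinv c z.2))) \o
      (fun z : R * M => (z.1 : R^o, cfun c z.2)))) z = phi z.1 z.2.
  apply: filterS nO => z [cz Oz] /=.
  rewrite (cfunK (max_ok mc) cz) (cfunK (max_ok md))//.
  by have [_] := OP _ Oz; rewrite /= (cfunK (max_ok mc) cz).
have H3 : phi z.1 z.2 @[z --> (t, x)] --> cinv d (cfun d (phi t (cinv c (cfun c x)))).
  exact: (cvg_trans (near_eq_cvg E) H2).
rewrite (cfunK (max_ok mc) cx) (cfunK (max_ok md) dtx) in H3; exact: H3.
Qed.

Lemma flow_continuous_time x : continuous (phi ^~ x).
Proof.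
move=> t; apply: (@continuous_comp _ _ _ (fun t => (t, x)) (fun z : R * M => phi z.1 z.2)).
  have c1 : s @[s --> t] --> t by exact: cvg_id.
  have c2 : x @[_ --> t] --> x by exact: cvg_cst.
  exact: (cvg_pair c1 c2).
exact: flow_joint_continuous.
Qed.

Lemma flow_continuous t : continuous (phi t).
Proof.
move=> x; apply: (@continuous_comp _ _ _ (fun x => (t, x)) (fun z : R * M => phi z.1 z.2)).
  have c1 : t @[_ --> x] --> t by exact: cvg_cst.
  have c2 : s @[s --> x] --> x by exact: cvg_id.
  exact: (cvg_pair c1 c2).
exact: flow_joint_continuous.
Qed.

Lemma f_continuous : continuous f.
Proof. by move=> p; exact: (smooth_near_continuous hM (hf p)). Qed.

Lemma f_flow_continuous x : continuous (fun t => f (phi t x)).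
Proof.
by move=> t; apply: continuous_comp; [exact: flow_continuous_time|exact: f_continuous].
Qed.

Lemma f_flow_is_derive t x :
  is_derive (t : R^o) (1 : R^o) (fun s => f (phi s x) : R^o) (- g (phi t x) (X (phi t x)) (X (phi t x))).
Proof. by rewrite (speedE hM hX) opprK; exact: flow_is_derive. Qed.

Lemma f_flow_MVT x s t : s < t -> exists2 r, s < r < t &
  f (phi t x) - f (phi s x) = - g (phi r x) (X (phi r x)) (X (phi r x)) * (t - s).
Proof.
move=> st; have [||r] := @MVT R (fun t => f (phi t x))
  (fun r => - g (phi r x) (X (phi r x)) (X (phi r x))) _ _ st.
- by move=> r _; exact: f_flow_is_derive.
- exact/continuous_subspaceT/f_flow_continuous.
by rewrite in_itv /= => srt E; exists r.
Qed.

Lemma f_flow_le x s t : s <= t -> f (phi t x) <= f (phi s x).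
Proof.
rewrite le_eqVlt => /predU1P[->//|st]; have [r _ E] := f_flow_MVT x st.
rewrite -subr_le0 E mulNr oppr_le0; apply: mulr_ge0; first exact: (speed_ge0 hM hg hX).
by rewrite subr_ge0 ltW.
Qed.

Lemma crit_X0 p : crit A f p -> X p = 0.
Proof.
move=> /(critP hM hg hX) Xf0; apply/not_notP => X0.
have := gpos hM hg (Xtan hM hX p) X0.
by rewrite (Xgrad hM hX (Xtan hM hX p)) Xf0 oppr0 ltxx.
Qed.

Lemma flow_chart_differentiable t x m (c : chart R M m) k (d : chart R M k) j :
  max_atlas A c -> cdom c x -> max_atlas A d -> cdom d (phi t x) ->
  differentiable (fun z => cfun d (phi t (cinv c z)) 0 j : R^o) (cfun c x).
Proof.
move=> mc cx md dtx.
have [_ _ _ /(_ t x)[m' [c' [k' [d' [Ac Ad cx' dtx' [ O [Op OP sO]]]]]]]] := hphi.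
have mc' := atlas_max hM Ac; have md' := atlas_max hM Ad.
have [cc' _] := mc.2 _ _ Ac; have [_ dd'] := md.2 _ _ Ad.
have Uc : (cfun c @` (cdom c `&` cdom c')) (cfun c x) by exists x.
have d1 := smooth_on_differentiable cc' Uc.
have d2 : differentiable (fun z : 'rV[R]_m' => (t : R^o, z)) (cfun c' x).
  by apply: differentiable_pair.
have d3 := smooth_on_differentiable sO Op.
have Ud : (cfun d' @` (cdom d' `&` cdom d)) (cfun d' (phi t x)) by exists (phi t x).
have d4 := smooth_on_differentiable dd' Ud.
pose F := (cfun d \o cinv d') \o (fun z : (R^o * 'rV[R]_m')%type => cfun d' (phi z.1 (cinv c' z.2)))
  \o (fun z : 'rV[R]_m' => (t : R^o, z)) \o (cfun c' \o cinv c).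
have dF : differentiable F (cfun c x).
  apply: differentiable_comp => //.
  rewrite /= (cfunK (max_ok mc))//.
  apply: differentiable_comp => //.
  by apply: differentiable_comp => //=; rewrite (cfunK (max_ok mc')).
apply: near_eq_differentiable (differentiable_coordl j dF).
have nP : nbhs x (fun y => [/\ cdom c y, cdom c' y & cdom d' (phi t y)]).
  have n1 := near_cdom hM mc cx; have n2 := near_cdom hM mc' cx'.
  have n3 := @flow_continuous t x _ (near_cdom hM md' dtx').
  by apply: filterS (filterI n1 (filterI n2 n3)) => y [? [? ?]].
have nz := max_cinv_near hM mc cx nP.
near=> z; have [cz cz' dz] : [/\ cdom c (cinv c z), cdom c' (cinv c z) &
  cdom d' (phi t (cinv c z))] by near: z; exact: nz.
by rewrite /F /= (cfunK (max_ok mc'))// (cfunK (max_ok md')).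
Unshelve. all: by end_near. Qed.

(* [phi t] maps the vector field to itself. *)
Lemma flow_X0 t p : X p = 0 -> X (phi t p) = 0.
Proof.
move=> X0; have [c [Ac cp]] := atlas_chart hM p; have mc := atlas_max hM Ac.
have [d [Ad dp]] := atlas_chart hM (phi t p); have md := atlas_max hM Ad.
rewrite (chart_tvecP hM md dp (Xtan hM hX (phi t p))).
suff -> : \row_j X (phi t p) (fun q => cfun d q 0 j) = 0.
  have := chart_tvec_lin hM 1 0 0 md dp; rewrite scaler0 addr0 scale1r => E.
  by apply: (addrI (chart_tvec A d 0 (phi t p))); rewrite addr0 -E.
apply/rowP => j; rewrite !mxE.
have D1 := flow_is_derive (smooth_near_coord hM j md dp).
rewrite -(@derive_val _ _ _ _ _ _ _ D1).
have dK := flow_chart_differentiable j mc cp md dp.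
have dc : is_derive (0 : R^o) (1 : R^o) (fun s => cfun c (phi s p)) 0.
  have Hj i : is_derive (0 : R^o) (1 : R^o) (fun s => cfun c (phi s p) 0 i : R^o) 0.
    have := @flow_is_derive 0 p (fun q => cfun c q 0 i).
    by rewrite flow0 X0; apply; exact: (smooth_near_coord hM).
  have dd : derivable (fun s : R^o => cfun c (phi s p)) 0 1.
    by apply/derivable_mxP => i' i; rewrite (ord1 i'); have [] := Hj i.
  apply: DeriveDef => //; rewrite derive_mx//; apply/rowP => i; rewrite !mxE.
  exact: (@derive_val _ _ _ _ _ _ _ (Hj i)).
have dL : differentiable (fun s : R^o => cfun c (phi s p)) 0.
  by apply/derivable1_diffP; have [] := dc.
have dK' : differentiable (fun z => cfun d (phi t (cinv c z)) 0 j : R^o) (cfun c (phi 0 p)).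
  by rewrite flow0.
have E := derive_comp (1 : R^o) dL dK'.
rewrite (@derive_val _ _ _ _ _ _ _ dc) derive0 in E.
rewrite -[RHS]E.
(* Moving the base time from [t] to 0 exhibits the curve as [phi t] applied to [phi s p], whose
   velocity at 0 is [X p = 0]; the chain rule [E] then applies. *)
have E2 : 'D_(1 : R^o) (fun s : R^o => cfun d (phi s p) 0 j : R^o) (t : R^o) =
    'D_(1 : R^o) (fun s : R^o => cfun d (phi (s + t) p) 0 j : R^o) (0 : R^o).
  rewrite /derive; apply: (congr1 (fun u : R -> R^o => lim (u @ 0^'))).
  apply/funext => s /=.
  by rewrite addr0 add0r.
rewrite E2; apply: near_eq_derive.
have nc : \forall s \near (0 : R^o), cdom c (phi s p).
  by apply: (@flow_continuous_time p 0); rewrite flow0; exact: (near_cdom hM mc cp).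
near=> s; have cs : cdom c (phi s p) by near: s; exact: nc.
by rewrite /= (cfunK (max_ok mc) cs) addrC flowD.
Unshelve. all: by end_near. Qed.

(** In place of uniqueness for differential equations: by [flow_X0] the velocity vanishes at every
    time, so the coordinates are constant while the orbit stays in a chart, hence for small times,
    and [t] is a multiple of a small time. *)
Lemma crit_flow t p : crit A f p -> phi t p = p.
Proof.
move=> /crit_X0 X0.
have [c [Ac cp]] := atlas_chart hM p; have mc := atlas_max hM Ac.
have : \forall s \near (0 : R), cdom c (phi s p).
  by apply: (@flow_continuous_time p 0); rewrite flow0; exact: (near_cdom hM mc cp).
move=> /nbhs_ballP[e /= e0 He].
have small s : `|s| < e -> phi s p = p.
  move=> se.
  have He' r : `|r| <= `|s| -> cdom c (phi r p).
    by move=> rs; apply: He; rewrite -ball_normE /= sub0r normrN (le_lt_trans rs).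
  apply: (etrans (esym (cfunK (max_ok mc) (He' s (lexx _))))).
  apply: (etrans _ (cfunK (max_ok mc) cp)); congr cinv; apply/rowP => j.
  pose F (r : R^o) : R^o := cfun c (phi r p) 0 j.
  have dF (r : R^o) : `|r| <= `|s| -> is_derive r (1 : R^o) F 0.
    move=> rs; have := flow_is_derive (smooth_near_coord hM j mc (He' _ rs)).
    by rewrite flow_X0.
  have rs (th : R) : 0 <= th <= 1 -> `|0 + th * s| <= `|s|.
    by move=> /andP[t0 t1]; rewrite add0r normrM ger0_norm// ler_piMl.
  have ddF (r : R^o) : `|r| <= `|s| -> differentiable F r.
    by move=> /dF[+ _]; move/derivable1_diffP.
  have [th th01|th th01] := @MVT_line R R^o F 0 s; first exact/ddF/rs.
  have Hth := rs _ th01.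
  rewrite deriveE; last exact: ddF.
  have -> : 'd F (0 + th *: s : R^o) s = s *: 'd F (0 + th *: s : R^o) (1 : R^o).
    by rewrite -linearZ /= /GRing.scale /= mulr1.
  rewrite -deriveE; last exact: ddF.
  rewrite (@derive_val _ _ _ _ _ _ _ (dF _ Hth)) scaler0 add0r /F flow0 => /eqP.
  by rewrite subr_eq0 => /eqP.
have [N tN] : exists N : nat, `|t| / N.+1%:R < e.
  exists (Num.truncn (`|t| / e)); rewrite ltr_pdivrMr// mulrC -ltr_pdivrMr//.
  exact: truncnS_gt.
have fix1 : phi (t / N.+1%:R) p = p.
  by apply: small; rewrite normrM [X in _ * X]ger0_norm// invr_ge0.
have : forall k : nat, phi (k%:R * (t / N.+1%:R)) p = p.
  elim=> [|k IH]; first by rewrite mul0r flow0.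
  by rewrite -natr1 mulrDl mul1r flowD fix1.
by move=> /(_ N.+1); rewrite mulrCA divff ?mulr1.
Qed.

Lemma crit_flowE t x : crit A f (phi t x) -> phi t x = x.
Proof. by move=> /(crit_flow (- t)); rewrite flowK. Qed.

Lemma f_flow_lt x s t : ~ crit A f x -> s < t -> f (phi t x) < f (phi s x).
Proof.
move=> nx st; have [r _ E] := f_flow_MVT x st.
rewrite -subr_lt0 E mulNr oppr_lt0 mulr_gt0 ?subr_gt0//.
rewrite lt_def (speed_ge0 hM hg hX) andbT (speedE hM hX) oppr_eq0.
apply/negP => /eqP/(critP hM hg hX) Cr; apply: nx.
by rewrite -(crit_flowE Cr).
Qed.

(** Translation invariance of [F] makes the limit a fixed point of the flow, whereas [f] strictly
    decreases along the orbit of a noncritical point. *)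
Lemma flow_limit_crit (F : set_system R) (FF : ProperFilter F) x y :
  (forall s : R, (s + t @[t --> F]) --> F) ->
  phi t x @[t --> F] --> y -> crit A f y.
Proof.
move=> Finv Fy.
have fixy s : phi s y = y.
  apply: (@limit_unique (phi (s + t) x @[t --> F])).
    rewrite (_ : (fun t => phi (s + t) x) = phi s \o (phi ^~ x)).
      exact: (continuous_cvg _ (@flow_continuous s y) Fy).
    by apply/funext => t; rewrite flowD.
  by move=> P /Fy HP; exact: (Finv s _ HP).
apply: contrapT => ny.
by have := f_flow_lt ny (@ltr01 R); rewrite !fixy ltxx.
Qed.

Lemma starts_crit x y : starts phi x y -> crit A f y.
Proof.
apply: flow_limit_crit => s; apply/cvgrNyPle => B.
near=> t; rewrite -lerBrDl; near: t; exact: (nbhs_ninfty_le (num_real _)).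
Unshelve. all: by end_near. Qed.

Lemma f_starts x y : starts phi x y -> f (phi t x) @[t --> -oo] --> f y.
Proof. by move=> sxy; exact: (continuous_cvg _ (@f_continuous y) sxy). Qed.

Lemma f_ends x y : ends phi x y -> f (phi t x) @[t --> +oo] --> f y.
Proof. by move=> sxy; exact: (continuous_cvg _ (@f_continuous y) sxy). Qed.

Lemma f_starts_le x y t : starts phi x y -> f (phi t x) <= f y.
Proof.
move=> /f_starts H; rewrite -(cvg_lim (@Rhausdorff R) H).
apply: limr_ge; first by apply/cvg_ex; exists (f y).
near=> s; apply: f_flow_le; near: s; exact: (nbhs_ninfty_le (num_real _)).
Unshelve. all: by end_near. Qed.

Lemma f_ends_le x y t : ends phi x y -> f y <= f (phi t x).
Proof.
move=> /f_ends H; rewrite -(cvg_lim (@Rhausdorff R) H).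
apply: limr_le; first by apply/cvg_ex; exists (f y).
near=> s; apply: f_flow_le; near: s; exact: (nbhs_pinfty_ge (num_real _)).
Unshelve. all: by end_near. Qed.

Lemma starts_of_crit x : crit A f x -> starts phi x x.
Proof.
move=> Cx; rewrite /starts (_ : phi ^~ x = fun=> x); first exact: cvg_cst.
by apply/funext => t; exact: crit_flow.
Qed.

Lemma starts_unique x y y' : starts phi x y -> starts phi x y' -> y = y'.
Proof. exact: limit_unique. Qed.

Lemma ends_unique x y y' : ends phi x y -> ends phi x y' -> y = y'.
Proof. exact: limit_unique. Qed.

Lemma starts_flow x y t : starts phi x y -> starts phi (phi t x) y.
Proof.
move=> sxy; rewrite /starts (_ : phi ^~ (phi t x) = (phi ^~ x) \o (fun s => s + t)).
  have H : s + t @[s --> -oo] --> -oo.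
    apply/cvgrNyPle => B.
    near=> s; rewrite -lerBrDr; near: s; exact: (nbhs_ninfty_le (num_real _)).
  by move=> P /sxy HP; exact: (H _ HP).
by apply/funext => s; rewrite /= flowD.
Unshelve. all: by end_near. Qed.

Lemma ends_flow x y t : ends phi x y -> ends phi (phi t x) y.
Proof.
move=> sxy; rewrite /ends (_ : phi ^~ (phi t x) = (phi ^~ x) \o (fun s => s + t)).
  have H : s + t @[s --> +oo] --> +oo.
    apply/cvgryPge => B.
    near=> s; rewrite -lerBlDr; near: s; exact: (nbhs_pinfty_ge (num_real _)).
  by move=> P /sxy HP; exact: (H _ HP).
by apply/funext => s; rewrite /= flowD.
Unshelve. all: by end_near. Qed.

Lemma f_starts_lt x y t : starts phi x y -> ~ crit A f x -> f (phi t x) < f y.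
Proof.
move=> sxy nx; have tt : t - 1 < t by rewrite ltrBlDr ltrDl.
exact: lt_le_trans (f_flow_lt nx tt) (f_starts_le _ sxy).
Qed.

Lemma f_ends_lt x y t : ends phi x y -> ~ crit A f x -> f y < f (phi t x).
Proof.
move=> sxy nx; have tt : t < t + 1 by rewrite ltrDl.
exact: le_lt_trans (f_ends_le _ sxy) (f_flow_lt nx tt).
Qed.

End flow.

(** * Curves in a chart dominated by a monotone function *)

Section curve.
Context {R : realType} {M : topologicalType} {n : nat} {A : atlas R M}.
Arguments A : clear implicits.
Hypothesis hM : closed_manifold n A.
Context {m : nat} {c : chart R M m} {z0 : 'rV[R]_m} {r : R}.
Hypothesis mc : max_atlas A c.
Hypothesis rc : forall z, `|z - z0| < r -> ccod c z.

Lemma shift_continuous : continuous (fun z : 'rV[R]_m => z - z0).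
Proof. by move=> z; exact: (continuousB (@cvg_id _ (nbhs z)) (@cst_continuous _ _ z0 z)). Qed.

Definition chart_ball (rho : R) : set M :=
  [set q | cdom c q /\ `|cfun c q - z0| <= rho].

(** It is a compact image in a Hausdorff space. Closedness in [M], and not just in the chart, keeps
    limits from leaving the domain of the chart. *)
Lemma closed_chart_ball rho : rho < r -> closed (chart_ball rho).
Proof.
move=> rhor; apply: compact_closed; first exact: (manifold_hausdorff hM).
pose B : set 'rV[R]_m := [set z | `|z - z0| <= rho].
have BO z : B z -> ccod c z by move=> zB; apply: rc; exact: le_lt_trans zB rhor.
have -> : chart_ball rho = cinv c @` B.
  apply/seteqP; split=> [q [cq qB]|_ [z zB <-]].
    by exists (cfun c q) => //; rewrite (cfunK (max_ok mc)).
  have cz := BO _ zB; split; first exact: (cinv_cdom (max_ok mc)).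
  by rewrite (cinvK (max_ok mc)).
apply: continuous_compact.
  apply: continuous_in_subspaceT => z /set_mem zB.
  by apply: (max_cinv_continuous hM) => //; exact: BO.
apply: bounded_closed_compact.
  exists (rho + `|z0|); split; first exact: num_real.
  move=> x xr z zB /=; rewrite -[z](subrK z0) (le_trans (ler_normD _ _))//.
  by rewrite ltW// (le_lt_trans _ xr)// lerD2r.
rewrite (_ : B = (fun z => `|z - z0|) @^-1` [set x | x <= rho]); last by [].
apply: closed_comp => [z _|]; last exact: closed_le.
exact: (continuous_comp (@shift_continuous z) (@norm_continuous _ _ (z - z0))).
Qed.

Lemma near_chart_ball q : cdom c q -> `|cfun c q - z0| < r ->
  \forall y \near q, cdom c y /\ `|cfun c y - z0| < r.
Proof.
move=> cq qr; apply: filterI; first exact: (near_cdom hM mc cq).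
have cc : {for q, continuous (fun y => `|cfun c y - z0|)}.
  exact: (continuous_comp (continuous_comp (max_cfun_continuous hM mc cq)
    (@shift_continuous _)) (@norm_continuous _ _ _)).
exact: (cvgr_lt _ cc _ qr).
Qed.

Lemma derivable_ge0_le (F : R -> R) (a b : R) : a <= b ->
  (forall t, a <= t <= b -> {for t, continuous F}) ->
  (forall t, a < t < b -> exists2 d, is_derive (t : R^o) (1 : R^o) (F : R^o -> R^o) d & 0 <= d) ->
  F a <= F b.
Proof.
move=> ab cF dF; rewrite -subr_ge0.
(* Nothing is known about the derivative at the end points, so 0 is put there; this is harmless if
   the mean value point is one of them. *)
have [t|| t tab ->] := @MVT_segment R F
  (fun t => if a < t < b then 'D_(1 : R^o) (F : R^o -> R^o) t else 0) a b ab.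
- rewrite in_itv /= => tab; rewrite tab; have [d [D1 _] _] := dF _ tab.
  exact: derivableP.
- by apply: continuous_in_subspaceT => t /set_mem /=; rewrite in_itv /=; exact: cF.
case: ifPn => [/dF[d [_ <-] d0]|_]; last by rewrite mul0r.
by rewrite mulr_ge0// subr_ge0.
Qed.

Context {q : R -> M} {psi dpsi : R -> R} {a b : R}.
Hypothesis cq : continuous q.
Hypothesis cpsi : continuous psi.
Hypothesis psi_le : forall s t, a <= s -> s <= t -> t <= b -> psi s <= psi t.
Hypothesis dq : forall t : R, a < t < b -> cdom c (q t) -> `|cfun c (q t) - z0| < r ->
  is_derive (t : R^o) (1 : R^o) (psi : R^o -> R^o) (dpsi t) /\
  forall j, exists2 d, is_derive (t : R^o) (1 : R^o) (fun t => cfun c (q t) 0 j : R^o) d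
    & `|d| <= dpsi t.

(** [psi] plus or minus any coordinate is nondecreasing. Derivatives are only required at interior
    times, because the [psi] of the application need not be differentiable where an end point lies
    on the level of the centre. *)
Lemma curve_bound_inside t : a <= t -> t <= b ->
  (forall s, a <= s <= t -> cdom c (q s) /\ `|cfun c (q s) - z0| < r) ->
  `|cfun c (q t) - cfun c (q a)| <= psi t - psi a.
Proof.
move=> ta tb Kq; apply: norm_rV_le => [|j].
  by rewrite subr_ge0 psi_le.
have cz s : a <= s <= t -> {for s, continuous (fun t => cfun c (q t) 0 j : R)}.
  move=> /Kq[cs _]; apply: (@continuous_comp _ _ _ _ (fun z : 'rV[R]_m => z 0 j : R)).
    by apply: continuous_comp; [exact: cq|exact: (max_cfun_continuous hM mc cs)].
  exact: coord_continuous.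
have H s : a < s < t -> [/\ a < s < b, cdom c (q s) & `|cfun c (q s) - z0| < r].
  move=> /andP[as_ st]; have [|? ?] := Kq s; first by rewrite !ltW.
  by rewrite as_ (lt_le_trans st).
rewrite !mxE ler_norml; apply/andP; split.
  have := @derivable_ge0_le (psi \+ (fun t => cfun c (q t) 0 j)) a t ta.
  rewrite /= -subr_ge0 => E; rewrite -subr_ge0.
  rewrite (_ : _ - - _ = psi t + cfun c (q t) 0 j - (psi a + cfun c (q a) 0 j)); last by ring.
  rewrite subr_ge0 -subr_ge0; apply: E.
    by move=> s /cz ?; apply: continuousD => //; exact: cpsi.
  move=> s /H[ab cs rs]; have [D1 /(_ j)[d D2 dd]] := dq ab cs rs.
  by exists (dpsi s + d); [exact: is_deriveD|move: dd; rewrite ler_norml; lra].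
have := @derivable_ge0_le (psi \- (fun t => cfun c (q t) 0 j)) a t ta.
rewrite /= -subr_ge0 => E; rewrite -subr_ge0.
rewrite (_ : _ - _ = psi t - cfun c (q t) 0 j - (psi a - cfun c (q a) 0 j)); last by ring.
rewrite subr_ge0 -subr_ge0; apply: E.
  by move=> s /cz ?; apply: continuousB => //; exact: cpsi.
move=> s /H[ab cs rs]; have [D1 /(_ j)[d D2 dd]] := dq ab cs rs.
by exists (dpsi s - d); [exact: is_deriveB|move: dd; rewrite ler_norml; lra].
Qed.

(** Continuity argument: as long as the curve is in the open ball of radius [r], the estimate puts
    it in the closed ball of radius [rho < r], so there is no last such time before [b]. *)
Lemma curve_bound : a <= b -> cdom c (q a) ->
  `|cfun c (q a) - z0| + (psi b - psi a) < r ->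
  cdom c (q b) /\ `|cfun c (q b) - cfun c (q a)| <= psi b - psi a.
Proof.
move=> ab ca rho_r; set rho := _ + _ in rho_r.
pose K := chart_ball rho; have Kcl : closed K by exact: closed_chart_ball.
pose E := [set t | a <= t <= b /\ forall s, a <= s <= t -> K (q s)].
have psi0 t : a <= t -> t <= b -> psi t - psi a <= psi b - psi a.
  by move=> ta tb; rewrite lerD2r psi_le.
have Ea : E a.
  split; first by rewrite lexx.
  move=> s /andP[s1 s2]; have -> : s = a by apply/le_anti; rewrite s2.
  by split=> //; rewrite /rho lerDl subr_ge0 psi_le.
have Eub : ubound E b by move=> t [/andP[]].
have hsE : has_sup E by split; [exists a|exists b].
pose t0 := sup E.
have at0 : a <= t0 by apply: ub_le_sup => //; exists b.
have t0b : t0 <= b by apply: ge_sup => //; exists a.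
have below s : a <= s -> s < t0 -> K (q s).
  move=> as_ st0; have [e [Ee1 Ee2] se] := sup_gt hsE.1 st0.
  by apply: Ee2; rewrite as_ ltW.
have Kt0 : K (q t0).
  apply: contrapT => nK.
  have /cq : nbhs (q t0) (~` K) by apply: open_nbhs_nbhs; split=> //; exact: closed_openC.
  move=> /nbhs_ballP[e /= e0 He].
  have [t [Ee1 Ee2] et] := sup_adherent e0 hsE.
  apply: (He t); last by apply: Ee2; case/andP: Ee1 => -> _; rewrite lexx.
  have tt0 : t <= t0 by apply: ub_le_sup => //; exists b.
  by rewrite -ball_normE /= ger0_norm ?subr_ge0// ltrBlDl -ltrBlDr.
have inK s : a <= s <= t0 -> K (q s).
  move=> /andP[as_]; rewrite le_eqVlt => /predU1P[->//|]; exact: below.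
have [t0b'|bt0] := ltP t0 b; last first.
  have tb : t0 = b by apply/le_anti; rewrite t0b.
  rewrite tb in inK; have [|cb _] := inK b; first by rewrite ab lexx.
  split => //.
  apply: curve_bound_inside => // s /inK[cs Ks]; split => //.
  exact: le_lt_trans Ks rho_r.
exfalso.
have [ct0 rt0] := Kt0.
have /cq := near_chart_ball ct0 (le_lt_trans rt0 rho_r).
move=> /nbhs_ballP[e /= e0 He].
pose t1 := Num.min b (t0 + e / 2).
have t01 : t0 < t1 by rewrite lt_min t0b' ltrDl divr_gt0.
have t1b : t1 <= b by rewrite ge_min lexx.
have in1 s : a <= s <= t1 -> cdom c (q s) /\ `|cfun c (q s) - z0| < r.
  move=> /andP[as_ st1]; have [st0|t0s] := leP s t0.
    by have [|? Ks] := inK s; [rewrite as_|split=> //; exact: le_lt_trans Ks rho_r].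
  apply: (He s); rewrite -ball_normE /= distrC gtr0_norm ?subr_gt0// ltrBlDl.
  have : t1 <= t0 + e / 2 by rewrite ge_min lexx orbT.
  lra.
suff /(ub_le_sup _) : E t1.
  by move=> /(_ (ex_intro _ b Eub)); rewrite leNgt t01.
split; first by rewrite t1b andbT (le_trans at0)// ltW.
move=> s /andP[as_ st1]; have sb := le_trans st1 t1b.
have [|cs _] := in1 s; first by rewrite as_.
split => //.
have H : `|cfun c (q s) - cfun c (q a)| <= psi s - psi a.
  apply: curve_bound_inside => // u /andP[au us].
  by apply: in1; rewrite au (le_trans us).
rewrite -(subrKA (cfun c (q a))) (le_trans (ler_normD _ _))// /rho addrC lerD2l.
exact: le_trans H (psi0 _ as_ sb).
Qed.

End curve.

(** * The signed square root *)

Section signed_sqrt.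
Context {R : realType}.

(* An increasing primitive of [x |-> 1 / (2 * sqrt |x|)], which uses that
   [Num.sqrt] is 0 on negative numbers. *)
Definition signed_sqrt (u : R) : R := Num.sqrt u - Num.sqrt (- u).

Lemma signed_sqrt_le u v : u <= v -> signed_sqrt u <= signed_sqrt v.
Proof. by move=> uv; rewrite lerB// ler_wsqrtr// lerN2. Qed.

Lemma signed_sqrt_continuous : continuous signed_sqrt.
Proof.
move=> u; apply: continuousB; first exact: sqrt_continuous.
by apply: continuous_comp; [exact: opp_continuous|exact: sqrt_continuous].
Qed.

Lemma signed_sqrt0 : signed_sqrt 0 = 0.
Proof. by rewrite /signed_sqrt oppr0 subrr. Qed.

Lemma is_derive_signed_sqrt (u : R) : u != 0 ->
  is_derive (u : R^o) (1 : R^o) (signed_sqrt : R^o -> R^o) (2 * Num.sqrt `|u|)^-1.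
Proof.
rewrite neq_lt => /orP[u0|u0].
  have E : \forall v \near (u : R^o), - Num.sqrt (- v) = signed_sqrt v :> R^o.
    have : \forall v \near u, v < 0 by exact: lt_nbhsl.
    by apply: filterS => v v0; rewrite /signed_sqrt [Num.sqrt v]ltr0_sqrtr// sub0r.
  apply: (near_eq_is_derive E).
  have u0' : 0 < - u by rewrite oppr_gt0.
  have D1 := is_derive1_sqrt u0'.
  have D2 : is_derive (u : R^o) (1 : R^o) (-%R : R^o -> R^o) (- 1) by exact: is_deriveNid.
  have := is_deriveN (is_derive1_comp D1 D2).
  by rewrite mulrN1 opprK ltr0_norm.
have E : \forall v \near (u : R^o), Num.sqrt v = signed_sqrt v :> R^o.
  have : \forall v \near u, 0 < v by exact: lt_nbhsr.
  by apply: filterS => v v0; rewrite /signed_sqrt [Num.sqrt (- v)]ltr0_sqrtr ?oppr_lt0// subr0.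
apply: (near_eq_is_derive E); rewrite gtr0_norm//; exact: is_derive1_sqrt.
Qed.

End signed_sqrt.

(** * Drift of trajectories in a chart ball *)

Section drift.
Context {R : realType} {M : topologicalType} {n : nat} {A : atlas R M}.
Arguments A : clear implicits.
Hypothesis hM : closed_manifold n A.
Context {f : M -> R} {g : M -> tvec R M -> tvec R M -> R} {X : M -> tvec R M}.
Hypothesis hf : forall p, smooth_near A f p.
Hypothesis hg : riemannian_metric A g.
Hypothesis hX : neg_gradient A g f X.
Context {phi : R -> M -> M}.
Hypothesis hphi : is_flow A X phi.

Section near_point.
Context {p : M} {m : nat} {c : chart R M m} {r k : R}.
Hypothesis mc : max_atlas A c.
Hypothesis k0 : 0 < k.
Hypothesis rc : forall z, `|z - cfun c p| < r -> ccod c z.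
Hypothesis rX : forall q, cdom c q -> `|cfun c q - cfun c p| < r ->
  (forall j, X q (fun y => cfun c y 0 j) ^+ 2 <= k * g q (X q) (X q)) /\
  `|f q - f p| <= k * g q (X q) (X q).

(** Along the flow its derivative is [- k |X|^2 / sqrt |f - f p|] off the level of [p], the 2
    cancelling that of the square root; by [rX] this dominates the speed of every coordinate. *)
Definition height (q : M) : R := 2 * k * signed_sqrt (f q - f p).

Lemma height_le q q' : f q <= f q' -> height q <= height q'.
Proof.
move=> qq'; apply: ler_wpM2l; first by rewrite mulr_ge0// ltW.
by apply: signed_sqrt_le; rewrite lerD2r.
Qed.

Lemma height_continuous : continuous height.
Proof.
move=> q.
have c1 : {for q, continuous (fun q => f q - f p)}.
  by apply: continuousB; [exact: (f_continuous hM hf)|exact: cst_continuous].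
have c2 := continuous_comp c1 (@signed_sqrt_continuous _ _).
exact: (continuousM (@cst_continuous _ _ (2 * k) q) c2).
Qed.

(* The drift along a trajectory from [q] to [q'] is bounded by the variation of
   [height], as long as this variation cannot make it leave the chart ball. *)
Definition drift_le (q q' : M) : Prop :=
  cdom c q -> `|cfun c q - cfun c p| + `|height q - height q'| < r ->
  cdom c q' /\ `|cfun c q' - cfun c q| <= `|height q - height q'|.

(** Both directions are kept because [drift_le] only locates its first argument, while the point
    known to be close to [p] may be the upper or the lower one. *)
Definition drift (q q' : M) : Prop :=
  [/\ f q' <= f q, drift_le q q' & drift_le q' q].

Lemma drift_refl q : drift q q.
Proof. by split => //; move=> cq _; split => //; rewrite subrr normr0. Qed.

(** [height] is monotone along the three points, so its variations add up exactly: no constant is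
    lost however many pieces are joined. *)
Lemma drift_trans q1 q2 q3 : drift q1 q2 -> drift q2 q3 -> drift q1 q3.
Proof.
move=> [f12 d12 d21] [f23 d23 d32].
have h12 := height_le f12; have h23 := height_le f23.
have e12 : `|height q1 - height q2| = height q1 - height q2 by rewrite ger0_norm// subr_ge0.
have e23 : `|height q2 - height q3| = height q2 - height q3 by rewrite ger0_norm// subr_ge0.
have e13 : `|height q1 - height q3| = height q1 - height q3.
  by rewrite ger0_norm// subr_ge0 (le_trans h23).
split; first exact: le_trans f12.
- move=> c1 H1; move: d12 d23; rewrite /drift_le e12 e23; rewrite e13 in H1 *.
  move=> /(_ c1)[|c2 H2]; first by apply: le_lt_trans H1; lra.
  have t12 := ler_normD (cfun c q1 - cfun c p) (cfun c q2 - cfun c q1).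
  rewrite addrC subrKA in t12.
  move=> /(_ c2)[|c3 H3]; first by apply: le_lt_trans H1; lra.
  have := ler_normD (cfun c q3 - cfun c q2) (cfun c q2 - cfun c q1).
  by rewrite subrKA; split => //; lra.
- move=> c1 H1; move: d32 d21; rewrite /drift_le !(distrC (height q3)) !(distrC (height q2)).
  rewrite (distrC (height q3)) in H1; rewrite e13 in H1 *.
  rewrite -(distrC (height q2)) e23 e12.
  move=> /(_ c1)[|c2 H2]; first by apply: le_lt_trans H1; lra.
  have t12 := ler_normD (cfun c q3 - cfun c p) (cfun c q2 - cfun c q3).
  rewrite addrC subrKA in t12.
  move=> /(_ c2)[|c3 H3]; first by apply: le_lt_trans H1; lra.
  have := ler_normD (cfun c q1 - cfun c q2) (cfun c q2 - cfun c q3).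
  by rewrite subrKA; split => //; lra.
Qed.

(** [e] is 1 or -1 and treats both directions of time together. The level of [p] is avoided at
    interior times because [signed_sqrt] is not differentiable at 0. *)
Lemma drift_le_flow (e : R) x s : e ^+ 2 = 1 -> ~ crit A f x -> 0 <= s ->
  (forall t, 0 < t < s -> f (phi (e * t) x) != f p) ->
  drift_le x (phi (e * s) x).
Proof.
move=> e1 nx s0 nf cx.
have eE : e = 1 \/ e = - 1 by move/eqP: e1; rewrite sqrf_eq1 => /orP[]/eqP; [left|right].
pose q t := phi (e * t) x.
have cq : continuous q.
  move=> t; apply: (@continuous_comp _ _ _ (fun t => e * t) (phi ^~ x)).
    exact: mulrl_continuous.
  exact: (flow_continuous_time hM hphi).
(* The sign makes [psi] nondecreasing in both directions of time. *)
pose psi t := - e * height (q t).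
have fq t t' : t <= t' -> psi t <= psi t'.
  move=> tt'; rewrite /psi /q; case: eE => ->; rewrite ?mulN1r ?opprK ?mul1r.
    by rewrite lerN2; apply: height_le; exact: (f_flow_le hM hf hg hX hphi).
  by apply: height_le; apply: (f_flow_le hM hf hg hX hphi); rewrite lerN2.
have hE : `|height x - height (phi (e * s) x)| = psi s - psi 0.
  have := fq _ _ s0; rewrite -subr_ge0 => /ger0_norm <-.
  rewrite /psi /q mulr0 (flow0 hphi).
  by case: eE => ->; [rewrite !mulN1r opprK addrC|rewrite opprK !mul1r distrC].
rewrite hE => Hr.
pose N t := g (q t) (X (q t)) (X (q t)).
have cpsi : continuous psi.
  move=> t; have c2 := continuous_comp (cq t) (@height_continuous _).
  exact: (continuousM (@cst_continuous _ _ (- e) t) c2).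
have := @curve_bound _ _ _ _ hM m c (cfun c p) r mc rc q psi
  (fun t => k * N t / Num.sqrt `|f (q t) - f p|) 0 s cq cpsi
  (fun u v _ uv _ => fq u v uv).
rewrite /q mulr0 (flow0 hphi); apply => //.
move=> t t0s ct rt.
have De : is_derive (t : R^o) (1 : R^o) (fun t => e * t : R^o) e.
  have := @is_deriveZ R R^o R^o id e t 1 1 (is_derive_id _ _).
  by rewrite /GRing.scale /= mulr1.
have Df : is_derive (t : R^o) (1 : R^o) (fun t => f (q t) : R^o) (- N t * e).
  exact: (is_derive1_comp (f_flow_is_derive hM hf hX hphi (e * t) x) De).
have ft : f (q t) - f p != 0 by rewrite subr_eq0; exact: (nf _ t0s).
have [Xk fk] := rX ct rt.
have sq0 : 0 < Num.sqrt `|f (q t) - f p| by rewrite sqrtr_gt0 normr_gt0.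
have kN0 : 0 <= k * N t by rewrite mulr_ge0 ?(ltW k0)//; exact: (speed_ge0 hM hg hX).
split.
  have D1 : is_derive (t : R^o) (1 : R^o) (fun t => f (q t) - f p : R^o) (- N t * e).
    rewrite -[X in is_derive _ _ _ X]subr0; apply: is_deriveB.
  have D2 := @is_derive1_comp R signed_sqrt (fun t => f (q t) - f p) t _ _
    (is_derive_signed_sqrt ft) D1.
  have D3 := @is_deriveZ R R^o R^o _ (- e * (2 * k)) t 1 _ D2.
  have -> : k * N t / Num.sqrt `|f (q t) - f p| =
     (- e * (2 * k)) *: ((2 * Num.sqrt `|f (q t) - f p|)^-1 * (- N t * e)).
    rewrite /GRing.scale /=.
    transitivity (e ^+ 2 * (k * N t / Num.sqrt `|f (q t) - f p|)); first by rewrite e1 mul1r.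
    by field; rewrite gt_eqF.
  rewrite (_ : psi = ((- e * (2 * k)) \*: (signed_sqrt \o (fun t => f (q t) - f p) : R^o -> R^o))) //.
  by apply/funext => u; rewrite /psi /height /= /GRing.scale /= mulrA.
move=> j.
have Dj : is_derive (t : R^o) (1 : R^o) (fun t => cfun c (q t) 0 j : R^o)
    (X (q t) (fun y => cfun c y 0 j) * e).
  have D0 := flow_is_derive hphi (smooth_near_coord hM j mc ct).
  exact: (is_derive1_comp D0 De).
eexists; first exact: Dj.
rewrite normrM (_ : `|e| = 1) ?mulr1; last by case: eE => ->; rewrite ?normrN normr1.
rewrite ler_pdivlMr//.
(* Here the Lojasiewicz inequality enters: the coordinate speed and [sqrt |f - f p|] are both at
   most [sqrt (k N)], so their product is at most [k N]. *)
have h1 : `|X (q t) (fun y => cfun c y 0 j)| <= Num.sqrt (k * N t).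
  by rewrite -sqrtr_sqr ler_wsqrtr.
have h2 : Num.sqrt `|f (q t) - f p| <= Num.sqrt (k * N t) by rewrite ler_wsqrtr.
rewrite -[leRHS]sqr_sqrtr// expr2 ler_pM// ltW//.
Qed.

Lemma drift_flow_nocross x s : ~ crit A f x -> 0 <= s ->
  (forall t, 0 < t < s -> f (phi t x) != f p) -> drift x (phi s x).
Proof.
move=> nx s0 nf; split.
- by rewrite -[in leRHS](flow0 hphi x); exact: (f_flow_le hM hf hg hX hphi).
- rewrite -[s]mul1r; apply: drift_le_flow => //; first exact: expr1n.
  by move=> t; rewrite mul1r; exact: nf.
- have E : x = phi (-1 * s) (phi s x) by rewrite mulN1r (flowK hphi).
  rewrite [X in drift_le _ X]E; apply: drift_le_flow => //.
  + by rewrite sqrrN expr1n.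
  + by move=> Cs; apply: nx; rewrite -(crit_flowE hM hg hX hphi Cs).
  + move=> t /andP[t0 ts]; rewrite mulN1r -(flowD hphi) nf//.
    by rewrite addrC subr_gt0 ts gtrBl.
Qed.

(** A noncritical trajectory meets the level of [p] at most once; it is split there and the two
    estimates are joined. *)
Lemma drift_flow x s : 0 <= s -> drift x (phi s x).
Proof.
move=> s0; have [Cx|nx] := pselect (crit A f x).
  by rewrite (crit_flow hM hg hX hphi)//; exact: drift_refl.
have [[t /andP[t0 ts] ft]|nf] := pselect (exists2 t, 0 < t < s & f (phi t x) = f p); last first.
  apply: drift_flow_nocross => // t ts; apply/eqP => ft; apply: nf; by exists t.
apply: (@drift_trans _ (phi t x)).
  apply: drift_flow_nocross => //; first exact: ltW.
  move=> u /andP[u0 ut]; rewrite -ft gt_eqF//.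
  exact: (f_flow_lt hM hf hg hX hphi).
rewrite -(subrK t s) (flowD hphi); apply: drift_flow_nocross.
- by move=> Ct; apply: nx; rewrite -(crit_flowE hM hg hX hphi Ct).
- by rewrite subr_ge0 ltW.
- move=> u /andP[u0 us]; rewrite -(flowD hphi) -ft lt_eqF//.
  by apply: (f_flow_lt hM hf hg hX hphi) => //; rewrite ltrDr.
Qed.

(** Extends the drift bound to limits at infinite time. If [y] is in the chart, so are the points
    close to it; if only [x] is, [y] has to be brought into the chart. *)
Lemma drift_le_lim (F : set_system M) (FF : ProperFilter F) x y : F --> y ->
  (\forall u \near F, [/\ drift_le u x, drift_le x u &
     `|height x - height u| <= `|height x - height y|]) ->
  drift_le y x /\ drift_le x y.
Proof.
move=> Fy Fu.
have Fh : height u @[u --> F] --> height y by exact: (continuous_cvg _ (@height_continuous y) Fy).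
have Fd : `|height x - height u| @[u --> F] --> `|height x - height y|.
  by apply: cvg_norm; exact: (cvgB (cvg_cst _) Fh).
have key : cdom c y -> cdom c x ->
    (\forall u \near F, `|cfun c x - cfun c u| <= `|height x - height u|) ->
    `|cfun c x - cfun c y| <= `|height x - height y|.
  move=> cy cx H; apply: (ler_cvg_to _ Fd H).
  have cc : cfun c u @[u --> F] --> cfun c y by exact: (continuous_cvg _ (max_cfun_continuous hM mc cy) Fy).
  by apply: cvg_norm; exact: (cvgB (cvg_cst _) cc).
split.
  move=> cy; rewrite (distrC (height y)) => Hr.
  have Hu : \forall u \near F, cdom c u /\
      `|cfun c u - cfun c p| + `|height x - height u| < r.
    apply: filterI; first by apply: Fy; exact: (near_cdom hM mc cy).
    have cc : cfun c u @[u --> F] --> cfun c y by exact: (continuous_cvg _ (max_cfun_continuous hM mc cy) Fy).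
    have H : `|cfun c u - cfun c p| + `|height x - height u| @[u --> F] -->
       `|cfun c y - cfun c p| + `|height x - height y|.
      by apply: cvgD Fd; apply: cvg_norm; exact: (cvgB cc (cvg_cst _)).
    exact: (cvgr_lt _ H _ Hr).
  have Hx : \forall u \near F, cdom c x /\ `|cfun c x - cfun c u| <= `|height x - height u|.
    apply: filterS (filterI Hu Fu) => u [[cu ru] [+ _ _]].
    by rewrite /drift_le (distrC (height u)) => /(_ cu ru).
  have [u [cx _]] := filter_ex Hx; split => //.
  by apply: key => //; apply: filterS Hx => u' [].
move=> cx Hr.
pose rho := `|cfun c x - cfun c p| + `|height x - height y|.
have Hx : \forall u \near F, cdom c u /\ `|cfun c u - cfun c x| <= `|height x - height u|.
  apply: filterS Fu => u [_ + hu]; apply => //.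
  by apply: le_lt_trans Hr; rewrite lerD2l.
(* The approximating points lie in a chart ball closed in [M], so their limit [y] does too. *)
have HK : \forall u \near F, chart_ball (c := c) (z0 := cfun c p) rho u.
  apply: filterS (filterI Hx Fu) => u [[cu ru] [_ _ hu]]; split => //.
  rewrite -(subrKA (cfun c x)) (le_trans (ler_normD _ _))// /rho addrC lerD2l.
  exact: le_trans hu.
have [cy _] := closed_cvg _ (closed_chart_ball hM mc rc Hr) HK y Fy.
split => //; rewrite distrC; apply: key => //.
by apply: filterS Hx => u [_]; rewrite distrC.
Qed.

Lemma drift_starts x y : starts phi x y -> drift y x.
Proof.
move=> sxy.
have fxy : f x <= f y.
  by rewrite -[x in f x](flow0 hphi); exact: (f_starts_le hM hf hg hX hphi).
have [|d1 d2] := @drift_le_lim (phi t x @[t --> -oo]) _ x y sxy; last by split.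
rewrite near_map; near=> t.
have t0 : t <= 0 by near: t; exact: (nbhs_ninfty_le (num_real _)).
have [_ d1 d2] : drift (phi t x) x.
  by rewrite -[X in drift _ X](flowNK hphi (- t)) opprK; apply: drift_flow; rewrite oppr_ge0.
have h1 : height x <= height (phi t x).
  apply: height_le; rewrite -[in leLHS](flow0 hphi x).
  exact: (f_flow_le hM hf hg hX hphi).
have h2 : height (phi t x) <= height y.
  by apply: height_le; exact: (f_starts_le hM hf hg hX hphi).
split => //; rewrite !ler0_norm ?subr_le0//; last exact: le_trans h2.
by rewrite !opprB lerD2r.
Unshelve. all: by end_near. Qed.

Lemma drift_ends x y : ends phi x y -> drift x y.
Proof.
move=> sxy.
have fxy : f y <= f x.
  by rewrite -[in leRHS](flow0 hphi x); exact: (f_ends_le hM hf hg hX hphi).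
have [|d1 d2] := @drift_le_lim (phi t x @[t --> +oo]) _ x y sxy; last by split.
rewrite near_map; near=> t.
have t0 : 0 <= t by near: t; exact: (nbhs_pinfty_ge (num_real _)).
have [_ d1 d2] : drift x (phi t x) by exact: drift_flow.
have h1 : height (phi t x) <= height x.
  apply: height_le; rewrite -[in leRHS](flow0 hphi x).
  exact: (f_flow_le hM hf hg hX hphi).
have h2 : height y <= height (phi t x).
  by apply: height_le; exact: (f_ends_le hM hf hg hX hphi).
split => //; rewrite !ger0_norm ?subr_ge0//; last exact: le_trans h2 _.
by rewrite lerB.
Unshelve. all: by end_near. Qed.

End near_point.
End drift.

(** * Reachability across breaks, equicontinuity, finiteness of components *)

(** The order along broken trajectories, generated by the forward flow and the passages from a
    starting point and to an end point. An estimate that is transitive and holds for the generators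
    holds across all breaks. *)
Inductive reach (R : realType) (M : topologicalType) (phi : R -> M -> M) :
    M -> M -> Prop :=
| reach_refl q : reach phi q q
| reach_flow q s : 0 <= s -> reach phi q (phi s q)
| reach_starts x y : starts phi x y -> reach phi y x
| reach_ends x y : ends phi x y -> reach phi x y
| reach_trans q q' q'' : reach phi q q' -> reach phi q' q'' -> reach phi q q''.

(** Were the image infinite, the points of [P] where [h] avoids a given finite set would generate a
    proper filter; at a cluster point [h] has locally a single value, and avoiding that value is
    contradictory. *)
Lemma compact_finite_image (T : topologicalType) (V : Type) (h : T -> V) (P : set T) :
  compact [set: T] -> (forall p : T, exists v, \forall q \near p, P q -> h q = v) ->
  finite_set (h @` P).
Proof.
move=> cT loc; apply: contrapT => infin.
pose G := filter_from (@finite_set V) (fun B => P `&` h @^-1` (~` B)).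
have FG : ProperFilter G.
  apply: filter_from_proper.
    apply: filter_from_filter; first by exists set0; exact: finite_set0.
    move=> B B' fB fB'; exists (B `|` B'); first by rewrite finite_setU.
    by move=> q [Pq nB]; split; split=> // ?; apply: nB; [left|right].
  move=> B fB; apply: contrapT => B0; apply: infin; apply: sub_finite_set fB.
  by move=> _ [q Pq <-]; apply: contrapT => nB; apply: B0; exists q.
have [p [_ Gp]] := cT G FG filterT.
have [v vP] := loc p.
have [|q [[Pq nv] Hq]] := Gp (P `&` h @^-1` (~` [set v])) _ _ vP.
  by exists [set v] => //; exact: finite_set1.
by apply: nv; exact: Hq.
Qed.

Lemma ultra_compact_cvg (I : Type) (T : topologicalType) (F : set_system I) (h : I -> T) :
  compact [set: T] -> UltraFilter F -> exists p : T, h x @[x --> F] --> p.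
Proof.
move=> cT UF; have [p [_ Gp]] := cT (h x @[x --> F]) _ filterT.
exists p => B nB; have [//|FnB] := in_ultra_setVsetC (h @^-1` B) UF.
by have [q [nBq Bq]] := Gp (~` B) B FnB nB.
Qed.

Lemma rV_nbhs_ball (R : realType) m (z : 'rV[R]_m) (P : set 'rV[R]_m) :
  nbhs z P -> exists2 r : R, 0 < r & forall y, `|y - z| < r -> P y.
Proof.
by move=> /nbhs_ballP[r /= r0 rP]; exists r => // y yr; apply: rP; rewrite -ball_normE /= distrC.
Qed.

Section reach.
Context {R : realType} {M : topologicalType} {n : nat} {A : atlas R M}.
Arguments A : clear implicits.
Hypothesis hM : closed_manifold n A.
Context {f : M -> R} {g : M -> tvec R M -> tvec R M -> R} {X : M -> tvec R M}.
Hypothesis hf : forall p, smooth_near A f p.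
Hypothesis hg : riemannian_metric A g.
Hypothesis hX : neg_gradient A g f X.
Context {phi : R -> M -> M}.
Hypothesis hphi : is_flow A X phi.
Hypothesis hMB : morse_bott A f.

(** The strict inequality is what makes [f] injective on a broken trajectory. *)
Lemma reach_lt q q' : reach phi q q' -> q = q' \/ f q' < f q.
Proof.
elim=> {q q'} [q|q s s0|x y sxy|x y sxy|q q' q'' _ [->|h1] _ [<-|h2]]; [by left|..].
- have [Cq|nq] := pselect (crit A f q); first by left; rewrite (crit_flow hM hg hX hphi).
  move: s0; rewrite le_eqVlt => /predU1P[<-|s0]; first by left; rewrite (flow0 hphi).
  by right; rewrite -[in ltRHS](flow0 hphi q); exact: (f_flow_lt hM hf hg hX hphi).
- have [Cx|nx] := pselect (crit A f x).
    left; apply: (starts_unique hM sxy); exact: (starts_of_crit hM hg hX hphi).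
  by right; have := f_starts_lt hM hf hg hX hphi 0 sxy nx; rewrite (flow0 hphi).
- have [Cx|nx] := pselect (crit A f x).
    left; apply: (limit_unique hM) sxy.
    rewrite (_ : phi ^~ x = fun=> x); first exact: cvg_cst.
    by apply/funext => t; exact: (crit_flow hM hg hX hphi).
  by right; have := f_ends_lt hM hf hg hX hphi 0 sxy nx; rewrite (flow0 hphi).
- by left.
- by right.
- by right.
- by right; exact: lt_trans h2 h1.
Qed.

Lemma reach_le q q' : reach phi q q' -> f q' <= f q.
Proof. by move=> /reach_lt[->|/ltW]. Qed.

(** The drift estimate holds for each generator of [reach] and is transitive. Small variation of [f]
    means small variation of [height], so nearby levels cannot be far apart in the chart. *)
Lemma reach_equicontinuous (p : M) (O : set M) : nbhs p O ->
  exists2 O' : set M, nbhs p O' & exists2 d : R, 0 < d & forall q q',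
    reach phi q q' -> `|f q - f q'| < d -> (O' q -> O q') /\ (O' q' -> O q).
Proof.
move=> nO; have [m [c [mc cp [C C0 HC]]]] := lojasiewicz hM hf hg hX p hMB.
have okc := max_ok mc.
have [r r0 Hr] := rV_nbhs_ball (max_cinv_near_ccod hM mc cp (filterI nO HC)).
have Hball q : cdom c q -> `|cfun c q - cfun c p| < r -> O q /\
    ((forall j, X q (fun y => cfun c y 0 j) ^+ 2 <= C * g q (X q) (X q)) /\
     `|f q - f p| <= C * g q (X q) (X q)).
  by move=> cq qr; have := Hr (cfun c q) qr; rewrite (cfunK okc cq) => -[_ [Oq []]].
have rc z : `|z - cfun c p| < r -> ccod c z.
  by move=> /Hr[].
have rX q cq qr := (Hball q cq qr).2.
pose h := height (f := f) (p := p) (k := C).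
(* Two heights below [r / 4] differ by less than [r / 2]; with the radius [r / 2] of [O'] the total
   stays below [r]. *)
have [e e0 He] : exists2 e : R, 0 < e & forall q, `|f q - f p| < e -> `|h q| < r / 4.
  have c0 : 2 * C * signed_sqrt u @[u --> (0 : R)] --> 2 * C * signed_sqrt 0.
    exact: (continuousM (@cst_continuous _ _ (2 * C) 0) (@signed_sqrt_continuous _ 0)).
  have r4 : 0 < r / 4 by rewrite divr_gt0.
  have : nbhs (0 : R) (fun u => `|2 * C * signed_sqrt 0 - 2 * C * signed_sqrt u| < r / 4).
    exact: (cvgr_dist_lt _ _ c0 _ r4).
  move=> /nbhs_ballP[e /= e0 He].
  exists e => // q qe; have := He (f q - f p).
  rewrite -ball_normE /= sub0r normrN signed_sqrt0 mulr0 sub0r normrN; exact.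
(* This [e / 2] and the one taken for [d] keep both points within [e] of the level of [p]. *)
pose O' := [set q | [/\ cdom c q, `|cfun c q - cfun c p| < r / 2 & `|f q - f p| < e / 2]].
have e2 : 0 < e / 2 by rewrite divr_gt0.
have r2 : 0 < r / 2 by rewrite divr_gt0.
exists O'.
  have n1 : \forall q \near p, cdom c q /\ `|cfun c q - cfun c p| < r / 2.
    by apply: (near_chart_ball hM mc cp); rewrite subrr normr0.
  have n2 : \forall q \near p, `|f q - f p| < e / 2.
    have H : \forall q \near p, `|f p - f q| < e / 2.
      exact: (cvgr_dist_lt _ _ (@f_continuous _ _ _ _ hM _ hf p) _ e2).
    by apply: filterS H => q; rewrite distrC.
  by apply: filterS (filterI n1 n2) => q [[]].
exists (e / 2) => //.
have key q q' : drift_le (f := f) (p := p) (c := c) (r := r) (k := C) q q' ->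
    `|f q - f q'| < e / 2 -> O' q -> O q'.
  move=> dqq' ff [cq qr qf].
  have fq' : `|f q' - f p| < e.
    have := ler_normD (f q' - f q) (f q - f p); rewrite subrKA (distrC (f q') (f q)).
    lra.
  have h1 := He _ (lt_trans qf (ltac:(lra) : e / 2 < e)).
  have h2 := He _ fq'; have := ler_normB (h q) (h q').
  move=> h3; have [|cq' H'] := dqq' cq; first by rewrite -/h; lra.
  apply: (Hball q' cq' _).1.
  have := ler_normD (cfun c q' - cfun c q) (cfun c q - cfun c p); rewrite subrKA.
  move: H'; rewrite -/h; lra.
move=> q q' rqq' ff.
have [_ d1 d2] : drift (f := f) (p := p) (c := c) (r := r) (k := C) q q'.
  elim: rqq' => {q q' ff} [q|q s s0|x y sxy|x y sxy|q q' q'' _ h1 _ h2].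
  - exact: drift_refl.
  - exact: (drift_flow hM hf hg hX hphi mc C0 rc rX).
  - exact: (drift_starts hM hf hg hX hphi mc C0 rc rX).
  - exact: (drift_ends hM hf hg hX hphi mc C0 rc rX).
  - exact: (drift_trans C0 h1 h2).
by split; [exact: key|apply: key => //; rewrite distrC].
Qed.

(** At a critical [q] the right-hand side of the Lojasiewicz inequality around [p] vanishes. *)
Lemma crit_locally_constant (p : M) : \forall q \near p, crit A f q -> f q = f p.
Proof.
have [m [c [mc cp [C C0 HC]]]] := lojasiewicz hM hf hg hX p hMB.
apply: filterS HC => q [cq _ fq] /(critP hM hg hX) Xf0; move: fq.
by rewrite (speedE hM hX) Xf0 oppr0 mulr0 normr_le0 subr_eq0 => /eqP.
Qed.

Lemma finite_critical_values : finite_set (f @` crit A f).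
Proof.
apply: compact_finite_image; first exact: (manifold_compact hM).
by move=> p; exists (f p); exact: crit_locally_constant.
Qed.

(** In a slice chart the critical set is a linear subspace, and the segment from [p] to [q] stays in
    it and in a ball of the chart. *)
Lemma component_near (p : M) : crit A f p ->
  \forall q \near p, crit A f q -> connected_component (crit A f) p q.
Proof.
move=> Cp; have [_ subS _] := hMB.
have [k [_ [[l [c [mc cS ->]]] [cp _]]]] := subS _ Cp; have okc := max_ok mc.
have [r r0 Hr] := rV_nbhs_ball (near_ccod mc (ccod_cfun cp)).
have nb : \forall q \near p, cdom c q /\ `|cfun c q - cfun c p| < r.
  by apply: (near_chart_ball hM mc cp); rewrite subrr normr0.
apply: filterS nb => q [cq qr] Cq.
pose L (t : R) := cfun c p + t *: (cfun c q - cfun c p).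
have LO t : 0 <= t <= 1 -> ccod c (L t).
  move=> /andP[t0 t1]; apply: Hr; rewrite /L addrC addKr normrZ ger0_norm//.
  by apply: le_lt_trans qr; rewrite ler_piMl.
have cL : continuous L by move=> t; exact/differentiable_continuous/differentiable_line.
exists ((cinv c \o L) @` `[0, 1]%classic).
  split.
  - by exists 0; rewrite /= ?in_itv /= ?lexx ?ler01// /L scale0r addr0 cfunK.
  - move=> _ [t + <-]; rewrite /= in_itv /= => t01; have Lt := LO _ t01.
    apply/(cS _ (cinv_cdom okc Lt)); rewrite (cinvK okc Lt) /L linearD linearZ linearB /=.
    by rewrite ((cS _ cq).1 Cq) ((cS _ cp).1 Cp) subrr scaler0 addr0.
  - apply: connected_continuous_connected; first exact: segment_connected.
    apply: continuous_in_subspaceT => t /set_mem; rewrite /= in_itv /= => t01.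
    by apply: continuous_comp; [exact: cL|exact: (max_cinv_continuous hM mc (LO _ t01))].
exists 1; rewrite /= ?in_itv /= ?lexx ?ler01// /L scale1r addrC subrK cfunK//.
Qed.

Lemma finite_components : finite_set (component A f).
Proof.
have -> : component A f = connected_component (crit A f) @` crit A f.
  by apply/seteqP; split=> [_ [x Cx ->]|_ [x Cx <-]]; exists x.
apply: compact_finite_image; first exact: (manifold_compact hM).
move=> p; have [Cp|nCp] := pselect (crit A f p).
  exists (connected_component (crit A f) p).
  by apply: filterS (component_near Cp) => q + Cq => /(_ Cq)/same_connected_component.
exists set0; have [clS _ _] := hMB.
have : nbhs p (~` crit A f) by apply: open_nbhs_nbhs; split=> //; exact: closed_openC.
by apply: filterS => q nq /nq.
Qed.

Lemma f_component S x y : component A f S -> S x -> S y -> f x = f y.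
Proof.
move=> [z Cz ->]; set S' := connected_component _ _.
suff H q : S' q -> f q = f z by move=> /H -> /H ->.
have cS : connected S' by exact: component_connected.
have sub : S' `<=` crit A f by exact: connected_component_sub.
(* The level set of [f z] in the connected set [S'] is nonempty, open by local constancy and closed
   by continuity. *)
have E : S' `&` [set q | f q = f z] = S'.
  apply: cS.
  - by exists z; split => //; exact: connected_component_refl.
  - exists (interior [set q | crit A f q -> f q = f z]); first exact: open_interior.
    apply/seteqP; split=> y0 [Sy]; last first.
      by move=> /interior_subset H; split => //; apply: H; exact: sub.
    move=> /= fy; split=> //; apply: filterS (crit_locally_constant y0) => q' + Cq'.
    by move=> /(_ Cq') ->.
  - exists [set q | f q = f z] => //.
    rewrite (_ : [set q | _] = f @^-1` [set f z]); last by [].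
    by apply: closed_comp => [q' _|]; [exact: (f_continuous hM hf)|exact: closed_eq].
by rewrite -E => -[].
Qed.

Lemma fvalE S y : component A f S -> S y -> fval f S = f y.
Proof.
move=> CS Sy; rewrite /fval; case: xgetP => [_ _ [z Sz <-]|/(_ (f y))[]].
  exact: f_component Sz Sy.
by exists y.
Qed.

Lemma component_is_closed S : component A f S -> closed S.
Proof. by move=> [z Cz ->]; apply: component_closed; case: hMB. Qed.

End reach.

(** * Broken trajectories parametrized by level *)

(** The path of [broken_path] with the level [u] itself as parameter, defined for every real [u]. *)
Definition level_point (R : realType) (M : topologicalType) (f : M -> R)
    (phi : R -> M -> M) (x : seq (set M) * M) (u : R) : M :=
  if f x.2 <= u then xget x.2 [set p | support_of phi x p /\ f p = u] else x.2.

Section support.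
Context {R : realType} {M : topologicalType} {n : nat} {A : atlas R M}.
Arguments A : clear implicits.
Hypothesis hM : closed_manifold n A.
Context {f : M -> R} {g : M -> tvec R M -> tvec R M -> R} {X : M -> tvec R M}.
Hypothesis hf : forall p, smooth_near A f p.
Hypothesis hg : riemannian_metric A g.
Hypothesis hX : neg_gradient A g f X.
Context {phi : R -> M -> M}.
Hypothesis hphi : is_flow A X phi.
Hypothesis hMB : morse_bott A f.

Let flow0' := flow0 hphi.

Lemma flow_IVT x s t u : s <= t -> f (phi t x) <= u -> u <= f (phi s x) ->
  exists2 r, s <= r <= t & f (phi r x) = u.
Proof.
move=> st tu us; have [||r] := @IVT R (fun t => f (phi t x)) s t u st.
- exact/continuous_subspaceT/(f_flow_continuous hM hf hphi).
- by rewrite ge_min le_max tu us orbT.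
by rewrite in_itv /= => srt E; exists r.
Qed.

Lemma flow_starts_IVT x y t u : starts phi x y -> f (phi t x) <= u -> u < f y ->
  exists2 r, r <= t & f (phi r x) = u.
Proof.
move=> sxy tu uy.
have [s [st us]] : exists s, s <= t /\ u < f (phi s x).
  apply: (@filter_ex _ -oo); apply: filterI; first exact: (nbhs_ninfty_le (num_real _)).
  exact: (cvgr_gt _ (f_starts hM hf sxy) _ uy).
by have [r /andP[_ rt] E] := flow_IVT st tu (ltW us); exists r.
Qed.

Lemma flow_ends_IVT x y t u : ends phi x y -> f y < u -> u <= f (phi t x) ->
  exists2 r, t <= r & f (phi r x) = u.
Proof.
move=> sxy yu ut.
have [s [ts us]] : exists s, t <= s /\ f (phi s x) < u.
  apply: (@filter_ex _ +oo); apply: filterI; first exact: (nbhs_pinfty_ge (num_real _)).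
  exact: (cvgr_lt _ (f_ends hM hf sxy) _ yu).
by have [r /andP[tr _] E] := flow_IVT ts (ltW us) ut; exists r.
Qed.

Lemma flow_both_IVT x y y' u : starts phi x y -> ends phi x y' -> f y' < u -> u < f y ->
  exists r, f (phi r x) = u.
Proof.
move=> sxy exy yu uy; have [u0|/ltW u0] := leP (f (phi 0 x)) u.
  by have [r _] := flow_starts_IVT sxy u0 uy; exists r.
by have [r _] := flow_ends_IVT exy yu u0; exists r.
Qed.

Lemma orbit_starts x y q : starts phi x y -> orbit_of phi x q -> starts phi q y.
Proof. by move=> sxy [t _ <-]; exact: (starts_flow hphi). Qed.

Lemma orbit_ends x y q : ends phi x y -> orbit_of phi x q -> ends phi q y.
Proof. by move=> sxy [t _ <-]; exact: (ends_flow hphi). Qed.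

Lemma Tall_orbit tau y y' : Tall A f phi tau -> pi_minus phi tau y ->
  pi_plus phi tau y' -> exists x, [/\ tau = orbit_of phi x, starts phi x y & ends phi x y'].
Proof.
move=> [S [S' [_ _ _ [x [[z _ sxz] [z' _ exz']] <-]]]] [q tq sqy] [q' tq' eqy'].
exists x; split => //.
  by rewrite -(starts_unique hM (orbit_starts sxz tq) sqy).
by rewrite -(ends_unique hM (orbit_ends exz' tq') eqy').
Qed.

Lemma support_nil w y q : starts phi w y -> support_of phi ([::], w) q <->
  q = y \/ exists2 s, s <= 0 & q = phi s w.
Proof.
move=> swy; split; last by move=> [->|[s s0 ->]]; right; [left|right; exists s].
move=> [[tau]|[sq|[s s0 ->]]] //; last by right; exists s.
by left; exact: (starts_unique hM sq swy).
Qed.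

Lemma support_cons x y y' ts w q : starts phi x y -> ends phi x y' ->
  support_of phi (orbit_of phi x :: ts, w) q <->
  [\/ q = y, orbit_of phi x q, q = y' | support_of phi (ts, w) q].
Proof.
have ox : orbit_of phi x x by exists 0 => //; rewrite flow0'.
move=> sxy exy; split.
  move=> [[tau]|H]; last by apply: Or44; right.
  rewrite inE => /predU1P[->|tts] H.
    case: H => [oq|[z oz szq]|[z oz ezq]]; first exact: Or42.
      by apply: Or41; exact: (starts_unique hM szq (orbit_starts sxy oz)).
    by apply: Or43; exact: (ends_unique hM ezq (orbit_ends exy oz)).
  by apply: Or44; left; exists tau.
move=> [->|oq|->|[[tau tts H]|H]].
- by left; exists (orbit_of phi x); rewrite ?inE ?eqxx//; apply: Or32; exists x.
- by left; exists (orbit_of phi x); rewrite ?inE ?eqxx//; exact: Or31.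
- by left; exists (orbit_of phi x); rewrite ?inE ?eqxx//; apply: Or33; exists x.
- by left; exists tau; rewrite ?inE ?tts ?orbT.
- by right.
Qed.

Lemma broken_from_cons y tau ts w : broken_from A f phi y (tau :: ts) w ->
  exists x y', [/\ tau = orbit_of phi x, starts phi x y, ends phi x y' &
    broken_from A f phi y' ts w].
Proof.
move=> [tt pm [y' pp b]]; have [x [-> sxy exy]] := Tall_orbit tt pm pp.
by exists x, y'.
Qed.

Lemma broken_crit y ts w : broken_from A f phi y ts w -> crit A f y.
Proof.
case: ts => [[]//|tau ts] /broken_from_cons[x [y' [_ sxy _ _]]].
exact: (starts_crit hM hf hg hX hphi sxy).
Qed.

Lemma reach_flow_le s t x : s <= t -> reach phi (phi s x) (phi t x).
Proof.
move=> st; rewrite -(subrK s t) (flowD hphi); apply: reach_flow.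
by rewrite subr_ge0.
Qed.

(** What the limit argument needs from a broken trajectory: a chain for [reach] from [y] to [w] on
    which [f] takes every intermediate value. Only the backward flow preserves it, the forward flow
    may run past [w]. *)
Record support_spec (y w : M) (S : set M) : Prop := {
  support_start : S y;
  support_end : S w;
  support_from : forall q, S q -> reach phi y q;
  support_to : forall q, S q -> reach phi q w;
  support_total : forall q q', S q -> S q' -> reach phi q q' \/ reach phi q' q;
  support_onto : forall u, f w <= u <= f y -> exists2 q, S q & f q = u;
  support_back : forall q s, S q -> s <= 0 -> S (phi s q) }.

Lemma broken_support y ts w : broken_from A f phi y ts w ->
  support_spec y w (support_of phi (ts, w)).
Proof.
elim: ts y => [|tau ts IH] y.
  move=> [Cy swy].
  have yfrom s : reach phi y (phi s w) by apply: reach_starts; exact: (starts_flow hphi).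
  have sto s : s <= 0 -> reach phi (phi s w) w.
    by move=> s0; rewrite -[X in reach _ _ X]flow0'; exact: reach_flow_le.
  split.
  - by apply/(support_nil _ swy); left.
  - by apply/(support_nil _ swy); right; exists 0; rewrite ?flow0'.
  - by move=> q /(support_nil _ swy)[->|[s s0 ->]]; [exact: reach_refl|].
  - move=> q /(support_nil _ swy)[->|[s s0 ->]]; last exact: sto.
    by rewrite -[X in reach _ _ X]flow0'; exact: yfrom.
  - move=> q q' /(support_nil _ swy)[->|[s s0 ->]] /(support_nil _ swy)[->|[s' s0' ->]].
    + by left; exact: reach_refl.
    + by left.
    + by right.
    + by have [ss'|/ltW ss'] := leP s s'; [left|right]; exact: reach_flow_le.
  - move=> u /andP[wu]; rewrite le_eqVlt => /predU1P[->|uy].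
      by exists y => //; apply/(support_nil _ swy); left.
    have [|r r0 ru] := flow_starts_IVT (t := 0) swy _ uy; first by rewrite flow0'.
    by exists (phi r w) => //; apply/(support_nil _ swy); right; exists r.
  - move=> q s /(support_nil _ swy)[->|[t t0 ->]] s0; apply/(support_nil _ swy).
      by left; exact: (crit_flow hM hg hX hphi).
    by right; exists (s + t); rewrite ?(flowD hphi)//; lra.
move=> /broken_from_cons[x [y' [-> sxy exy b]]].
have H := IH _ b.
have Cy : crit A f y by exact: (starts_crit hM hf hg hX hphi sxy).
have Cy' := broken_crit b.
have P q := support_cons ts w q sxy exy.
have yo q : orbit_of phi x q -> reach phi y q.
  by move=> /(orbit_starts sxy); exact: reach_starts.
have oy q : orbit_of phi x q -> reach phi q y'.
  by move=> /(orbit_ends exy); exact: reach_ends.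
have ox : orbit_of phi x x by exists 0 => //; rewrite flow0'.
have yy' : reach phi y y' := reach_trans (yo _ ox) (oy _ ox).
have y'w : reach phi y' w := support_to H (support_start H).
split.
- by apply/P/Or41.
- by apply/P/Or44; exact: support_end H.
- move=> q /P[->|oq|->|Sq] //; [exact: reach_refl|exact: yo|].
  by apply: reach_trans yy' _; exact: support_from H _ Sq.
- move=> q /P[->|oq|->|Sq] //.
  + exact: reach_trans yy' y'w.
  + exact: reach_trans (oy _ oq) y'w.
  + exact: support_to H _ Sq.
- have ord q q' : [\/ q = y, orbit_of phi x q | q = y'] -> support_of phi (ts, w) q' ->
      reach phi q q'.
    move=> Hq Sq'; apply: (@reach_trans _ _ _ _ y'); last exact: support_from H _ Sq'.
    by case: Hq => [->//|/oy//|->]; exact: reach_refl.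
  move=> q q' /P[->|oq|->|Sq] /P[->|oq'|->|Sq'];
    try by [left; exact: reach_refl | left; apply: yo | right; apply: yo |
      left; apply: oy | right; apply: oy | left | right].
  + by left; apply: ord => //; exact: Or31.
  + case: oq oq' => [s _ <-] [t _ <-].
    by have [st|/ltW st] := leP s t; [left|right]; exact: reach_flow_le.
  + by left; apply: ord => //; exact: Or32.
  + by left; apply: ord => //; exact: Or33.
  + by right; apply: ord => //; exact: Or31.
  + by right; apply: ord => //; exact: Or32.
  + by right; apply: ord => //; exact: Or33.
  + exact: support_total H _ _ Sq Sq'.
- move=> u /andP[wu uy]; have [uy'|y'u] := leP u (f y').
    have [|q Sq qu] := support_onto H (u := u); first by rewrite wu.
    by exists q => //; apply/P/Or44.
  move: uy; rewrite le_eqVlt => /predU1P[->|uy]; first by exists y => //; apply/P/Or41.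
  have [r ru] := flow_both_IVT sxy exy y'u uy.
  by exists (phi r x) => //; apply/P/Or42; exists r.
- move=> q s /P[->|[t _ <-]|->|Sq] s0; apply/P.
  + by apply: Or41; exact: (crit_flow hM hg hX hphi).
  + by apply: Or42; exists (s + t); rewrite ?(flowD hphi).
  + by apply: Or43; exact: (crit_flow hM hg hX hphi).
  + by apply: Or44; exact: support_back H _ _ Sq s0.
Qed.

Lemma support_inj y w S q q' : support_spec y w S -> S q -> S q' -> f q = f q' -> q = q'.
Proof.
move=> H Sq Sq' E; case: (support_total H Sq Sq') => /(reach_lt hM hf hg hX hphi)[//|].
  by rewrite E ltxx.
by rewrite E ltxx.
Qed.

Lemma level_pointP y ts w u : broken_from A f phi y ts w -> u <= f y ->
  support_of phi (ts, w) (level_point f phi (ts, w) u) /\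
  f (level_point f phi (ts, w) u) = Num.max u (f w).
Proof.
move=> b uy; have H := broken_support b; rewrite /level_point /=.
have [wu|uw] := leP (f w) u; last by split=> //; exact: support_end H.
have [|q Sq qu] := support_onto H (u := u); first by rewrite wu.
by case: xgetP => [p _ //|/(_ q)[]].
Qed.

Lemma level_point_eq y ts w q : broken_from A f phi y ts w ->
  support_of phi (ts, w) q -> level_point f phi (ts, w) (f q) = q.
Proof.
move=> b Sq; have H := broken_support b.
have qy : f q <= f y by apply: (reach_le hM hf hg hX hphi); exact: support_from H _ Sq.
have wq : f w <= f q by apply: (reach_le hM hf hg hX hphi); exact: support_to H _ Sq.
have [Sp Ep] := level_pointP b qy.
by apply: (support_inj H) => //; rewrite Ep; apply/max_idPl.
Qed.

Lemma level_point_start y ts w : broken_from A f phi y ts w ->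
  level_point f phi (ts, w) (f y) = y.
Proof. by move=> b; apply: (level_point_eq b); exact: support_start (broken_support b). Qed.

Lemma level_point_flow y ts w u s : broken_from A f phi y ts w -> u <= f y -> s <= 0 ->
  let q := level_point f phi (ts, w) u in
  f (phi s q) <= f y /\ level_point f phi (ts, w) (f (phi s q)) = phi s q.
Proof.
move=> b uy s0 q; have H := broken_support b; have [Sq _] := level_pointP b uy.
have Ssq := support_back H Sq s0; split; last exact: level_point_eq b Ssq.
by apply: (reach_le hM hf hg hX hphi); exact: support_from H _ Ssq.
Qed.

(** Two points of one support are comparable for [reach], so [reach_equicontinuous] applies with
    [O'] and [d] that do not depend on the trajectory. *)
Lemma level_point_equicontinuous (p : M) (O : set M) : nbhs p O ->
  exists2 O' : set M, nbhs p O' & exists2 d : R, 0 < d & forall y ts w u u',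
    broken_from A f phi y ts w -> u <= f y -> u' <= f y -> `|u - u'| < d ->
    O' (level_point f phi (ts, w) u) -> O (level_point f phi (ts, w) u').
Proof.
move=> nO; have [ O' nO' [d d0 Hd]] := reach_equicontinuous hM hf hg hX hphi hMB nO.
exists O' => //; exists d => // y ts w u u' b uy uy' uu' Ou.
have H := broken_support b.
have [Sq Eq] := level_pointP b uy; have [Sq' Eq'] := level_pointP b uy'.
have ff : `|f (level_point f phi (ts, w) u) - f (level_point f phi (ts, w) u')| < d.
  (* Replacing levels below [f w] by [f w] does not increase their distance. *)
  rewrite Eq Eq'; apply: le_lt_trans uu'; rewrite /Order.max.
  by case: ltP => h1; case: ltP => h2; rewrite ler_norml; apply/andP; split;
    have := ler_norm (u - u'); have := ler_norm (u' - u); rewrite (distrC u'); lra.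
case: (support_total H Sq Sq') => rr.
  by have [+ _] := Hd _ _ rr ff; exact.
by move: ff; rewrite distrC => ff; have [_] := Hd _ _ rr ff; exact.
Qed.

End support.

(** * From level paths to broken trajectories *)

Section paths.
Context {R : realType} {M : topologicalType} {n : nat} {A : atlas R M}.
Arguments A : clear implicits.
Hypothesis hM : closed_manifold n A.
Context {f : M -> R} {g : M -> tvec R M -> tvec R M -> R} {X : M -> tvec R M}.
Hypothesis hf : forall p, smooth_near A f p.
Hypothesis hg : riemannian_metric A g.
Hypothesis hX : neg_gradient A g f X.
Context {phi : R -> M -> M}.
Hypothesis hphi : is_flow A X phi.
Hypothesis hMB : morse_bott A f.

Let flow0' := flow0 hphi.

(* Broken trajectories parametrized by the values of [f], downwards from [b]. *)
Record level_path (gam : R -> M) (b : R) (w : M) : Prop := {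
  lpath_le : f w <= b;
  lpath_crit : crit A f (gam b);
  lpath_level : forall u, u <= b -> f (gam u) = Num.max u (f w);
  lpath_end : forall u, u <= f w -> gam u = w;
  lpath_back : forall u s, u <= b -> s <= 0 ->
    f (phi s (gam u)) <= b /\ gam (f (phi s (gam u))) = phi s (gam u);
  lpath_cont : forall u (O : set M), u <= b -> nbhs (gam u) O ->
    exists2 d : R, 0 < d & forall u', u' <= b -> `|u - u'| < d -> O (gam u') }.

Lemma lpath_f gam b w u : level_path gam b w -> f w <= u -> u <= b -> f (gam u) = u.
Proof. by move=> H wu ub; rewrite (lpath_level H)//; apply/max_idPl. Qed.

(** Along the backward orbit of [gam u0] the level increases to a supremum [v]; continuity of [gam]
    at [v] gives the limit [gam v]. A limit at infinite time is critical, which forces [v = b]. *)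
Lemma lpath_starts gam b w u0 : level_path gam b w -> f w <= u0 -> u0 <= b ->
  (forall u, u0 <= u -> u < b -> ~ crit A f (gam u)) -> starts phi (gam u0) (gam b).
Proof.
move=> H wu0 u0b nC; set q := gam u0.
pose E := [set f (phi s q) | s in [set s : R | s <= 0]].
have E0 : E !=set0 by exists (f (phi 0 q)), 0 => /=.
have Eb : ubound E b by move=> _ [s /= s0 <-]; have [] := lpath_back H u0b s0.
pose v := sup E.
have vb : v <= b by exact: ge_sup.
have Ev s : s <= 0 -> f (phi s q) <= v.
  by move=> s0; apply: ub_le_sup; [exists b|exists s].
have u0v : u0 <= v.
  by have := Ev 0 (lexx 0); rewrite flow0' /q (lpath_f H).
have sv : starts phi q (gam v).
  move=> O nO; have [d d0 Hd] := lpath_cont H vb nO.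
  have [_ [s /= s0 <-] sd] := sup_adherent d0 (conj E0 (ex_intro _ b Eb)).
  suff : \forall t \near -oo, O (phi t q) by [].
  near=> t.
  have ts : t <= s by near: t; exact: (nbhs_ninfty_le (num_real _)).
  have t0 : t <= 0 := le_trans ts s0.
  have [fb <-] := lpath_back H u0b t0; apply: Hd => //.
  have := f_flow_le hM hf hg hX hphi q ts.
  have := Ev _ t0; rewrite -/q -/v in sd *.
  by move=> h1 h2; rewrite ger0_norm ?subr_ge0//; lra.
have Cv := starts_crit hM hf hg hX hphi sv.
suff <- : v = b by [].
apply/le_anti; rewrite vb leNgt; apply/negP => vb'.
exact: nC u0v vb' Cv.
Unshelve. all: by end_near. Qed.

Lemma lpath_restrict gam b w u1 : level_path gam b w -> f w <= u1 -> u1 <= b ->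
  crit A f (gam u1) -> level_path gam u1 w.
Proof.
move=> H wu1 u1b C1; split => //.
- by move=> u uu1; apply: (lpath_level H); exact: le_trans uu1 u1b.
- exact: lpath_end H.
- move=> u s uu1 s0; have ub := le_trans uu1 u1b.
  have [fb E] := lpath_back H ub s0; split => //.
  (* A backward orbit rising above [u1] would pass through the critical point [gam u1], and then be
     constant. *)
  rewrite leNgt; apply/negP => h.
  have fu : f (phi 0 (gam u)) <= u1.
    by rewrite flow0' (lpath_level H)// ge_max uu1.
  have [r /andP[sr r0] Er] := flow_IVT hM hf hphi s0 fu (ltW h).
  have [_ Er'] := lpath_back H ub r0; rewrite Er in Er'.
  have Cr : crit A f (phi r (gam u)) by rewrite -Er'.
  have Cu : crit A f (gam u) by rewrite -(crit_flowE hM hg hX hphi Cr).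
  by move: h fu; rewrite !(crit_flow hM hg hX hphi)// => /lt_le_trans/[apply]; rewrite ltxx.
- by move=> u O uu1 nO; have [d d0 Hd] := lpath_cont H (le_trans uu1 u1b) nO;
    exists d => // u' u'u1; apply: Hd; exact: le_trans u'u1 u1b.
Qed.

(** Every point strictly between the two levels starts at [gam b], so it flows back through all
    higher ones and these points lie on one orbit. That the orbit ends at [gam u1] does not follow
    from backward invariance; continuity of [gam] at [u1] gives it. *)
Lemma lpath_segment gam b w u1 : level_path gam b w -> f w <= u1 -> u1 < b ->
  crit A f (gam u1) -> (forall u, u1 < u -> u < b -> ~ crit A f (gam u)) ->
  exists q, [/\ starts phi q (gam b), ends phi q (gam u1) &
    forall u, u1 < u -> u < b -> orbit_of phi q (gam u)].
Proof.
move=> H wu1 u1b C1 nC.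
pose u2 := (u1 + b) / 2.
have u12 : u1 < u2 by rewrite midf_lt.
have u2b : u2 < b by rewrite midf_lt.
have wu v : u1 < v -> f w <= v by move=> /ltW; exact: le_trans.
have fE v : u1 < v -> v < b -> f (gam v) = v.
  by move=> v1 vb; apply: (lpath_f H (wu _ v1)); exact: ltW.
have st v : u1 < v -> v < b -> starts phi (gam v) (gam b).
  move=> v1 vb; apply: (lpath_starts H (wu _ v1) (ltW vb)) => u vu ub.
  by apply: nC => //; exact: lt_le_trans vu.
have fb : f (gam b) = b by apply: (lpath_f H) => //; exact: wu.
pose q := gam u2.
have nq : ~ crit A f q by exact: nC.
have back v v' : u1 < v -> v <= v' -> v' < b -> exists2 r, r <= 0 & phi r (gam v) = gam v'.
  move=> v1 vv' v'b; have vb := le_lt_trans vv' v'b.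
  have [||r r0 Er] := flow_starts_IVT hM hf hphi (t := 0) (u := v') (st v v1 vb).
  - by rewrite flow0' fE.
  - by rewrite fb.
  by exists r => //; have [_ <-] := lpath_back H (ltW vb) r0; rewrite Er.
have orb v : u1 < v -> v < b -> exists2 r, (v <= u2 -> 0 <= r) & phi r q = gam v.
  move=> v1 vb; have [vu2|/ltW u2v] := leP v u2.
    have [r r0 Er] := back _ _ v1 vu2 u2b.
    by exists (- r); rewrite ?oppr_ge0// /q -Er (flowK hphi).
  have [r r0 Er] := back _ _ u12 u2v vb; by exists r.
(* [f] is injective along the noncritical orbit of [q], so a level determines the time. *)
have gamE t : u1 < f (phi t q) -> f (phi t q) < b -> gam (f (phi t q)) = phi t q.
  move=> h1 h2; have [r _ Er] := orb _ h1 h2.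
  rewrite -Er; congr (phi _ q); apply/eqP; rewrite eq_le !leNgt.
  have Ef : f (phi r q) = f (phi t q) by rewrite Er fE.
  by apply/andP; split; apply/negP => /(f_flow_lt hM hf hg hX hphi nq); rewrite Ef ltxx.
have fq2 : f q = u2 by exact: fE.
(* If the orbit reached the level [u1] at a finite time [t'], continuity from the left would give
   [phi t' q = gam u1], a critical point on a noncritical orbit. *)
have below t : 0 < t -> u1 < f (phi t q).
  move=> t0; rewrite ltNge; apply/negP => ft.
  have [|t' /andP[t'0 t't] Et'] := flow_IVT hM hf hphi (ltW t0) ft (u := u1).
    by rewrite flow0' fq2 ltW.
  have t'p : 0 < t'.
    rewrite lt_neqAle t'0 andbT; apply/eqP => t'E; move: Et'.
    by rewrite -t'E flow0' fq2 => E; move: u12; rewrite E ltxx.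
  have lim1 : phi t q @[t --> t'^'-] --> phi t' q.
    by apply: cvg_at_left_filter; exact: (flow_continuous_time hM hphi).
  have lim2 : phi t q @[t --> t'^'-] --> gam u1.
    move=> O nO; have [d d0 Hd] := lpath_cont H (ltW u1b) nO.
    have fl : f (phi t q) @[t --> t'^'-] --> u1.
      by rewrite -Et'; apply: cvg_at_left_filter; exact: (f_flow_continuous hM hf hphi).
    suff : \forall t \near t'^'-, O (phi t q) by [].
    near=> s.
    have t1 : s < t' by near: s; exact: nbhs_left_lt.
    have t2 : 0 < s by near: s; exact: nbhs_left_gt.
    have h1 : u1 < f (phi s q).
      by rewrite -Et'; exact: (f_flow_lt hM hf hg hX hphi).
    have h2 : f (phi s q) < b.
      apply: lt_trans u2b; rewrite -fq2 -[in ltRHS](flow0' q).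
      exact: (f_flow_lt hM hf hg hX hphi).
    rewrite -(gamE _ h1 h2); apply: Hd; first exact: ltW.
    by near: s; exact: (cvgr_dist_lt _ _ fl _ d0).
  have E := limit_unique hM lim1 lim2.
  by apply: nq; rewrite -(crit_flowE hM hg hX hphi (t := t') (x := q)) E.
exists q; split.
- exact: st.
- move=> O nO; have [d d0 Hd] := lpath_cont H (ltW u1b) nO.
  (* Once below the level [v], the orbit remains within [d / 2] of the level [u1], where continuity
     of [gam] puts it in [O]. *)
  pose v := Num.min u2 (u1 + d / 2).
  have v1 : u1 < v by rewrite lt_min u12 ltrDl divr_gt0.
  have v2 : v <= u2 by rewrite ge_min lexx.
  have vd : v <= u1 + d / 2 by rewrite ge_min lexx orbT.
  have [r r0 Er] := orb _ v1 (le_lt_trans v2 u2b).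
  suff : \forall t \near +oo, O (phi t q) by [].
  near=> t.
  have t0 : 0 < t by near: t; exact: (nbhs_pinfty_gt (num_real _)).
  have rt : r <= t by near: t; exact: (nbhs_pinfty_ge (num_real _)).
  have h1 := below _ t0.
  have h2 : f (phi t q) <= v.
    rewrite -(fE v v1 (le_lt_trans v2 u2b)) -Er.
    exact: (f_flow_le hM hf hg hX hphi).
  have h3 : f (phi t q) < b := le_lt_trans (le_trans h2 v2) u2b.
  rewrite -(gamE _ h1 h3); apply: Hd; first exact: ltW.
  by rewrite ler0_norm ?subr_le0 ?ltW// opprB; lra.
- by move=> u u1u ub; have [r _ <-] := orb _ u1u ub; exists r.
Unshelve. all: by end_near. Qed.

Lemma seq_max (s : seq R) : s != [::] -> exists2 m, m \in s & forall v, v \in s -> v <= m.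
Proof.
elim: s => // a s IH _; have [->|/IH[m ms mP]] := eqVneq s [::].
  by exists a; rewrite ?inE// => v; rewrite inE => /eqP ->.
have [am|/ltW ma] := leP a m.
  by exists m; rewrite ?inE ?ms ?orbT// => v; rewrite inE => /predU1P[->//|/mP].
by exists a; rewrite ?inE ?eqxx// => v; rewrite inE => /predU1P[->//|/mP/le_trans]; exact.
Qed.

Lemma component_of_crit y : crit A f y -> component A f (connected_component (crit A f) y).
Proof. by move=> Cy; exists y. Qed.

(** Induction on the number of critical values below [b]: the path is cut at the highest level
    [u1 < b] where it is critical, and each cut uses up a critical value. *)
Lemma level_path_broken gam b w : level_path gam b w ->
  exists2 ts, broken_from A f phi (gam b) ts w &
    forall u, f w <= u -> u <= b -> support_of phi (ts, w) (gam u).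
Proof.
have [CV CVE] := (finite_seqP _).1 (finite_critical_values hM hf hg hX hMB).
have CVP q : crit A f q -> f q \in CV.
  by move=> Cq; have : (f @` crit A f) (f q) by [exists q]; rewrite CVE.
pose below (c v : R) := v < c.
have [N] := ubnP (count (below b) CV).
elim: N b => // N IH b Nb H.
have wb := lpath_le H.
pose s := [seq v <- CV | [&& f w <= v, v < b & `[< crit A f (gam v) >]]].
have [s0|/seq_max[u1]] := eqVneq s [::].
  have nC u : f w <= u -> u < b -> ~ crit A f (gam u).
    move=> wu ub Cu; have : u \in s.
      rewrite mem_filter wu ub /=; apply/andP; split; first exact/asboolP.
      by rewrite -[u](lpath_f H wu (ltW ub)); exact: CVP.
    by rewrite s0.
  have gw : gam (f w) = w by exact: lpath_end H _ (lexx _).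
  have sw : starts phi w (gam b).
    by rewrite -[X in starts phi X _]gw; exact: (lpath_starts H).
  exists [::]; first by split => //; exact: lpath_crit H.
  move=> u wu; rewrite le_eqVlt => /predU1P[->|ub].
    by apply/(support_nil hM _ sw); left.
  apply/(support_nil hM _ sw); right.
  have [||r r0 Er] := flow_starts_IVT hM hf hphi (t := 0) (u := u) sw.
  - by rewrite flow0'.
  - by rewrite (lpath_f H).
  exists r => //; have [_] := lpath_back H wb r0 (u := f w).
  by rewrite gw Er.
rewrite mem_filter => /andP[/and3P[wu1 u1b /asboolP C1] u1CV] u1max.
have nC u : u1 < u -> u < b -> ~ crit A f (gam u).
  move=> u1u ub Cu; have wu : f w <= u by rewrite (le_trans wu1)// ltW.
  have : u \in s.
    rewrite mem_filter wu ub /=; apply/andP; split; first exact/asboolP.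
    by rewrite -[u](lpath_f H wu (ltW ub)); exact: CVP.
  by move=> /u1max; rewrite leNgt u1u.
have H1 := lpath_restrict H wu1 (ltW u1b) C1.
have lt1 : (count (below u1) CV < N)%N.
  rewrite ltnS in Nb; apply: leq_trans Nb.
  have cu1 : (0 < count (pred1 u1) CV)%N by rewrite -has_count has_pred1.
  have := count_predUI (below u1) (pred1 u1) CV.
  rewrite (@eq_count _ (predI _ _) pred0); last first.
    by move=> v /=; apply/negP => /andP[/[swap] /eqP ->]; rewrite /below ltxx.
  rewrite count_pred0 addn0 => E.
  have : (count (predU (below u1) (pred1 u1)) CV <= count (below b) CV)%N.
    by apply: sub_count => v; rewrite /= /below => /orP[/lt_trans|/eqP ->//]; exact.
  by rewrite E; apply: leq_trans; rewrite -addn1 leq_add2l.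
have [ts bts Sts] := IH _ lt1 H1.
have [q [sq eq orb]] := lpath_segment H wu1 u1b C1 nC.
have oq : orbit_of phi q q by exists 0 => //; rewrite flow0'.
exists (orbit_of phi q :: ts).
  split.
  - exists (connected_component (crit A f) (gam b)), (connected_component (crit A f) (gam u1)).
    have Cb := component_of_crit (lpath_crit H); have C1' := component_of_crit C1.
    split => //.
      (* The two components differ because [f] is constant on a component and [u1 < b]. *)
      move=> E; have : f (gam b) = f (gam u1).
        apply: (f_component hM hf hg hX hMB Cb).
          exact/connected_component_refl/lpath_crit/H.
        by rewrite E; exact: connected_component_refl.
      by rewrite !(lpath_f H)// ?(ltW u1b)// => E2; move: u1b; rewrite E2 ltxx.
    exists q => //; split; [exists (gam b) => //|exists (gam u1) => //].
      exact/connected_component_refl/lpath_crit/H.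
    exact: connected_component_refl.
  - by exists q.
  - by exists (gam u1) => //; exists q.
move=> u wu; rewrite le_eqVlt => /predU1P[->|ub].
  by apply/(support_cons hM hphi _ _ _ sq eq)/Or41.
apply/(support_cons hM hphi _ _ _ sq eq).
have [uu1|u1u] := leP u u1; first by apply: Or44; exact: Sts.
by apply: Or42; exact: orb.
Qed.

End paths.

Arguments level_path {R M} A f phi gam b w.

(** * Limits of broken trajectories along an ultrafilter *)

Section limit.
Context {R : realType} {M : topologicalType} {n : nat} {A : atlas R M}.
Arguments A : clear implicits.
Hypothesis hM : closed_manifold n A.
Context {f : M -> R} {g : M -> tvec R M -> tvec R M -> R} {X : M -> tvec R M}.
Hypothesis hf : forall p, smooth_near A f p.
Hypothesis hg : riemannian_metric A g.
Hypothesis hX : neg_gradient A g f X.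
Context {phi : R -> M -> M}.
Hypothesis hphi : is_flow A X phi.
Hypothesis hMB : morse_bott A f.

Lemma manifold_regular (p : M) (O : set M) : nbhs p O ->
  exists2 O', nbhs p O' & closure O' `<=` O.
Proof.
have nT : nbhs p [set: M] by exact: filterT.
exact: (compact_regular (manifold_hausdorff hM) (manifold_compact hM) nT).
Qed.

Section ultra.
Context {I : Type} {F : set_system I} {UF : UltraFilter F} {b : R}.
Context {y w : I -> M} {ts : I -> seq (set M)}.
Hypothesis by_ : forall i, broken_from A f phi (y i) (ts i) (w i).
Hypothesis yb : forall i, f (y i) = b.

Local Notation lp i u := (level_point f phi (ts i, w i) u).

(** Convergence at the single level [u] controls a whole interval of levels for almost all [i]. This
    gives the continuity of the limit as well as uniform convergence. *)
Lemma limit_equicontinuous (gam : R -> M) u (O : set M) :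
  lp i u @[i --> F] --> gam u -> u <= b -> nbhs (gam u) O ->
  exists2 d : R, 0 < d & \forall i \near F, forall u', u' <= b -> `|u - u'| < d ->
    O (lp i u').
Proof.
move=> Fu ub nO.
have [ O' nO' [d d0 Hd]] := level_point_equicontinuous hM hf hg hX hphi hMB nO.
have FO' : \forall i \near F, O' (lp i u) by exact: Fu.
exists d => //; apply: filterS FO' => i Oi u' u'b uu'.
by apply: (Hd (y i) (ts i) (w i) u u') => //; rewrite yb.
Qed.

Lemma limit_level_path : exists gam w0, [/\ level_path A f phi gam b w0,
  y i @[i --> F] --> gam b & forall u (O : set M), u <= b -> nbhs (gam u) O ->
  exists2 d : R, 0 < d & \forall i \near F, forall u', u' <= b -> `|u - u'| < d ->
    O (lp i u')].
Proof.
have cM := manifold_compact hM.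
(* The same ultrafilter converges at every level, so the limits are chosen level by level with no
   extraction. *)
have [gam gamP] : {gam : R -> M & forall u, lp i u @[i --> F] --> gam u}.
  apply: (@choice R M (fun u p => lp i u @[i --> F] --> p)) => u.
  exact: ultra_compact_cvg.
have [w0 w0P] := ultra_compact_cvg w cM UF.
exists gam, w0.
have eq u (O : set M) := @limit_equicontinuous gam u O (gamP u).
have yE i : lp i b = y i.
  by rewrite -(yb i); exact: (level_point_start hM hf hg hX hphi (by_ i)).
have yE' : (fun i => lp i b) = y by apply/funext.
have yP : y i @[i --> F] --> gam b.
  by have := gamP b; rewrite yE'.
have fw : f (w i) @[i --> F] --> f w0.
  exact: (continuous_cvg _ (@f_continuous _ _ _ _ hM _ hf w0) w0P).
have wE i : lp i (f (w i)) = w i.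
  by apply: (level_point_eq hM hf hg hX hphi (by_ i)); exact: support_end (broken_support hM hf hg hX hphi (by_ i)).
have wb i : f (w i) <= b.
  rewrite -(yb i); apply: (reach_le hM hf hg hX hphi).
  have H := broken_support hM hf hg hX hphi (by_ i).
  exact: support_to H _ (support_start H).
have w0b : f w0 <= b by apply: (cvgr_to_le fw); apply: filterE.
split => //.
split => //.
- have [clS _ _] := hMB.
  apply: (closed_cvg _ clS _ _ yP); apply: filterE => i.
  exact: (broken_crit hM hf hg hX hphi (by_ i)).
- move=> u ub.
  have l1 : f (lp i u) @[i --> F] --> f (gam u).
    exact: (continuous_cvg _ (@f_continuous _ _ _ _ hM _ hf _) (gamP u)).
  have l2 : f (lp i u) @[i --> F] --> Num.max u (f w0).
    apply/cvgrPdist_lt => e e0.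
    apply: filterS (cvgr_dist_lt _ _ fw _ e0) => i; apply: le_lt_trans.
    have [|_ ->] := level_pointP hM hf hg hX hphi (u := u) (by_ i); first by rewrite yb.
    rewrite /Order.max; case: ltP => h1; case: ltP => h2; rewrite ler_norml; apply/andP; split;
      have := ler_norm (f w0 - f (w i)); have := ler_norm (f (w i) - f w0);
      rewrite (distrC (f (w i))); lra.
  exact: (cvg_unique (@Rhausdorff R) l1 l2).
(* Either [u < f (w i)] and the path already rests at [w i], or [f (w i)] is within [d] of [u] and
   equicontinuity applies to the level of [w i]. *)
- move=> u uw0; have ub := le_trans uw0 w0b.
  apply: (limit_unique hM (F := w i @[i --> F])) w0P => O nO.
  have [d d0 Hd] := eq u O ub nO.
  have n1 : \forall i \near F, f w0 - d < f (w i) by apply: (cvgr_gt _ fw); lra.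
  apply: filterS (filterI Hd n1) => i [Hi fi].
  have [uw|wu] := ltP u (f (w i)).
    have := Hi u ub; rewrite subrr normr0 => /(_ d0).
    by rewrite {1}/level_point /= leNgt uw.
  have := Hi _ (wb i); rewrite wE; apply.
  by rewrite ger0_norm ?subr_ge0//; lra.
(* The point [phi s (lp i u)] lies on a level that varies with [i]; equicontinuity around the limit
   level compensates for this. *)
- move=> u s ub s0.
  have lpi : forall i, f (phi s (lp i u)) <= b /\
      lp i (f (phi s (lp i u))) = phi s (lp i u).
    move=> i; rewrite -(yb i).
    by apply: (level_point_flow hM hf hg hX hphi (by_ i)) => //; rewrite yb.
  have l1 : phi s (lp i u) @[i --> F] --> phi s (gam u).
    exact: (continuous_cvg _ (@flow_continuous _ _ _ _ hM _ _ hphi s _) (gamP u)).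
  have l2 : f (phi s (lp i u)) @[i --> F] --> f (phi s (gam u)).
    exact: (continuous_cvg _ (@f_continuous _ _ _ _ hM _ hf _) l1).
  have vb : f (phi s (gam u)) <= b.
    by apply: (cvgr_to_le l2); apply: filterE => i; case: (lpi i).
  split => //; apply: (limit_unique hM (F := phi s (lp i u) @[i --> F])) l1 => O nO.
  have [d d0 Hd] := eq _ O vb nO.
  apply: filterS (filterI Hd (cvgr_dist_lt _ _ l2 _ d0)) => i [Hi di].
  by have [vib E] := lpi i; have := Hi _ vib di; rewrite E.
(* Membership of the limit only follows for closed sets, hence a neighbourhood [O'] whose closure
   lies in [O]. *)
- move=> u O ub nO; have [ O' nO' O'O] := manifold_regular nO.
  have [d d0 Hd] := eq u O' ub nO'.
  exists d => // u' u'b uu'; apply: O'O.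
  apply: (closed_cvg _ (@closed_closure _ O') _ _ (gamP u')).
  by apply: filterS Hd => i /(_ u' u'b uu')/subset_closure.
Qed.

End ultra.

Lemma compact_What_component S : component A f S ->
  compact [set: initial_topology (fun x : What_at A f phi S =>
    @broken_path R M f phi S (set_val x))].
Proof.
move=> CS; rewrite compact_ultra => F UF _.
set beta := fun x : What_at A f phi S => _.
pose b := fval f S.
have xP (x : What_at A f phi S) : exists y, [/\ S y, f y = b &
    broken_from A f phi y (set_val x).1 (set_val x).2].
  have [y Sy br] : What_at A f phi S (set_val x) by exact: set_valP.
  by exists y; split => //; rewrite /b (fvalE hM hf hg hX hMB CS Sy).
have [y yP] := choice xP.
have by_ x : broken_from A f phi (y x) (set_val x).1 (set_val x).2 by have [] := yP x.
have yb x : f (y x) = b by have [] := yP x.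
have [gam [w0 [lpath ygam Hgam]]] := limit_level_path (F := F) by_ yb.
have Sb : S (gam b).
  apply: (closed_cvg _ (component_is_closed hMB CS) _ _ ygam).
  by apply: filterE => x; have [] := yP x.
have [ts0 br0 sup0] := level_path_broken hM hf hg hX hphi hMB lpath.
have W0 : What_at A f phi S (ts0, w0) by exists (gam b).
pose x0 : What_at A f phi S := SigSub (mem_set W0).
have betaE x t : beta x t = level_point f phi ((set_val x).1, (set_val x).2)
    (minf f + b - set_val t).
  by rewrite -surjective_pairing.
(* [gam] lies in the support of [x0] and [f] is injective there, so the path of [x0] is [gam] with
   the parameter reversed. *)
have beta0 t : minf f + b - set_val t <= b -> beta x0 t = gam (minf f + b - set_val t).
  move=> ub; rewrite betaE /=.
  have fb : f (gam b) = b by apply: (lpath_f lpath) => //; exact: lpath_le lpath.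
  have [wu|uw] := leP (f w0) (minf f + b - set_val t).
    by rewrite -[in LHS](lpath_f lpath wu ub); apply: (level_point_eq hM hf hg hX hphi br0); exact: sup0.
  by rewrite /level_point /= leNgt uw (lpath_end lpath)// ltW.
exists x0; split => // B; rewrite nbhsE => -[V [[D oD <-] Dx0] VB].
apply: filterS VB _.
have nD : nbhs (beta x0) D by apply: open_nbhs_nbhs.
have : beta x @[x --> F] --> beta x0; last by apply.
apply/compact_open_cvgP => K O cK oO KO.
have tb (t : `[minf f, fval f S]%classic) : minf f + b - set_val t <= b.
  have : `[minf f, fval f S]%classic (set_val t) by exact: set_valP.
  by rewrite /= in_itv /= => /andP[h _]; rewrite -/b; lra.
(* Each point of [K] has an interval on which almost all paths stay in [O]; compactness of [K] makes
   finitely many suffice. *)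
have /compact_near_coveringP/(_ _ F (fun x t => O (beta x t)) _) H := cK.
have : \forall x \near F, K `<=` (fun t => O (beta x t)).
  apply: H => t Kt.
  have nO : nbhs (gam (minf f + b - set_val t)) O.
    apply: open_nbhs_nbhs; split => //; rewrite -beta0//.
    by apply: KO; exists t.
  have [d d0 Hd] := Hgam _ O (tb t) nO.
  have nt : \forall t' \near t, `|set_val t - set_val t'| < d.
    have ct : set_val t' @[t' --> t] --> set_val t by exact: initial_continuous.
    exact: (cvgr_dist_lt _ _ ct _ d0).
  exists ([set t' | `|set_val t - set_val t'| < d], [set x | forall u', u' <= b ->
    `|minf f + b - set_val t - u'| < d ->
    O (level_point f phi ((set_val x).1, (set_val x).2) u')]) => //=.
  move=> [t' x] /= [tt' Hx]; rewrite betaE; apply: Hx => //.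
  by rewrite (_ : _ - _ = - (set_val t - set_val t')) ?normrN//; ring.
by apply: filterS => x Kx _ [t Kt <-]; exact: Kx.
Qed.

End limit.

Theorem proposition3 (R : realType) (M : topologicalType) (n : nat)
    (A : atlas R M) (f : M -> R) (g : M -> tvec R M -> tvec R M -> R)
    (X : M -> tvec R M) (phi : R -> M -> M)
    (hM : closed_manifold n A)
    (hf : forall p, smooth_near A f p)
    (hg : riemannian_metric A g)
    (hX : neg_gradient A g f X)
    (hphi : is_flow A X phi)
    (hMBS : morse_bott_smale A f g phi) :
  compact [set: What A f phi].
Proof.
have [hMB _ _] := hMBS.
(* Finitely many components have to be checked, each giving a compact summand. *)
apply: sigT_compact => [|S]; last first.
  by apply: (compact_What_component hM hf hg hX hphi hMB); exact: set_valP.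
rewrite (_ : [set: _] = set_val @^-1` component A f); last first.
  by apply/seteqP; split => // S _; exact: set_valP.
apply: finite_preimage; last exact: (finite_components hM hMB).
by move=> S S' _ _; exact: val_inj.
Qed.
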